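(* Let $I$ be a prime ideal of $\mathbb{Z}[i]$ whose quotient field $\mathbb{Z}[i]/I=F_q$ has $q$ elements, characteristic not $2$, and $q>5$. Let $X$ be the finite CW complex obtained from the tiling of $\mathbb{H}^3/\Gamma_0(I)$ by ideal octahedra by one-point compactifying each cusp (adding one point per cusp, which become the vertices, so that each ideal octahedron becomes a closed octahedral $3$-cell together with its faces and edges). Then $X$ is a strongly regular cellulation.
   Context: $\Gamma=PSL_2(\mathbb{Z}[i])$ acts on hyperbolic $3$-space $\mathbb{H}^3$ (upper half-space model $\mathbb{C}\times(0,\infty)$) by orientation-preserving isometries extending Möbius transformations on $\mathbb{C}\cup\{\infty\}$. Let $T$ be the ideal hyperbolic octahedron with ideal vertices $0,1,1+i,i,\infty,\frac12+\frac12 i$, with antipodal pairs $\{\infty,\frac12+\frac12 i\}$, $\{0,1+i\}$, $\{1,i\}$ and edges the geodesics joining non-antipodal vertices. The images $\{g(T):g\in\Gamma\}$ tile $\mathbb{H}^3$. $\Gamma_0(I)$ is the kernel of the natural surjection $PSL_2(\mathbb{Z}[i])\to PSL_2(\mathbb{Z}[i]/I)$; it is torsion-free and the tiling descends to a tiling of $\mathbb{H}^3/\Gamma_0(I)$ by ideal octahedra. Cusps of $\mathbb{H}^3/\Gamma_0(I)$ are the $\Gamma_0(I)$-orbits of the ideal vertices of the tiling. A cellulation of a space $M$ is a finite CW complex with underlying space $M$; it is regular if all closed cells are embedded, and strongly regular if moreover the intersection of any two closed cells is a closed cell (or empty). *)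

(* Defs.v *)
From HB Require Import structures.
From mathcomp Require Import all_boot all_order all_algebra.
From mathcomp Require Import ring_quotient generic_quotient complex.
From mathcomp Require Import all_classical all_reals all_analysis.

Set Implicit Arguments.
Unset Strict Implicit.
Unset Printing Implicit Defensive.

Import Order.TTheory GRing.Theory Num.Theory.
Import numFieldNormedType.Exports.

Local Open Scope ring_scope.
Local Open Scope complex_scope.
Local Open Scope classical_set_scope.
Local Open Scope quotient_scope.

Definition gauss_int (R : realType) : {pred R[i]} :=
  [pred z | (complex.Re z \is a Num.int) && (complex.Im z \is a Num.int)].

Fact gauss_int_subring (R : realType) : subring_closed (@gauss_int R).
Proof.
split=> [|[a b] [c d]|[a b] [c d]].
- by rewrite inE /= rpred0 rpred1.
- by rewrite !inE /= => /andP[? ?] /andP[? ?]; rewrite !rpredB.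
- by rewrite !inE /= => /andP[? ?] /andP[? ?]; rewrite rpredB ?rpredD ?rpredM.
Qed.
HB.instance Definition _ (R : realType) :=
  GRing.isSubringClosed.Build R[i] (@gauss_int R) (@gauss_int_subring R).

(* Z[i], as a subring of the field R[i] of complex numbers over R. *)
Record Zi (R : realType) := GaussInt {
  Zi_val :> R[i];
  _ : Zi_val \in @gauss_int R }.
HB.instance Definition _ (R : realType) := [isSub for @Zi_val R].
HB.instance Definition _ (R : realType) := [Choice of Zi R by <:].
HB.instance Definition _ (R : realType) :=
  [SubChoice_isSubComNzRing of Zi R by <:].

Definition SL2 (K : comPzRingType) : set 'M[K]_2 := [set A | \det A = 1].

(* An element of PSL_2(K) is represented by a matrix of SL2 K, and two such
   matrices represent the same element when they are equal up to sign. *)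
Definition PSL2_eq (K : comPzRingType) (A B : 'M[K]_2) : Prop :=
  A = B \/ A = - B.

(* The matrices representing an element of the kernel of
   PSL_2(Z[i]) -> PSL_2(Z[i]/I), i.e. those congruent to 1 or to -1 mod I. *)
Definition Gamma0 (R : realType) (I : prime_idealr (Zi R)) : set 'M[Zi R]_2 :=
  [set A | SL2 A /\ PSL2_eq (map_mx \pi_({ideal_quot I}) A) 1%:M].

Definition sqnorm (R : realType) (z : R[i]) : R :=
  complex.Re z ^+ 2 + complex.Im z ^+ 2.

(* inl (z, t) is the point (z, t) of C x R, in the upper half-space when
   0 < t; inr (Some z) is the boundary point z and inr None is infinity. *)
Definition bpoint (R : realType) : Type := (R[i] * R + option R[i])%type.
HB.instance Definition _ (R : realType) := Choice.on (bpoint R).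

(* Poincare extension of the Moebius transformation given by A. *)
Definition poincare (R : realType) (A : 'M[R[i]]_2) (p : R[i] * R) : R[i] * R :=
  let: (z, t) := p in
  let w := A 1 0 * z + A 1 1 in
  let n := sqnorm w + sqnorm (A 1 0) * t ^+ 2 in
  (((A 0 0 * z + A 0 1) * w^* + A 0 0 * (A 1 0)^* * (t ^+ 2)%:C) / n%:C,
   t / n).

Definition moebius (R : realType) (A : 'M[R[i]]_2) (u : option R[i]) :
    option R[i] :=
  match u with
  | None => if A 1 0 == 0 then None else Some (A 0 0 / A 1 0)
  | Some z => if A 1 0 * z + A 1 1 == 0 then None
              else Some ((A 0 0 * z + A 0 1) / (A 1 0 * z + A 1 1))
  end.

Definition act (R : realType) (A : 'M[Zi R]_2) (p : bpoint R) : bpoint R :=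
  let AC := map_mx (@Zi_val R) A in
  match p with
  | inl q => inl (poincare AC q)
  | inr u => inr (moebius AC u)
  end.

(* The vertices of the octahedron: (k, false) and (k, true) are antipodal. *)
Definition octv : finType := ('I_3 * bool)%type.

Definition octv_pos (R : realType) (v : octv) : option R[i] :=
  match val v.1, v.2 with
  | 0%N, false => None                 (* infinity *)
  | 0%N, true  => Some (2^-1 +i* 2^-1)
  | 1%N, false => Some (0 +i* 0)
  | 1%N, true  => Some (1 +i* 1)
  | _, false   => Some (1 +i* 0)
  | _, true    => Some (0 +i* 1)
  end.

(* The vertex sets of the nonempty faces: the octahedron itself, and the sets
   without antipodal pairs (6 vertices, 12 edges and 8 triangles). *)
Definition oct_face (S : {set octv}) : bool :=
  (S == finset.setTfor octv) ||
  (S != finset.set0) && [forall k, ~~ (((k, false) \in S) && ((k, true) \in S))].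

Definition face_dim (S : {set octv}) : nat :=
  if S == finset.setTfor octv then 3%N else #|S|.-1.

(* The hyperboloid (Minkowski) model: (z, t) goes to the timelike vector
   (|z|^2 + t^2, Re z, Im z, 1), for the quadratic form a d - x^2 - y^2 on
   vectors (a, x, y, d), and a boundary point to a lightlike vector. Only the
   rays spanned by these vectors matter. *)
Definition mink (R : realType) (p : bpoint R) : 'rV[R]_4 :=
  let v := match p with
    | inl (z, t) => [:: sqnorm z + t ^+ 2; complex.Re z; complex.Im z; 1]
    | inr (Some z) => [:: sqnorm z; complex.Re z; complex.Im z; 1]
    | inr None => [:: 1; 0; 0; 0]
    end in \row_j v`_j.

Definition in_Hstar (R : realType) (p : bpoint R) : Prop :=
  match p with
  | inl (_, t) => 0 < t
  | inr u => exists A v, SL2 A /\ inr u = act A (inr (octv_pos R v))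
  end.

Definition Hstar (R : realType) : Type := {p : bpoint R | `[< in_Hstar p >]}.
HB.instance Definition _ (R : realType) := SubType.on (Hstar R).
HB.instance Definition _ (R : realType) := Choice.on (Hstar R).

(* The points (z, t) of a horoball at the boundary point u. *)
Definition horoball (R : realType) (u : option R[i]) (r : R) : set (R[i] * R) :=
  [set p | match u with
    | None => p.2^-1 < r
    | Some w => sqnorm (p.1 - w) + p.2 ^+ 2 < r * p.2
    end].

(* The usual topology on the upper half-space; the horoballs at an ideal
   vertex, with this vertex added, are a basis of its neighborhoods. In the
   quotient by Gamma_0(I) a horoball at an ideal vertex becomes an end
   (torus) x [0, +oo[, and this is the topology which compactifies each such
   end by one point. *)
Definition Hstar_open (R : realType) (U : set (Hstar R)) : Prop :=
  forall x, U x ->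
    match val x with
    | inl (z, t) => exists2 e : R, 0 < e &
        forall (y : Hstar R) z' t', val y = inl (z', t') ->
          sqnorm (z' - z) + (t' - t) ^+ 2 < e ^+ 2 -> U y
    | inr u => exists2 r : R, 0 < r &
        forall (y : Hstar R) q, val y = inl q -> horoball u r q -> U y
    end.

Fact Hstar_openT (R : realType) : @Hstar_open R setT.
Proof. by move=> x _; case: (val x) => [[z t]|u]; exists 1. Qed.

Fact Hstar_openI (R : realType) : setI_closed (@Hstar_open R).
Proof.
move=> U V oU oV x [Ux Vx]; move: (oU x Ux) (oV x Vx).
case: (val x) => [[z t]|u] [e e0 He] [f f0 Hf].
- exists (Num.min e f) => [|y z' t' yE lt]; first by rewrite lt_min e0 f0.
  have lexn (g : R) : 0 < g -> Num.min e f <= g ->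
      sqnorm (z' - z) + (t' - t) ^+ 2 < g ^+ 2.
    move=> g0 leg; apply: lt_le_trans lt _.
    by rewrite lerXn2r // nnegrE ?(ltW g0) // le_min !ltW.
  by split; [apply: (He _ _ _ yE)|apply: (Hf _ _ _ yE)]; apply: lexn => //;
    rewrite ge_min lexx ?orbT.
- exists (Num.min e f) => [|y q yE]; first by rewrite lt_min e0 f0.
  have q0 : 0 < q.2 by have /asboolP := valP y; rewrite yE; case: (q).
  move=> hq; split; [apply: (He _ _ yE)|apply: (Hf _ _ yE)]; move: hq;
    rewrite /horoball /=; case: u {He Hf} => [w|];
    do ?[move=> hq; apply: lt_le_trans hq _; rewrite ?ler_pM2r //];
    by rewrite ge_min lexx ?orbT.
Qed.

Fact Hstar_open_bigU (R : realType) (J : Type) (f : J -> set (Hstar R)) :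
  (forall j, Hstar_open (f j)) -> Hstar_open (\bigcup_j f j).
Proof.
move=> of_ x [j _ fx]; move: (of_ j x fx).
case: (val x) => [[z t]|u] [e e0 He]; exists e => //.
- by move=> y z' t' yE hy; exists j => //; apply: He yE hy.
- by move=> y q yE hy; exists j => //; apply: He yE hy.
Qed.

HB.instance Definition _ (R : realType) :=
  @isOpenTopological.Build (Hstar R) (@Hstar_open R)
    (@Hstar_openT R) (@Hstar_openI R) (@Hstar_open_bigU R).

(* The hyperbolic convex hull of the vertices in S (these vertices included),
   and its relative interior. Hyperbolic convex hulls are cut out by convex
   cones in the Minkowski model, so S = {u, v} gives the geodesic from u to v
   and S = octv gives the octahedron T. *)
Definition hull (R : realType) (S : {set octv}) : set (Hstar R) :=
  [set x | exists2 w : octv -> R, (forall v, v \in S -> 0 <= w v) &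
    mink (val x) = \sum_(v in S) w v *: mink (inr (octv_pos R v))].

Definition open_hull (R : realType) (S : {set octv}) : set (Hstar R) :=
  [set x | exists2 w : octv -> R, (forall v, v \in S -> 0 < w v) &
    mink (val x) = \sum_(v in S) w v *: mink (inr (octv_pos R v))].

Definition orbit0 (R : realType) (I : prime_idealr (Zi R)) (x : Hstar R) :
    set (Hstar R) :=
  [set y | exists2 A, Gamma0 I A & val y = act A (val x)].

Definition same_orbit (R : realType) (I : prime_idealr (Zi R)) : rel (Hstar R) :=
  fun x y => `[< orbit0 I x = orbit0 I y >].

Fact same_orbit_refl (R : realType) (I : prime_idealr (Zi R)) :
  reflexive (same_orbit I).
Proof. by move=> x; apply/asboolP. Qed.

Fact same_orbit_sym (R : realType) (I : prime_idealr (Zi R)) :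
  symmetric (same_orbit I).
Proof. by move=> x y; apply: asbool_equiv_eq; split=> ->. Qed.

Fact same_orbit_trans (R : realType) (I : prime_idealr (Zi R)) :
  transitive (same_orbit I).
Proof. by move=> y x z /asboolP xy /asboolP yz; apply/asboolP; rewrite xy. Qed.

Canonical same_orbit_equiv (R : realType) (I : prime_idealr (Zi R)) :=
  EquivRel (same_orbit I) (@same_orbit_refl R I) (@same_orbit_sym R I)
    (@same_orbit_trans R I).

Definition cusped_quotient (R : realType) (I : prime_idealr (Zi R)) : topologicalType :=
  quotient_topology {eq_quot (same_orbit I)}.

Definition proj_quotient (R : realType) (I : prime_idealr (Zi R)) (x : Hstar R) : cusped_quotient I :=
  \pi_({eq_quot (same_orbit I)}) x.

Definition disk (R : realType) n : set 'rV[R]_n :=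
  [set x | \sum_i x 0 i ^+ 2 <= 1].

Definition open_disk (R : realType) n : set 'rV[R]_n :=
  [set x | \sum_i x 0 i ^+ 2 < 1].

Definition homeo_onto (T U : topologicalType) (A : set T) (B : set U)
    (f : T -> U) : Prop :=
  set_bij A B f /\ {within A, continuous f} /\
  exists2 g : U -> T, {within B, continuous g} & {in A, cancel f g}.

(* A finite CW structure on T is given by a family of characteristic maps:
   f in Phi n is a characteristic map disk n -> T of the open n-cell
   f (open_disk n), and only the restriction of f to disk n matters. The
   family may contain several characteristic maps of the same cell. Since
   there are finitely many cells and T is Hausdorff, T automatically has the
   weak topology. *)
Record finite_CW (R : realType) (T : topologicalType)
    (Phi : forall n, set ('rV[R]_n -> T)) : Prop := FiniteCW {
  CW_hausdorff : hausdorff_space T ;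
  CW_finite : finite_set [set c : nat * set T |
    exists2 f, Phi c.1 f & c.2 = f @` @open_disk R c.1] ;
  CW_cover : forall x : T,
    exists n, exists2 f, Phi n f & (f @` @open_disk R n) x ;
  CW_disjoint : forall n m f g, Phi n f -> Phi m g ->
    (f @` @open_disk R n) `&` (g @` @open_disk R m) !=set0 ->
    n = m /\ f @` @open_disk R n = g @` @open_disk R m ;
  CW_continuous : forall n f, Phi n f -> {within @disk R n, continuous f} ;
  CW_interior : forall n f, Phi n f ->
    homeo_onto (@open_disk R n) (f @` @open_disk R n) f ;
  CW_boundary : forall n f, Phi n f -> forall x, (@disk R n `\` @open_disk R n) x ->
    exists m, (m < n)%N /\ exists2 g, Phi m g & (g @` @open_disk R m) (f x) }.

Definition regular_cellulation (R : realType) (T : topologicalType)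
    (Phi : forall n, set ('rV[R]_n -> T)) : Prop :=
  finite_CW Phi /\
  forall n f, Phi n f -> homeo_onto (@disk R n) (f @` @disk R n) f.

Definition strongly_regular_cellulation (R : realType) (T : topologicalType)
    (Phi : forall n, set ('rV[R]_n -> T)) : Prop :=
  regular_cellulation Phi /\
  forall n m f g, Phi n f -> Phi m g ->
    (f @` @disk R n) `&` (g @` @disk R m) = set0 \/
    exists k, exists2 h, Phi k h &
      (f @` @disk R n) `&` (g @` @disk R m) = h @` @disk R k.

(* The face of the tile A(T) with vertices A(S), as a subset of Hstar. *)
Definition tile_face (R : realType) (A : 'M[Zi R]_2) (S : {set octv}) :
    set (Hstar R) :=
  [set x | exists2 y, hull S y & val x = act A (val y)].

Definition open_tile_face (R : realType) (A : 'M[Zi R]_2) (S : {set octv}) :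
    set (Hstar R) :=
  [set x | exists2 y, open_hull S y & val x = act A (val y)].

(* The characteristic maps of the n-cells: all the maps disk n -> cusped_quotient I which
   factor as a parametrization psi of an n-dimensional closed face of a tile,
   ideal vertices included, followed by the projection. *)
Definition tiling_cells (R : realType) (I : prime_idealr (Zi R)) (n : nat) :
    set ('rV[R]_n -> cusped_quotient I) :=
  [set f | exists (A : 'M[Zi R]_2) (S : {set octv}) (psi : 'rV[R]_n -> Hstar R),
    [/\ SL2 A, oct_face S /\ face_dim S = n,
        homeo_onto (@disk R n) (tile_face A S) psi,
        psi @` @open_disk R n = open_tile_face A S &
        f = @proj_quotient R I \o psi]].

(* Main.v *)
(** In the Minkowski model, the ideal points are the light rays, and a primitive
vector v of Z[i]^2 gives a light vector V(v) with B(V(u), V(v)) = |det(u, v)|^2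
up to a constant factor. The pairing ell with the center of T is at least 1 on
all the V(v), with equality exactly at the vertices of T. Hence a relation
between positive combinations of vertices of two octahedra only involves common
vertices: two tiles meet along a common face. Every point is in a tile, as ell
attains its minimum on the orbit of the point.

The determinants of vertices of one octahedron have norm at most 2, so that, as
q > 5, congruences modulo I between such determinants are equalities. Therefore
one element of the kernel realises all the identifications between two closed
tiles, which are thus embedded and meet along one closed face. Small balls and
horoballs separate the orbits, so the quotient is Hausdorff, and the continuous
bijections from the compact polytopes onto the closed cells are homeomorphisms. *)

Require Import Defs.
From HB Require Import structures.
From mathcomp Require Import all_boot all_order all_algebra.
From mathcomp Require Import ring_quotient generic_quotient complex.
From mathcomp Require Import all_classical all_reals all_analysis.
From mathcomp Require Import ring lra zify.

Set Implicit Arguments.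
Unset Strict Implicit.
Unset Printing Implicit Defensive.

Import Order.TTheory GRing.Theory Num.Theory.
Import numFieldNormedType.Exports.

Local Open Scope ring_scope.
Local Open Scope classical_set_scope.

(** The group acts linearly on the Minkowski model, but [mink] is normalised; points are therefore
    compared through rays, and positive scale factors are carried along. A vertex determines its
    primitive vector only up to a unit of Z[i], and an element of the kernel is known only up to
    sign, so congruences of vectors hold after unit factors have been put in. A linear map is fixed
    by two vectors, and it is integral at once if their determinant is a unit. Antipodal vertices
    are the obstacle: their determinant has norm 2, and integrality is recovered because they agree
    modulo 1 + i. The bound on q comes from differences of two determinants: their coordinates are
    at most 2 in absolute value, so a nonzero one has as norm 5 or a power of 2. Balls parametrize
    faces through flat polytopes, slices of cones, whose topology near a vertex has to be matched
    with horoballs. The Hausdorff property is proved for the quotient, and a face upstairs inherits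
    its homeomorphism from the composite with the projection. *)

(** * Arithmetic of Gaussian integers in real coordinates *)

Definition zre (R : realType) (z : Zi R) : R := complex.Re (Zi_val z).
Definition zim (R : realType) (z : Zi R) : R := complex.Im (Zi_val z).

Lemma zreD (R : realType) (z w : Zi R) : zre (z + w) = zre z + zre w.
Proof. by case: z w => [[a b] ?] [[c d] ?]. Qed.
Lemma zimD (R : realType) (z w : Zi R) : zim (z + w) = zim z + zim w.
Proof. by case: z w => [[a b] ?] [[c d] ?]. Qed.
Lemma zreN (R : realType) (z : Zi R) : zre (- z) = - zre z.
Proof. by case: z => [[a b] ?]. Qed.
Lemma zimN (R : realType) (z : Zi R) : zim (- z) = - zim z.
Proof. by case: z => [[a b] ?]. Qed.
Lemma zreM (R : realType) (z w : Zi R) :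
  zre (z * w) = zre z * zre w - zim z * zim w.
Proof. by case: z w => [[a b] ?] [[c d] ?]. Qed.
Lemma zimM (R : realType) (z w : Zi R) :
  zim (z * w) = zre z * zim w + zim z * zre w.
Proof. by case: z w => [[a b] ?] [[c d] ?]. Qed.
Lemma zre0 (R : realType) : zre (0 : Zi R) = 0. Proof. by []. Qed.
Lemma zim0 (R : realType) : zim (0 : Zi R) = 0. Proof. by []. Qed.
Lemma zre1 (R : realType) : zre (1 : Zi R) = 1. Proof. by []. Qed.
Lemma zim1 (R : realType) : zim (1 : Zi R) = 0. Proof. by []. Qed.
Definition zE := (zreD, zimD, zreN, zimN, zreM, zimM, zre0, zim0, zre1, zim1).

Lemma zi_eqP (R : realType) (z w : Zi R) :
  zre z = zre w -> zim z = zim w -> z = w.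
Proof.
case: z w => [[a b] ?] [[c d] ?]; rewrite /zre /zim /= => ac bd.
by apply/val_inj => /=; rewrite ac bd.
Qed.

Lemma zre_int (R : realType) (z : Zi R) : zre z \is a Num.int.
Proof. by have := valP z; rewrite inE => /andP[]. Qed.
Lemma zim_int (R : realType) (z : Zi R) : zim z \is a Num.int.
Proof. by have := valP z; rewrite inE => /andP[]. Qed.

Definition zn (R : realType) (z : Zi R) : R := zre z ^+ 2 + zim z ^+ 2.

Lemma zn_ge0 (R : realType) (z : Zi R) : 0 <= zn z.
Proof. by rewrite addr_ge0 ?sqr_ge0. Qed.

Lemma znM (R : realType) (z w : Zi R) : zn (z * w) = zn z * zn w.
Proof. by rewrite /zn !zE; ring. Qed.
Lemma znN (R : realType) (z : Zi R) : zn (- z) = zn z.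
Proof. by rewrite /zn !zE; ring. Qed.
Lemma zn1 (R : realType) : zn (1 : Zi R) = 1.
Proof. by rewrite /zn !zE; ring. Qed.

Lemma zn_eq0 (R : realType) (z : Zi R) : zn z = 0 -> z = 0.
Proof.
rewrite /zn => /eqP; rewrite paddr_eq0 ?sqr_ge0 // !sqrf_eq0.
by case/andP=> /eqP h1 /eqP h2; apply: zi_eqP.
Qed.

Lemma zn_int (R : realType) (z : Zi R) : zn z \is a Num.int.
Proof. by rewrite rpredD // rpredX // ?zre_int ?zim_int. Qed.

Lemma int_gt0_ge1 (R : realType) (x : R) : x \is a Num.int -> 0 < x -> 1 <= x.
Proof. by move=> /intrP[k ->]; rewrite ltr0z ler1z. Qed.

Lemma zn_ge1 (R : realType) (z : Zi R) : z != 0 -> 1 <= zn z.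
Proof.
move=> z0; apply: int_gt0_ge1; first exact: zn_int.
by rewrite lt_def zn_ge0 andbT; apply: contraNneq z0 => /zn_eq0 ->.
Qed.

Lemma zi_integral (R : realType) (z w : Zi R) : z * w = 0 -> z = 0 \/ w = 0.
Proof.
move=> /(congr1 (@zn R)); rewrite znM {3}/zn !zE expr0n addr0 => /eqP.
by rewrite mulf_eq0 => /orP[]/eqP/zn_eq0; [left|right].
Qed.

(** * Hermitian matrices as Minkowski space, with the action of SL_2 *)

Definition x0 : 'I_4 := @Ordinal 4 0 isT.
Definition x1 : 'I_4 := @Ordinal 4 1 isT.
Definition x2 : 'I_4 := @Ordinal 4 2 isT.
Definition x3 : 'I_4 := @Ordinal 4 3 isT.

Definition mk4 (R : realType) (a x y d : R) : 'rV[R]_4 :=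
  \row_j [:: a; x; y; d]`_j.

Lemma mk4_0 (R : realType) (a x y d : R) : mk4 a x y d 0 x0 = a.
Proof. by rewrite mxE. Qed.
Lemma mk4_1 (R : realType) (a x y d : R) : mk4 a x y d 0 x1 = x.
Proof. by rewrite mxE. Qed.
Lemma mk4_2 (R : realType) (a x y d : R) : mk4 a x y d 0 x2 = y.
Proof. by rewrite mxE. Qed.
Lemma mk4_3 (R : realType) (a x y d : R) : mk4 a x y d 0 x3 = d.
Proof. by rewrite mxE. Qed.
Definition mk4E := (mk4_0, mk4_1, mk4_2, mk4_3).

Lemma row4P (R : realType) (m n : 'rV[R]_4) : m 0 x0 = n 0 x0 ->
  m 0 x1 = n 0 x1 -> m 0 x2 = n 0 x2 -> m 0 x3 = n 0 x3 -> m = n.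
Proof.
move=> h0 h1 h2 h3; apply/rowP => -[[|[|[|[|//]]]] h].
- by rewrite (_ : Ordinal h = x0) //; apply: val_inj.
- by rewrite (_ : Ordinal h = x1) //; apply: val_inj.
- by rewrite (_ : Ordinal h = x2) //; apply: val_inj.
- by rewrite (_ : Ordinal h = x3) //; apply: val_inj.
Qed.

(* The Hermitian matrix [[a, x + iy], [x - iy, d]] is the vector (a, x, y, d);
   [qf] is its determinant, and A acts on it by M |-> A M A^*. *)
Definition qf (R : realType) (m : 'rV[R]_4) : R :=
  m 0 x0 * m 0 x3 - m 0 x1 ^+ 2 - m 0 x2 ^+ 2.

(** The polarization [qf (m + n) - qf m - qf n]; without the usual factor 1/2, it is integral on
    integral vectors. *)
Definition polar (R : realType) (m n : 'rV[R]_4) : R :=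
  m 0 x0 * n 0 x3 + m 0 x3 * n 0 x0 - 2 * (m 0 x1 * n 0 x1 + m 0 x2 * n 0 x2).

Definition rho (R : realType) (A : 'M[Zi R]_2) (m : 'rV[R]_4) : 'rV[R]_4 :=
  let a := m 0 x0 in let x := m 0 x1 in let y := m 0 x2 in let d := m 0 x3 in
  let ar := zre (A 0 0) in let ai := zim (A 0 0) in
  let br := zre (A 0 1) in let bi := zim (A 0 1) in
  let cr := zre (A 1 0) in let ci := zim (A 1 0) in
  let dr := zre (A 1 1) in let di := zim (A 1 1) in
  mk4 (zn (A 0 0) * a + zn (A 0 1) * d
        + 2 * ((ar * br + ai * bi) * x - (ai * br - ar * bi) * y))
      ((ar * cr + ai * ci) * a + (br * dr + bi * di) * d
        + (ar * dr + ai * di) * x - (ai * dr - ar * di) * y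
        + (br * cr + bi * ci) * x + (bi * cr - br * ci) * y)
      ((ai * cr - ar * ci) * a + (bi * dr - br * di) * d
        + (ar * dr + ai * di) * y + (ai * dr - ar * di) * x
        - (br * cr + bi * ci) * y + (bi * cr - br * ci) * x)
      (zn (A 1 0) * a + zn (A 1 1) * d
        + 2 * ((cr * dr + ci * di) * x - (ci * dr - cr * di) * y)).

(** The Hermitian matrix v v^* of rank one, which A sends to (A v)(A v)^*. *)
Definition lightvec (R : realType) (v : 'cV[Zi R]_2) : 'rV[R]_4 :=
  let p := v 0 0 in let r := v 1 0 in
  mk4 (zn p) (zre p * zre r + zim p * zim r) (zim p * zre r - zre p * zim r)
      (zn r).

Definition det2 (R : realType) (u v : 'cV[Zi R]_2) : Zi R :=
  u 0 0 * v 1 0 - u 1 0 * v 0 0.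

Lemma colE (R : realType) (A : 'M[Zi R]_2) (v : 'cV[Zi R]_2) i :
  (A *m v) i 0 = A i 0 * v 0 0 + A i 1 * v 1 0.
Proof. by rewrite mxE big_ord_recl big_ord1 (_ : lift _ _ = 1) //; apply: val_inj. Qed.

Lemma mul2E (R : realType) (A B : 'M[Zi R]_2) i j :
  (A *m B) i j = A i 0 * B 0 j + A i 1 * B 1 j.
Proof. by rewrite mxE big_ord_recl big_ord1 (_ : lift _ _ = 1) //; apply: val_inj. Qed.

Lemma rho_lightvec (R : realType) (A : 'M[Zi R]_2) (v : 'cV[Zi R]_2) :
  rho A (lightvec v) = lightvec (A *m v).
Proof.
apply: row4P; rewrite /rho /lightvec !mk4E !colE /zn !zE; ring.
Qed.

Lemma polar_lightvec (R : realType) (u v : 'cV[Zi R]_2) :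
  polar (lightvec u) (lightvec v) = zn (det2 u v).
Proof. by rewrite /polar /lightvec !mk4E /zn /det2 !zE; ring. Qed.

Lemma rho_mul (R : realType) (A B : 'M[Zi R]_2) m :
  rho A (rho B m) = rho (A *m B) m.
Proof.
apply: row4P; rewrite /rho !mk4E !mul2E /zn !zE; ring.
Qed.

Lemma det_mx22 (K : comPzRingType) (A : 'M[K]_2) :
  \det A = A 0 0 * A 1 1 - A 0 1 * A 1 0.
Proof.
rewrite (expand_det_row _ 0) big_ord_recl big_ord1 /cofactor !det_mx11 !mxE.
rewrite (_ : lift 0 (0 : 'I_1) = 1 :> 'I_2); last exact: val_inj.
rewrite (_ : lift 1 (0 : 'I_1) = 0 :> 'I_2); last exact: val_inj.
by rewrite /= !mulN1r !mul1r ?mulrN ?expr0 ?expr1 ?mul1r ?mulN1r ?mulrN.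
Qed.

Lemma rho_qf (R : realType) (A : 'M[Zi R]_2) m : SL2 A -> qf (rho A m) = qf m.
Proof.
rewrite /SL2 /= det_mx22 => dA.
(* Writing a factor 1 as |det A|^2 turns the goal into a polynomial identity that holds for every
   A. *)
rewrite -[RHS]mul1r -(zn1 R) -dA /zn !zE /qf /rho !mk4E /zn; ring.
Qed.

Lemma rho_polar (R : realType) (A : 'M[Zi R]_2) m n : SL2 A ->
  polar (rho A m) (rho A n) = polar m n.
Proof.
rewrite /SL2 /= det_mx22 => dA.
rewrite -[RHS]mul1r -(zn1 R) -dA /zn !zE /polar /rho !mk4E /zn; ring.
Qed.

(** * Moebius maps and their extensions are linear up to a positive scale *)

Lemma complexM (R : realType) (a b c d : R) :
  Complex a b * Complex c d = Complex (a * c - b * d) (a * d + b * c).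
Proof. by []. Qed.

Lemma complexD (R : realType) (a b c d : R) :
  Complex a b + Complex c d = Complex (a + c) (b + d).
Proof. by []. Qed.

Lemma sumsq_eq0 (R : realType) (a b : R) :
  (a ^+ 2 + b ^+ 2 == 0) = (a == 0) && (b == 0).
Proof. by rewrite paddr_eq0 ?sqr_ge0 // !sqrf_eq0. Qed.

Lemma sumsq_ge0 (R : realType) (a b : R) : 0 <= a ^+ 2 + b ^+ 2.
Proof. by rewrite addr_ge0 ?sqr_ge0. Qed.

Lemma complex_eq0 (R : realType) (a b : R) :
  (Complex a b == 0) = (a ^+ 2 + b ^+ 2 == 0).
Proof. by rewrite sumsq_eq0 eq_complex. Qed.

Lemma complexV (R : realType) (a b : R) : a ^+ 2 + b ^+ 2 != 0 ->
  (Complex a b)^-1 = Complex (a / (a ^+ 2 + b ^+ 2)) (- (b / (a ^+ 2 + b ^+ 2))).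
Proof.
move=> n0; have z0 : Complex a b != 0 by rewrite complex_eq0.
by apply: (mulfI z0); rewrite mulfV.
Qed.

Lemma Zi_valE (R : realType) (z : Zi R) : Zi_val z = Complex (zre z) (zim z).
Proof. by case: z => [[a b] ?]. Qed.

Lemma SL2E (R : realType) (A : 'M[Zi R]_2) : SL2 A <->
  zre (A 0 0) * zre (A 1 1) - zim (A 0 0) * zim (A 1 1)
  - (zre (A 0 1) * zre (A 1 0) - zim (A 0 1) * zim (A 1 0)) = 1 /\
  zre (A 0 0) * zim (A 1 1) + zim (A 0 0) * zre (A 1 1)
  - (zre (A 0 1) * zim (A 1 0) + zim (A 0 1) * zre (A 1 0)) = 0.
Proof.
rewrite /SL2 /= det_mx22; split=> [h|[h1 h2]].
  by have := congr1 (@zre R) h; have := congr1 (@zim R) h; rewrite !zE => -> ->.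
by apply: zi_eqP; rewrite !zE.
Qed.

Lemma qf_mink_inl (R : realType) z t : qf (mink (inl (z, t) : bpoint R)) = t ^+ 2.
Proof. by case: z => x y; rewrite /qf /mink !mxE /= /sqnorm /=; ring. Qed.

Lemma qf_mink_inr (R : realType) u : qf (mink (inr u : bpoint R)) = 0.
Proof. by case: u => [[x y]|]; rewrite /qf /mink !mxE /= /sqnorm /=; ring. Qed.

Lemma complex_divr (R : realType) (a b n : R) : n != 0 ->
  Complex a b / (n%:C)%C = Complex (a / n) (b / n).
Proof.
move=> n0; have nn : n ^+ 2 + 0 ^+ 2 != 0 by rewrite sumsq_eq0 negb_and n0.
rewrite complexV // complexM; apply/eqP; rewrite eq_complex /=.
by apply/andP; split; apply/eqP; field.
Qed.

Lemma complex_div (R : realType) (a b c d : R) : c ^+ 2 + d ^+ 2 != 0 ->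
  Complex a b / Complex c d =
  Complex ((a * c + b * d) / (c ^+ 2 + d ^+ 2))
          ((b * c - a * d) / (c ^+ 2 + d ^+ 2)).
Proof.
move=> n0; rewrite complexV // complexM; apply/eqP; rewrite eq_complex /=.
by apply/andP; split; apply/eqP; field.
Qed.

Lemma mink_inl (R : realType) (x y t : R) :
  mink (inl (Complex x y, t)) = mk4 (x ^+ 2 + y ^+ 2 + t ^+ 2) x y 1.
Proof. by []. Qed.

Lemma mink_inr (R : realType) (x y : R) :
  mink (inr (Some (Complex x y))) = mk4 (x ^+ 2 + y ^+ 2) x y 1.
Proof. by []. Qed.

Lemma mink_oo (R : realType) : mink (inr None : bpoint R) = mk4 1 0 0 0.
Proof. by []. Qed.

(* The lower right entry of A M A^* is the factor which brings the image back
   to the normalisation used in mink. *)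
Lemma mink_poincare (R : realType) (A : 'M[Zi R]_2) (z : R[i]) (t : R) :
  SL2 A -> 0 < t ->
  exists2 c : R, 0 < c & 0 < (poincare (map_mx (@Zi_val R) A) (z, t)).2 /\
    mink (act A (inl (z, t))) = c *: rho A (mink (inl (z, t))).
Proof.
move=> /SL2E[dr di] t0; case: z => x y.
rewrite /act /poincare !mxE !Zi_valE /rho /zn mink_inl !mk4E.
move: (zre (A 0 0)) (zim (A 0 0)) (zre (A 0 1)) (zim (A 0 1))
  (zre (A 1 0)) (zim (A 1 0)) (zre (A 1 1)) (zim (A 1 1)) dr di
  => a a' b b' c c' d d' dr di.
cbv zeta; set n := (sqnorm _ + sqnorm _ * _).
have nE : n = (c * x - c' * y + d) ^+ 2 + (c * y + c' * x + d') ^+ 2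
              + (c ^+ 2 + c' ^+ 2) * t ^+ 2 by [].
have n0 : 0 < n.
  have ct0 : 0 <= (c ^+ 2 + c' ^+ 2) * t ^+ 2.
    by rewrite mulr_ge0 ?sumsq_ge0 ?sqr_ge0.
  rewrite lt_def nE addr_ge0 ?sumsq_ge0 // andbT.
  (* As t > 0, n = 0 would make the lower row of A vanish, against determinant 1. *)
  apply/negP; rewrite paddr_eq0 ?sumsq_ge0 // mulf_eq0.
  rewrite !sumsq_eq0 sqrf_eq0 (gt_eqF t0) orbF => /andP[h /andP[/eqP c0 /eqP c'0]].
  move: h dr di; rewrite c0 c'0 => /andP[/eqP h1 /eqP h2].
  have -> : d = 0 by lra.
  have -> : d' = 0 by lra.
  move=> ? _; lra.
exists n^-1; first by rewrite invr_gt0.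
split; first by rewrite divr_gt0.
have n1 : n != 0 by rewrite gt_eqF.
have := fun u v => complex_divr u v n1; move: ((n%:C)%C^-1) => k kE.
rewrite !complexM !complexD kE mink_inl; move: n n0 n1 nE {k kE} => n n0 n1 nE.
(* The height enters the first coordinate as t^2; the factor |det A|^2 = 1 makes the identity
   homogeneous in the entries of A. *)
have key : t ^+ 2 = t ^+ 2 * ((a * d - a' * d' - (b * c - b' * c')) ^+ 2
  + (a * d' + a' * d - (b * c' + b' * c)) ^+ 2).
  by rewrite dr di; ring.
apply: row4P; rewrite [RHS]mxE !mk4E.
- set top := (X in n^-1 * X); have -> : n^-1 * top = n * top / n ^+ 2 by field.
  rewrite !expr_div_n -!mulrDl; congr (_ / _).
  by rewrite [X in _ + X = _]key nE /top; ring.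
- by rewrite mulrC; congr (_ * _); ring.
- by rewrite mulrC; congr (_ * _); ring.
- apply/eqP; rewrite -(inj_eq (mulfI n1)) mulrA mulfV // mul1r mulr1 nE; apply/eqP; ring.
Qed.

Lemma mink_moebius (R : realType) (A : 'M[Zi R]_2) (u : option R[i]) : SL2 A ->
  exists2 c : R, 0 < c & mink (act A (inr u)) = c *: rho A (mink (inr u)).
Proof.
move=> /SL2E[dr di]; rewrite /act /moebius.
case: u => [[x y]|]; rewrite !mxE !Zi_valE /rho /zn ?mink_inr ?mink_oo !mk4E;
move: (zre (A 0 0)) (zim (A 0 0)) (zre (A 0 1)) (zim (A 0 1))
  (zre (A 1 0)) (zim (A 1 0)) (zre (A 1 1)) (zim (A 1 1)) dr di
  => a a' b b' c c' d d' dr di.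
- rewrite -[_ * _ + Complex b b']/(Complex (a * x - a' * y + b) (a * y + a' * x + b')).
  rewrite -[_ * _ + Complex d d']/(Complex (c * x - c' * y + d) (c * y + c' * x + d')).
  rewrite complex_eq0.
  set p := c * x - c' * y + d; set p' := c * y + c' * x + d'.
  set r := a * x - a' * y + b; set r' := a * y + a' * x + b'.
  have [pp|p0] := eqVneq (p ^+ 2 + p' ^+ 2) 0.
    move/eqP: pp; rewrite sumsq_eq0 => /andP[/eqP p0 /eqP p'0].
    have dE : d = - (c * x - c' * y) by move: p0; rewrite /p; lra.
    have d'E : d' = - (c * y + c' * x) by move: p'0; rewrite /p'; lra.
    (* Numerator and denominator cannot vanish together, as (x + iy, 1) would then be in the kernel
       of A. *)
    have rr : 0 < r ^+ 2 + r' ^+ 2.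
      rewrite lt_def sumsq_ge0 andbT sumsq_eq0; apply/negP => /andP[/eqP h /eqP h'].
      have bE : b = - (a * x - a' * y) by move: h; rewrite /r; lra.
      have b'E : b' = - (a * y + a' * x) by move: h'; rewrite /r'; lra.
      have : (0 : R) = 1; last by move/eqP; rewrite eq_sym oner_eq0.
      by rewrite -dr dE d'E bE b'E; ring.
    exists (r ^+ 2 + r' ^+ 2)^-1; first by rewrite invr_gt0.
    rewrite mink_oo; apply: row4P; rewrite [RHS]mxE !mk4E.
    + apply/eqP; rewrite -(inj_eq (mulfI (lt0r_neq0 rr))) mulrA mulfV ?lt0r_neq0 //.
      by rewrite mul1r mulr1 /r /r'; apply/eqP; ring.
    + by apply/esym/eqP; rewrite mulf_eq0; apply/orP; right; apply/eqP;
        rewrite dE d'E; ring.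
    + by apply/esym/eqP; rewrite mulf_eq0; apply/orP; right; apply/eqP;
        rewrite dE d'E; ring.
    + by apply/esym/eqP; rewrite mulf_eq0; apply/orP; right; apply/eqP;
        rewrite dE d'E; ring.
  have pp : 0 < p ^+ 2 + p' ^+ 2 by rewrite lt_def p0 sumsq_ge0.
  exists (p ^+ 2 + p' ^+ 2)^-1; first by rewrite invr_gt0.
  rewrite complex_div // mink_inr; apply: row4P; rewrite [RHS]mxE !mk4E.
  + set top := (X in _^-1 * X); move: p0 pp; set n := p ^+ 2 + p' ^+ 2 => p0 pp.
    have -> : n^-1 * top = n * top / n ^+ 2 by field.
    by rewrite !expr_div_n -mulrDl; congr (_ / _); rewrite /top /n /p /p' /r /r'; ring.
  + by rewrite mulrC; congr (_ * _); rewrite /p /p' /r /r'; ring.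
  + by rewrite mulrC; congr (_ * _); rewrite /p /p' /r /r'; ring.
  + apply/eqP; rewrite -(inj_eq (mulfI p0)) mulrA mulfV // mul1r mulr1 /p /p'.
    by apply/eqP; ring.
- rewrite complex_eq0; have [pp|p0] := eqVneq (c ^+ 2 + c' ^+ 2) 0.
    move/eqP: pp; rewrite sumsq_eq0 => /andP[/eqP c0 /eqP c'0].
    have rr : 0 < a ^+ 2 + a' ^+ 2.
      rewrite lt_def sumsq_ge0 andbT sumsq_eq0; apply/negP => /andP[/eqP h /eqP h'].
      have : (0 : R) = 1; last by move/eqP; rewrite eq_sym oner_eq0.
      by rewrite -dr c0 c'0 h h'; ring.
    exists (a ^+ 2 + a' ^+ 2)^-1; first by rewrite invr_gt0.
    rewrite mink_oo; apply: row4P; rewrite [RHS]mxE !mk4E; last 3 first.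
    + by rewrite c0 c'0; ring.
    + by rewrite c0 c'0; ring.
    + by rewrite c0 c'0; ring.
    by field; rewrite lt0r_neq0.
  have pp : 0 < c ^+ 2 + c' ^+ 2 by rewrite lt_def p0 sumsq_ge0.
  exists (c ^+ 2 + c' ^+ 2)^-1; first by rewrite invr_gt0.
  rewrite complex_div // mink_inr; apply: row4P; rewrite [RHS]mxE !mk4E.
  + by field.
  + by field.
  + by field.
  + by field.
Qed.

Definition inside (R : realType) (p : bpoint R) : Prop :=
  if p is inl q then 0 < q.2 else True.

Lemma in_Hstar_inside (R : realType) (p : bpoint R) : in_Hstar p -> inside p.
Proof. by case: p => [[]|]. Qed.

Lemma Hstar_inside (R : realType) (x : Hstar R) : inside (val x).
Proof. by apply: in_Hstar_inside; have /asboolP := valP x. Qed.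

Lemma act_inside (R : realType) (A : 'M[Zi R]_2) (p : bpoint R) :
  SL2 A -> inside p -> inside (act A p).
Proof.
move=> sA; case: p => [[z t]|u] //= t0.
by have [c _ []] := mink_poincare z sA t0.
Qed.

Lemma mink_act (R : realType) (A : 'M[Zi R]_2) (p : bpoint R) :
  SL2 A -> inside p ->
  exists2 c : R, 0 < c & mink (act A p) = c *: rho A (mink p).
Proof.
move=> sA; case: p => [[z t]|u] /= hx.
  by have [c c0 [_ h]] := mink_poincare z sA hx; exists c.
by have [c c0 h] := mink_moebius u sA; exists c.
Qed.

(** The normalisation forces the scale: the last coordinate is 1 except at infinity, where it is 0
    and the first one is 1. Positivity of the heights then settles the sign of t. *)
Lemma mink_inj (R : realType) (p q : bpoint R) (c : R) :
  inside p -> inside q -> mink p = c *: mink q -> p = q.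
Proof.
move=> hp hq E; have E0 := congr1 (fun m : 'rV[R]_4 => m 0 x0) E.
have E1 := congr1 (fun m : 'rV[R]_4 => m 0 x1) E.
have E2 := congr1 (fun m : 'rV[R]_4 => m 0 x2) E.
have E3 := congr1 (fun m : 'rV[R]_4 => m 0 x3) E.
move: hp hq E0 E1 E2 E3 {E}.
case: p => [[[a b] t]|[[a b]|]]; case: q => [[[a' b'] t']|[[a' b']|]] /= hp hq;
  rewrite !mxE /= /sqnorm /= => E0 E1 E2 E3 //.
- have c1 : c = 1 by lra.
  rewrite {}c1 !mul1r in E0 E1 E2; rewrite E1 E2 in E0 *.
  have /eqP : t ^+ 2 - t' ^+ 2 = 0 by lra.
  rewrite subr_sqr mulf_eq0 => /orP[|] /eqP h.
    by rewrite (_ : t = t') //; lra.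
  by exfalso; lra.
- have c1 : c = 1 by lra.
  rewrite {}c1 !mul1r in E0 E1 E2; rewrite E1 E2 in E0 *.
  by have := exprn_gt0 2 hp => ?; exfalso; lra.
- by exfalso; lra.
- have c1 : c = 1 by lra.
  rewrite {}c1 !mul1r in E0 E1 E2; rewrite E1 E2 in E0 *.
  by have := exprn_gt0 2 hq => ?; exfalso; lra.
- have c1 : c = 1 by lra.
  by rewrite {}c1 !mul1r in E0 E1 E2; rewrite E1 E2.
- by exfalso; lra.
- have c0 : c = 0 by lra.
  by rewrite c0 mul0r in E0; exfalso; lra.
- have c0 : c = 0 by lra.
  by rewrite c0 mul0r in E0; exfalso; lra.
Qed.

(** * The vertices of T as primitive vectors, and coordinates adapted to T *)

Fact gauss_of_subproof (R : realType) (m n : int) :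
  Complex (m%:~R : R) n%:~R \in @gauss_int R.
Proof. by rewrite inE /= !intr_int. Qed.

Definition gauss_of (R : realType) (m n : int) : Zi R :=
  GaussInt (gauss_of_subproof R m n).

Lemma zre_gauss (R : realType) m n : zre (gauss_of R m n) = m%:~R.
Proof. by []. Qed.
Lemma zim_gauss (R : realType) m n : zim (gauss_of R m n) = n%:~R.
Proof. by []. Qed.

(* Coordinates of a primitive vector of Z[i]^2 over each vertex. *)
Definition vec (R : realType) (v : octv) : 'cV[Zi R]_2 :=
  \col_i match val v.1, v.2, val i with
  | 0%N, false, 0%N => gauss_of R 1 0
  | 0%N, false, _ => gauss_of R 0 0
  | 0%N, true, 0%N => gauss_of R 1 0
  | 0%N, true, _ => gauss_of R 1 (- 1)
  | 1%N, false, 0%N => gauss_of R 0 0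
  | 1%N, true, 0%N => gauss_of R 1 1
  | 1%N, _, _ => gauss_of R 1 0
  | _, false, _ => gauss_of R 1 0
  | _, true, 0%N => gauss_of R 0 1
  | _, true, _ => gauss_of R 1 0
  end.

Definition i30 : 'I_3 := @Ordinal 3 0 isT.
Definition i31 : 'I_3 := @Ordinal 3 1 isT.
Definition i32 : 'I_3 := @Ordinal 3 2 isT.

Lemma octv_ind (P : octv -> Prop) : P (i30, false) -> P (i30, true) ->
  P (i31, false) -> P (i31, true) -> P (i32, false) -> P (i32, true) ->
  forall v, P v.
Proof.
move=> h0 h1 h2 h3 h4 h5 [[[|[|[|//]]] h] b].
- by rewrite (_ : Ordinal h = i30); [case: b|apply: val_inj].
- by rewrite (_ : Ordinal h = i31); [case: b|apply: val_inj].
- by rewrite (_ : Ordinal h = i32); [case: b|apply: val_inj].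
Qed.

Lemma sum_octv (V : nmodType) (F : octv -> V) : \sum_v F v =
  F (i30, false) + F (i30, true) + (F (i31, false) + F (i31, true))
  + (F (i32, false) + F (i32, true)).
Proof.
transitivity (\sum_k \sum_b F (k, b)).
  by rewrite pair_bigA; apply: eq_bigr => -[].
rewrite !big_ord_recl big_ord0 addr0 !big_bool /=.
rewrite (_ : lift _ (lift _ _) = i32); last exact: val_inj.
rewrite (_ : lift _ _ = i31); last exact: val_inj.
rewrite (_ : ord0 = i30); last exact: val_inj.
by rewrite [F (i30, true) + _]addrC [F (i31, true) + _]addrC
  [F (i32, true) + _]addrC -addrA.
Qed.

HB.lock Definition octvec (R : realType) (v : octv) : 'rV[R]_4 := lightvec (vec R v).

Lemma octvecE (R : realType) :
  [/\ [/\ octvec R (i30, false) = mk4 1 0 0 0,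
      octvec R (i30, true) = mk4 1 1 1 2 &
      octvec R (i31, false) = mk4 0 0 0 1],
      octvec R (i31, true) = mk4 2 1 1 1,
      octvec R (i32, false) = mk4 1 1 0 1 &
      octvec R (i32, true) = mk4 1 0 1 1].
Proof.
by do !split; apply: row4P; rewrite octvec.unlock /lightvec !mk4E !mxE /= /zn
  !zre_gauss !zim_gauss ?rmorphN ?rmorph1 ?rmorph0; ring.
Qed.

Lemma octvec0f (R : realType) : octvec R (i30, false) = mk4 1 0 0 0.
Proof. by have [[]] := octvecE R. Qed.
Lemma octvec0t (R : realType) : octvec R (i30, true) = mk4 1 1 1 2.
Proof. by have [[]] := octvecE R. Qed.
Lemma octvec1f (R : realType) : octvec R (i31, false) = mk4 0 0 0 1.
Proof. by have [[]] := octvecE R. Qed.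
Lemma octvec1t (R : realType) : octvec R (i31, true) = mk4 2 1 1 1.
Proof. by have [] := octvecE R. Qed.
Lemma octvec2f (R : realType) : octvec R (i32, false) = mk4 1 1 0 1.
Proof. by have [] := octvecE R. Qed.
Lemma octvec2t (R : realType) : octvec R (i32, true) = mk4 1 0 1 1.
Proof. by have [] := octvecE R. Qed.
Definition ovE := (octvec0f, octvec0t, octvec1f, octvec1t, octvec2f, octvec2t).

(** The primitive vector (1, 1 - i) over (1 + i)/2 has a light vector ending in 2, which [mink]
    rescales to end in 1; the other vertices agree. *)
Definition pos_scale (R : realType) (v : octv) : R :=
  if v == (i30, true) then 2^-1 else 1.

Lemma pos_scale_gt0 (R : realType) v : 0 < pos_scale R v.
Proof. by rewrite /pos_scale; case: ifP; rewrite ?invr_gt0. Qed.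

Lemma mink_octv (R : realType) (v : octv) :
  mink (inr (octv_pos R v)) = pos_scale R v *: octvec R v.
Proof.
elim/octv_ind: v; rewrite /octv_pos /= /pos_scale ?mink_inr ?mink_oo ovE;
  apply: row4P; rewrite [RHS]mxE !mk4E /=; by field.
Qed.

(** Half the pairing with (2, 1, 1, 2), which is the sum of any two antipodal vertices and lies on
    the ray of the center of T. *)
Definition ell (R : realType) (m : 'rV[R]_4) : R :=
  m 0 x0 + m 0 x3 - m 0 x1 - m 0 x2.

(* The coordinate along the axis joining the antipodal vertices (k, false) and
   (k, true). *)
Definition axis (R : realType) (k : 'I_3) (m : 'rV[R]_4) : R :=
  match val k with
  | 0%N => m 0 x0 - m 0 x1 - m 0 x2
  | 1%N => m 0 x3 - m 0 x1 - m 0 x2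
  | _ => m 0 x1 - m 0 x2
  end.

Lemma ell_octvec (R : realType) v : ell (octvec R v) = 1.
Proof. by elim/octv_ind: v; rewrite /ell ovE !mk4E; ring. Qed.

(** In the slice [ell m = 1], with the three axes as coordinates, the vertices are plus and minus
    the unit vectors: T becomes the standard cross-polytope. *)
Lemma axis_octvec (R : realType) k v :
  axis k (octvec R v) = if v.1 == k then (-1) ^+ v.2 else 0.
Proof.
have hk : k = i30 \/ k = i31 \/ k = i32.
  by case: k => [[|[|[|//]]] h]; [left|right; left|right; right]; apply: val_inj.
by case: hk => [->|[->|->]]; elim/octv_ind: v; rewrite /axis ovE !mk4E /=
  ?expr0 ?expr1; ring.
Qed.

Lemma ell_axis_inj (R : realType) (m n : 'rV[R]_4) : ell m = ell n ->
  (forall k, axis k m = axis k n) -> m = n.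
Proof.
move=> h hk; have := hk i30; have := hk i31; have := hk i32.
by move: h; rewrite /ell /axis /= => *; apply: row4P; lra.
Qed.

Lemma lin_sum (R : realType) (U V : lmodType R) (f : U -> V)
    (J : finType) (P : pred J) (w : J -> R) (m : J -> U) :
  (forall a u v, f (a *: u + v) = a *: f u + f v) ->
  f (\sum_(i | P i) w i *: m i) = \sum_(i | P i) w i *: f (m i).
Proof.
move=> hf; apply: (big_rec2 (fun u v => f u = v)).
  (* Linearity at -1, 0, 0 gives f 0 = - f 0 + f 0 = 0. *)
  by have := hf (-1) 0 0; rewrite !scaler0 addr0 scaleN1r addNr.
by move=> i u v _ <-; rewrite hf.
Qed.

Lemma ell_sum (R : realType) (J : finType) (P : pred J) (w : J -> R) m :
  ell (\sum_(i | P i) w i *: m i) = \sum_(i | P i) w i * ell (m i).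
Proof.
by apply: (@lin_sum R _ (R^o)) => a u v; rewrite /ell !mxE -[_ *: _]/(_ * _); ring.
Qed.

Lemma axis_sum (R : realType) k (J : finType) (P : pred J) (w : J -> R) m :
  axis k (\sum_(i | P i) w i *: m i) = \sum_(i | P i) w i * axis k (m i).
Proof.
apply: (@lin_sum R _ (R^o)) => a u v; rewrite /axis.
by case: (val k) => [|[|n]]; rewrite !mxE -[_ *: _]/(_ * _); ring.
Qed.

Lemma polar_sum (R : realType) n (J : finType) (P : pred J) (w : J -> R) m :
  polar n (\sum_(i | P i) w i *: m i) = \sum_(i | P i) w i * polar n (m i).
Proof.
by apply: (@lin_sum R _ (R^o)) => a u v; rewrite /polar !mxE -[_ *: _]/(_ * _); ring.
Qed.

Lemma rho_lin (R : realType) (A : 'M[Zi R]_2) (a : R) u v :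
  rho A (a *: u + v) = a *: rho A u + rho A v.
Proof.
by apply: row4P; rewrite [RHS]mxE [in RHS]mxE /rho !mk4E !mxE; ring.
Qed.

Lemma rho_sum (R : realType) A (J : finType) (P : pred J) (w : J -> R) m :
  rho A (\sum_(i | P i) w i *: m i) = \sum_(i | P i) w i *: rho A (m i).
Proof. by apply: lin_sum => a u v; exact: rho_lin. Qed.

Lemma rhoZ (R : realType) (A : 'M[Zi R]_2) (a : R) u : rho A (a *: u) = a *: rho A u.
Proof.
by apply: row4P; rewrite [RHS]mxE /rho !mk4E !mxE; ring.
Qed.

Lemma ellZ (R : realType) (a : R) u : ell (a *: u) = a * ell u.
Proof. by rewrite /ell !mxE; ring. Qed.

(** * Inverses by adjugates, and the integral light vectors nearest to the center *)

Lemma adj_SL2 (K : comPzRingType) (A : 'M[K]_2) : SL2 A -> SL2 (\adj A).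
Proof.
move=> dA; have /(congr1 determinant) := mul_adj_mx A.
by rewrite det_mulmx dA det_scalar expr1n mulr1.
Qed.

Lemma adjK (K : comPzRingType) (A : 'M[K]_2) : SL2 A -> \adj A *m A = 1%:M.
Proof. by move=> dA; rewrite mul_adj_mx dA. Qed.

Lemma adjKr (K : comPzRingType) (A : 'M[K]_2) : SL2 A -> A *m \adj A = 1%:M.
Proof. by move=> dA; rewrite mul_mx_adj dA. Qed.

Lemma mul_SL2 (K : comPzRingType) (A B : 'M[K]_2) :
  SL2 A -> SL2 B -> SL2 (A *m B).
Proof. by rewrite /SL2 /= det_mulmx => -> ->; rewrite mulr1. Qed.

Lemma rho1 (R : realType) (m : 'rV[R]_4) : rho 1%:M m = m.
Proof. by apply: row4P; rewrite /rho !mk4E !mxE /zn /= !zE; ring. Qed.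

Lemma rho_adjK (R : realType) (A : 'M[Zi R]_2) m : SL2 A ->
  rho (\adj A) (rho A m) = m.
Proof. by move=> dA; rewrite rho_mul adjK // rho1. Qed.

Lemma rho_adjKr (R : realType) (A : 'M[Zi R]_2) m : SL2 A ->
  rho A (rho (\adj A) m) = m.
Proof. by move=> dA; rewrite rho_mul adjKr // rho1. Qed.

Lemma lightvec_int (R : realType) (v : 'cV[Zi R]_2) :
  [/\ lightvec v 0 x0 \is a Num.int, lightvec v 0 x1 \is a Num.int,
      lightvec v 0 x2 \is a Num.int & lightvec v 0 x3 \is a Num.int].
Proof.
by rewrite /lightvec !mk4E; split; rewrite ?zn_int //;
  rewrite ?(rpredB, rpredD) ?rpredM ?zre_int ?zim_int.
Qed.

(** No integer lies strictly between the roots 0 and 1 of x^2 - x. A vanishing sum of two such terms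
    thus leaves four possibilities. *)
Lemma int_sq_sub (R : realType) (x : R) : x \is a Num.int ->
  0 <= x ^+ 2 - x /\ (x ^+ 2 - x = 0 -> x = 0 \/ x = 1).
Proof.
move=> xi; split; last first.
  move=> h; have /eqP : x * (x - 1) = 0 by rewrite -h; ring.
  by rewrite mulf_eq0 subr_eq0 => /orP[] /eqP ->; [left|right].
have [x0|x0] := leP x 0; first by have := sqr_ge0 x; lra.
by have x1 := int_gt0_ge1 xi x0; rewrite -[x in _ - x]mulr1 expr2 -mulrBr mulr_ge0 // ?subr_ge0 // ltW.
Qed.

Lemma ell_int (R : realType) (v : 'cV[Zi R]_2) : ell (lightvec v) \is a Num.int.
Proof. by have [*] := lightvec_int v; rewrite /ell ?(rpredB, rpredD). Qed.

Lemma lightvec_qf (R : realType) (v : 'cV[Zi R]_2) :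
  lightvec v 0 x0 * lightvec v 0 x3 = lightvec v 0 x1 ^+ 2 + lightvec v 0 x2 ^+ 2.
Proof. by rewrite /lightvec !mk4E /zn; ring. Qed.

Lemma lightvec_ge0 (R : realType) (v : 'cV[Zi R]_2) :
  0 <= lightvec v 0 x0 /\ 0 <= lightvec v 0 x3.
Proof. by rewrite /lightvec !mk4E !zn_ge0. Qed.

Lemma lightvec_eq0 (R : realType) (v : 'cV[Zi R]_2) :
  lightvec v 0 x0 = 0 -> lightvec v 0 x3 = 0 -> v = 0.
Proof.
rewrite /lightvec !mk4E => /zn_eq0 h0 /zn_eq0 h1; apply/colP => i.
rewrite mxE; case: i => [[|[|//]] hi].
- by rewrite (_ : Ordinal hi = 0) //; apply: val_inj.
- by rewrite (_ : Ordinal hi = 1) //; apply: val_inj.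
Qed.

(** By integrality, positivity is enough. On the light cone, a times ell is the sum of squares (x -
    a/2)^2 + (y - a/2)^2 + a^2/2; the case a = 0 is treated directly. *)
Lemma ell_lightvec_ge1 (R : realType) (v : 'cV[Zi R]_2) :
  v != 0 -> 1 <= ell (lightvec v).
Proof.
move=> v0; apply: int_gt0_ge1; first exact: ell_int.
have := lightvec_qf v; have [h0 h3] := lightvec_ge0 v.
have : ~ (lightvec v 0 x0 = 0 /\ lightvec v 0 x3 = 0).
  by move=> [/lightvec_eq0 h /h vE]; rewrite vE eqxx in v0.
rewrite /ell; move: h0 h3; move: (lightvec v 0 x0) (lightvec v 0 x1)
  (lightvec v 0 x2) (lightvec v 0 x3) => a x y d a0 d0 h q.
have [aE|an] := eqVneq a 0.
  rewrite aE mul0r in q.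
  move/esym/eqP: q; rewrite sumsq_eq0 => /andP[/eqP xE /eqP yE].
  have dn : d != 0 by apply/negP => /eqP dE; apply: h.
  have : 0 < d by rewrite lt_def dn.
  by rewrite aE xE yE; lra.
have ap : 0 < a by rewrite lt_def an.
rewrite -(pmulr_rgt0 _ ap).
have -> : a * (a + d - x - y) = (x - a / 2) ^+ 2 + (y - a / 2) ^+ 2 + a ^+ 2 / 2.
  have -> : a * (a + d - x - y) = a ^+ 2 + (a * d) - a * x - a * y by ring.
  by rewrite q; field.
by apply: ltr_wpDl; rewrite ?sumsq_ge0 // divr_gt0 ?exprn_gt0.
Qed.

(** With ell = 1 the same sum of squares gives a^2/2 <= a, so a is 0, 1 or 2; these values yield
    one, four and one vertex. *)
Lemma ell_lightvec_eq1 (R : realType) (v : 'cV[Zi R]_2) :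
  ell (lightvec v) = 1 -> exists u, lightvec v = octvec R u.
Proof.
have := lightvec_qf v; have [h0 h3] := lightvec_ge0 v.
have [i0 i1 i2 i3] := lightvec_int v.
suff : lightvec v 0 x0 * lightvec v 0 x3 = lightvec v 0 x1 ^+ 2 + lightvec v 0 x2 ^+ 2 ->
    ell (lightvec v) = 1 -> exists u,
    [/\ lightvec v 0 x0 = octvec R u 0 x0, lightvec v 0 x1 = octvec R u 0 x1,
        lightvec v 0 x2 = octvec R u 0 x2 & lightvec v 0 x3 = octvec R u 0 x3].
  by move=> h q l; have [u [*]] := h q l; exists u; apply: row4P.
rewrite /ell; move: h0 h3 i0 i1 i2 i3; move: (lightvec v 0 x0) (lightvec v 0 x1)
  (lightvec v 0 x2) (lightvec v 0 x3) => a x y d a0 d0 ia ix iy id q l.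
have dE : d = 1 - a + x + y by lra.
have aE : a = (x - a / 2) ^+ 2 + (y - a / 2) ^+ 2 + a ^+ 2 / 2.
  rewrite -[LHS]mulr1 -[X in a * X]l.
  have -> : a * (a + d - x - y) = a ^+ 2 + (a * d) - a * x - a * y by ring.
  by rewrite q; field.
have a2 : a <= 2.
  rewrite leNgt; apply/negP => a2.
  have : a ^+ 2 / 2 <= a by rewrite {2}aE lerDr sumsq_ge0.
  by rewrite expr2; nra.
have [x0 xeq] := int_sq_sub ix; have [y0 yeq] := int_sq_sub iy.
have [aE0|an] := eqVneq a 0.
  rewrite aE0 mul0r in q.
  move/esym/eqP: q; rewrite sumsq_eq0 => /andP[/eqP xE /eqP yE].
  by exists (i31, false); rewrite ovE !mk4E; split; lra.
have a1 : 1 <= a by apply: int_gt0_ge1 => //; rewrite lt_def an.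
have [aE1|an1] := eqVneq a 1.
  have h : (x ^+ 2 - x) + (y ^+ 2 - y) = 0.
    by rewrite aE1 mul1r in q; rewrite aE1 in dE; lra.
  have [|xE|xE] := xeq; first by lra.
    have [|yE|yE] := yeq; first by lra.
      by exists (i30, false); rewrite ovE !mk4E; split; lra.
    by exists (i32, true); rewrite ovE !mk4E; split; lra.
  have [|yE|yE] := yeq; first by lra.
    by exists (i32, false); rewrite ovE !mk4E; split; lra.
  by exists (i30, true); rewrite ovE !mk4E; split; lra.
have a3 : 1 <= a - 1.
  by apply: int_gt0_ge1; rewrite ?rpredB ?rpred1 // subr_gt0 lt_def an1.
have aE2 : a = 2 by lra.
have h : (x - 1) ^+ 2 + (y - 1) ^+ 2 = 0.
  by move: aE; rewrite aE2 divff ?pnatr_eq0 // => h; lra.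
move/eqP: h; rewrite sumsq_eq0 !subr_eq0 => /andP[/eqP xE /eqP yE].
by exists (i31, true); rewrite ovE !mk4E; split; lra.
Qed.

(* Locked, as conversion would otherwise unfold determinants and matrix products. *)
HB.lock Definition tvec (R : realType) (A : 'M[Zi R]_2) (v : octv) : 'rV[R]_4 :=
  lightvec (A *m vec R v).

Lemma tvec_def (R : realType) (A : 'M[Zi R]_2) v : tvec A v = lightvec (A *m vec R v).
Proof. by rewrite tvec.unlock. Qed.

Lemma tvecE (R : realType) (A : 'M[Zi R]_2) v : tvec A v = rho A (octvec R v).
Proof. by rewrite tvec_def octvec.unlock rho_lightvec. Qed.

Lemma tvecM (R : realType) (A B : 'M[Zi R]_2) v : rho A (tvec B v) = tvec (A *m B) v.
Proof. by rewrite !tvec_def rho_lightvec mulmxA. Qed.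

Lemma octvec_neq0 (R : realType) v : vec R v != 0.
Proof.
apply/eqP => h; have := ell_octvec R v; rewrite octvec.unlock h /ell /lightvec !mk4E.
by rewrite !mxE /zn !zE; lra.
Qed.

Lemma mulvec_neq0 (R : realType) (A : 'M[Zi R]_2) v : SL2 A -> A *m vec R v != 0.
Proof.
move=> sA; apply/eqP => /(congr1 (mulmx (\adj A))).
by rewrite mulmx0 mulmxA adjK // mul1mx => /eqP; apply/negP/octvec_neq0.
Qed.

Lemma ell_tvec_ge1 (R : realType) (A : 'M[Zi R]_2) v : SL2 A -> 1 <= ell (tvec A v).
Proof. by move=> sA; rewrite tvec_def; apply/ell_lightvec_ge1/mulvec_neq0. Qed.

(** * Cones over faces, and how two tiles meet *)

Definition cone (R : realType) (A : 'M[Zi R]_2) (S : {set octv}) (m : 'rV[R]_4) :=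
  exists2 w : octv -> R, (forall v, v \in S -> 0 <= w v) &
    m = \sum_(v in S) w v *: tvec A v.

Definition ocone (R : realType) (A : 'M[Zi R]_2) (S : {set octv}) (m : 'rV[R]_4) :=
  exists2 w : octv -> R, (forall v, v \in S -> 0 < w v) &
    m = \sum_(v in S) w v *: tvec A v.

Lemma oct_face_antip (S : {set octv}) v : oct_face S -> S != finset.setTfor octv ->
  v \in S -> (v.1, ~~ v.2) \notin S.
Proof.
move=> /orP[-> //|/andP[_ /forallP h]] _; case: v => k b /= vS.
by have := h k; case: b vS => -> /=; rewrite ?andbT.
Qed.

(* S lies in the facet which on each axis contains the vertex of S if there is
   one, and which avoids u. *)
Lemma facet_functional (R : realType) (S : {set octv}) u : oct_face S -> u \notin S ->
  exists s : 'I_3 -> R, let phi m := ell m - \sum_k s k * axis k m in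
    [/\ forall v, 0 <= phi (octvec R v), forall v, v \in S -> phi (octvec R v) = 0 &
        0 < phi (octvec R u)].
Proof.
move=> fS uS; have ST : S != finset.setTfor octv.
  by apply/eqP => ST; rewrite ST inE in uS.
(* On an axis that misses S and does not contain u, the default is the vertex (k, false). *)
pose b k := if k == u.1 then ~~ u.2 else (k, true) \in S.
exists (fun k => (-1) ^+ b k); rewrite /=.
have E v : ell (octvec R v) - \sum_k (-1) ^+ b k * axis k (octvec R v) =
    1 - (-1) ^+ (b v.1 (+) v.2).
  rewrite ell_octvec (bigD1 v.1) //= axis_octvec eqxx big1 ?addr0.
    by rewrite signr_addb.
  by move=> k; rewrite axis_octvec eq_sym => /negPf ->; rewrite mulr0.
split=> [v|v vS|]; rewrite E.
- by case: (_ (+) _); rewrite ?expr0 ?expr1; lra.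
- have -> : b v.1 = v.2; last by rewrite addbb expr0 subrr.
  have := oct_face_antip fS ST vS; rewrite /b; case: eqP => [vu|_].
    have : v != u by apply: contraNneq uS => <-.
    case: (v) (u) vu => k c [k' c'] /= ->; rewrite xpair_eqE eqxx /=.
    by case: c c' => -[].
  by case: v vS => k [] vS /=; [rewrite vS|move/negPf].
- by rewrite /b eqxx; case: (u.2); rewrite /= expr1; lra.
Qed.

(** Seen from the center of either tile, the vertices of the other have level at least 1. Computing
    the level of m from both centers shows that the two total weights agree, so every vertex of
    positive weight has level exactly 1 and is a vertex of the other tile. *)
Lemma cone_tvec (R : realType) (A B : 'M[Zi R]_2) (S S' : {set octv}) m :
  SL2 A -> SL2 B -> oct_face S' -> ocone A S m -> cone B S' m ->
  forall v, v \in S -> exists2 u, u \in S' & tvec A v = tvec B u.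
Proof.
move=> sA sB fS' [w w0 mE] [w' w'0 mE'].
have aB := adj_SL2 sB; have aA := adj_SL2 sA.
have eB : \sum_(v in S) w v * ell (tvec (\adj B *m A) v) = \sum_(u in S') w' u.
  transitivity (ell (rho (\adj B) m)).
    by rewrite mE rho_sum ell_sum; apply: eq_bigr => v _; rewrite tvecM.
  rewrite mE' rho_sum ell_sum; apply: eq_bigr => v _.
  by rewrite tvecE rho_adjK // ell_octvec mulr1.
have eA : \sum_(u in S') w' u * ell (tvec (\adj A *m B) u) = \sum_(v in S) w v.
  transitivity (ell (rho (\adj A) m)).
    by rewrite mE' rho_sum ell_sum; apply: eq_bigr => v _; rewrite tvecM.
  rewrite mE rho_sum ell_sum; apply: eq_bigr => v _.
  by rewrite tvecE rho_adjK // ell_octvec mulr1.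
have le : \sum_(v in S) w v * ell (tvec (\adj B *m A) v) <= \sum_(v in S) w v.
  rewrite eB -eA; apply: ler_sum => u uS.
  by rewrite ler_peMr ?w'0 // ell_tvec_ge1 //; exact: (mul_SL2 aA sB).
have e1 v : v \in S -> ell (tvec (\adj B *m A) v) = 1.
  have h : forall u, u \in S -> 0 <= w u * ell (tvec (\adj B *m A) u) - w u.
    move=> u uS; rewrite subr_ge0 ler_peMr ?(ltW (w0 _ uS)) //.
    exact: (ell_tvec_ge1 u (mul_SL2 aB sA)).
  have s0 : \sum_(u in S) (w u * ell (tvec (\adj B *m A) u) - w u) = 0.
    by apply/eqP; rewrite eq_le sumr_ge0 // andbT sumrB subr_le0.
  move=> vS; have := psumr_eq0P h s0 vS; rewrite -{2}[w v]mulr1 -mulrBr => /eqP.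
  by rewrite mulf_eq0 (gt_eqF (w0 _ vS)) /= subr_eq0 => /eqP.
have ex v : v \in S -> exists u, tvec A v = tvec B u.
  move=> vS; have := e1 v vS; rewrite tvec_def => /ell_lightvec_eq1[u uE].
  by exists u; rewrite [RHS]tvecE -uE -tvec_def tvecM mulmxA adjKr // mul1mx.
move=> v vS; have [u uE] := ex v vS; exists u => //; apply/negP => /negP uS.
(* If u were outside S', a functional vanishing on S', nonnegative on all vertices and positive at u
   would be zero at m by one expression and positive by the other. *)
have [s /= [p0 pS pu]] := facet_functional R fS' uS.
pose phi m := ell m - \sum_k s k * axis k m.
have phiE (J : finType) (P : pred J) (c : J -> R) n :
    phi (\sum_(i | P i) c i *: n i) = \sum_(i | P i) c i * phi (n i).
  apply: (@lin_sum R _ (R^o)) => a x y; rewrite /phi.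
  have -> : \sum_k s k * axis k (a *: x + y) =
      a * (\sum_k s k * axis k x) + \sum_k s k * axis k y.
    rewrite mulr_sumr -big_split /=; apply: eq_bigr => k _; rewrite /axis.
    by case: (val k) => [|[|?]]; rewrite !mxE; ring.
  by rewrite /ell !mxE -[_ *: _]/(_ * _); ring.
have : phi (rho (\adj B) m) = 0.
  rewrite mE' rho_sum phiE big1 // => i iS.
  by rewrite tvecE rho_adjK // /phi pS // mulr0.
rewrite mE rho_sum phiE; apply/eqP; rewrite gt_eqF // (bigD1 v) //=.
apply: ltr_wpDr.
  apply: sumr_ge0 => i /andP[iS _]; have [j ->] := ex i iS.
  by rewrite tvecE rho_adjK // mulr_ge0 ?(ltW (w0 _ _)) // p0.
by rewrite uE tvecE rho_adjK // mulr_gt0 ?w0.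
Qed.

(** * The action on [Hstar], and faces of tiles as cones *)

Lemma act_mul (R : realType) (A B : 'M[Zi R]_2) (p : bpoint R) :
  SL2 A -> SL2 B -> inside p -> act A (act B p) = act (A *m B) p.
Proof.
move=> sA sB ip; have iB := act_inside sB ip; have sAB := mul_SL2 sA sB.
have [c c0 E] := mink_act sA iB; have [d d0 E'] := mink_act sB ip.
have [e e0 E''] := mink_act sAB ip.
(* Both points are compared through their Minkowski rays, on which [rho] is multiplicative. *)
apply: (@mink_inj _ _ _ (c * d / e)); try exact: act_inside.
by rewrite E E' E'' rhoZ rho_mul !scalerA mulfVK // gt_eqF.
Qed.

Lemma SL2_1 (K : comPzRingType) : SL2 (1%:M : 'M[K]_2).
Proof. by rewrite /SL2 /= det1. Qed.

Lemma act1 (R : realType) (p : bpoint R) : inside p -> act 1%:M p = p.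
Proof.
move=> ip; have [c c0 E] := mink_act (SL2_1 (Zi R)) ip.
apply: (@mink_inj _ _ _ c) => //; first exact/act_inside/ip/SL2_1.
by rewrite E rho1.
Qed.

Lemma act_in_Hstar (R : realType) (A : 'M[Zi R]_2) (p : bpoint R) :
  SL2 A -> in_Hstar p -> in_Hstar (act A p).
Proof.
move=> sA; case: p => [[z t]|u] h.
  by have := @act_inside _ A (inl (z, t)) sA h.
have [B [v [sB uE]]] := h; exists (A *m B), v; split; first exact: mul_SL2.
by rewrite -act_mul // -uE.
Qed.

(** For A in [SL2] the image stays in [Hstar], so the default of [insubd] is never taken. *)
Definition hact (R : realType) (A : 'M[Zi R]_2) (x : Hstar R) : Hstar R :=
  insubd x (act A (val x)).

Lemma val_hact (R : realType) (A : 'M[Zi R]_2) (x : Hstar R) : SL2 A ->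
  val (hact A x) = act A (val x).
Proof.
move=> sA; rewrite val_insubd; case: ifP => // /negP[]; apply/asboolP.
by apply: act_in_Hstar => //; have /asboolP := valP x.
Qed.

Lemma hact_mul (R : realType) (A B : 'M[Zi R]_2) (x : Hstar R) :
  SL2 A -> SL2 B -> hact A (hact B x) = hact (A *m B) x.
Proof.
move=> sA sB; apply: val_inj; rewrite !val_hact ?act_mul //; last exact: mul_SL2.
exact: Hstar_inside.
Qed.

Lemma hact1 (R : realType) (x : Hstar R) : hact 1%:M x = x.
Proof.
by apply: val_inj; rewrite val_hact ?act1 //; [exact: Hstar_inside|exact: SL2_1].
Qed.

Lemma hact_adjK (R : realType) (A : 'M[Zi R]_2) (x : Hstar R) :
  SL2 A -> hact (\adj A) (hact A x) = x.
Proof. by move=> sA; rewrite hact_mul ?adjK ?hact1 //; apply: adj_SL2. Qed.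

Lemma hact_adjKr (R : realType) (A : 'M[Zi R]_2) (x : Hstar R) :
  SL2 A -> hact A (hact (\adj A) x) = x.
Proof. by move=> sA; rewrite hact_mul ?adjKr ?hact1 //; apply: adj_SL2. Qed.

Lemma mink_hact (R : realType) (A : 'M[Zi R]_2) (x : Hstar R) : SL2 A ->
  exists2 c : R, 0 < c & mink (val (hact A x)) = c *: rho A (mink (val x)).
Proof. by move=> sA; rewrite val_hact //; apply: mink_act => //; apply: Hstar_inside. Qed.

Lemma Hstar_mink_inj (R : realType) (x y : Hstar R) (c : R) :
  mink (val x) = c *: mink (val y) -> x = y.
Proof. by move=> h; apply/val_inj/(mink_inj _ _ h); apply: Hstar_inside. Qed.

(** Passing from normalised vectors to the integral ones, and applying A, only multiplies the
    weights by positive factors. *)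
Lemma tile_faceE (R : realType) (A : 'M[Zi R]_2) S (x : Hstar R) : SL2 A ->
  tile_face A S x <-> cone A S (mink (val x)).
Proof.
move=> sA; split=> [[y [w w0 yE] xE]|[w w0 xE]].
  have [c c0 cE] := mink_act sA (Hstar_inside y).
  exists (fun v => c * (w v * pos_scale R v)) => [v vS|].
    by have := w0 v vS; have := pos_scale_gt0 R v => ? ?; rewrite !mulr_ge0 // ltW.
  rewrite xE cE yE rho_sum scaler_sumr; apply: eq_bigr => v _.
  by rewrite mink_octv rhoZ tvecE !scalerA mulrA.
have sA' := adj_SL2 sA; have [c c0 cE] := mink_hact x sA'.
exists (hact (\adj A) x); last by rewrite -[LHS](congr1 val (hact_adjKr x sA)) val_hact.
exists (fun v => c * w v / pos_scale R v) => [v vS|].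
  by have := w0 v vS; have := pos_scale_gt0 R v => ? ?; rewrite divr_ge0 ?mulr_ge0 // ltW.
rewrite cE xE rho_sum scaler_sumr; apply: eq_bigr => v _.
by rewrite mink_octv tvecE rho_adjK // !scalerA mulfVK // gt_eqF ?pos_scale_gt0.
Qed.

Lemma open_tile_faceE (R : realType) (A : 'M[Zi R]_2) S (x : Hstar R) : SL2 A ->
  open_tile_face A S x <-> ocone A S (mink (val x)).
Proof.
move=> sA; split=> [[y [w w0 yE] xE]|[w w0 xE]].
  have [c c0 cE] := mink_act sA (Hstar_inside y).
  exists (fun v => c * (w v * pos_scale R v)) => [v vS|].
    by rewrite !mulr_gt0 ?w0 // pos_scale_gt0.
  rewrite xE cE yE rho_sum scaler_sumr; apply: eq_bigr => v _.
  by rewrite mink_octv rhoZ tvecE !scalerA mulrA.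
have sA' := adj_SL2 sA; have [c c0 cE] := mink_hact x sA'.
exists (hact (\adj A) x); last by rewrite -[LHS](congr1 val (hact_adjKr x sA)) val_hact.
exists (fun v => c * w v / pos_scale R v) => [v vS|].
  by rewrite divr_gt0 ?mulr_gt0 ?w0 // pos_scale_gt0.
rewrite cE xE rho_sum scaler_sumr; apply: eq_bigr => v _.
by rewrite mink_octv tvecE rho_adjK // !scalerA mulfVK // gt_eqF ?pos_scale_gt0.
Qed.

Lemma coneZ (R : realType) (A : 'M[Zi R]_2) S m (c : R) : 0 <= c ->
  cone A S m -> cone A S (c *: m).
Proof.
move=> c0 [w w0 ->]; exists (fun v => c * w v) => [v vS|]; first by rewrite mulr_ge0 ?w0.
by rewrite scaler_sumr; apply: eq_bigr => v _; rewrite scalerA.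
Qed.

Lemma oconeZ (R : realType) (A : 'M[Zi R]_2) S m (c : R) : 0 < c ->
  ocone A S m -> ocone A S (c *: m).
Proof.
move=> c0 [w w0 ->]; exists (fun v => c * w v) => [v vS|]; first by rewrite mulr_gt0 ?w0.
by rewrite scaler_sumr; apply: eq_bigr => v _; rewrite scalerA.
Qed.

Lemma cone_rho (R : realType) (A B : 'M[Zi R]_2) S m :
  cone A S m -> cone (B *m A) S (rho B m).
Proof.
move=> [w w0 ->]; exists w => //; rewrite rho_sum; apply: eq_bigr => v _.
by rewrite tvecM.
Qed.

Lemma ocone_rho (R : realType) (A B : 'M[Zi R]_2) S m :
  ocone A S m -> ocone (B *m A) S (rho B m).
Proof.
move=> [w w0 ->]; exists w => //; rewrite rho_sum; apply: eq_bigr => v _.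
by rewrite tvecM.
Qed.

Lemma ocone_cone (R : realType) (A : 'M[Zi R]_2) S m : ocone A S m -> cone A S m.
Proof. by move=> [w w0 ->]; exists w => // v vS; rewrite ltW ?w0. Qed.

Lemma cone_sub (R : realType) (A : 'M[Zi R]_2) (S S' : {set octv}) m :
  S \subset S' -> cone A S m -> cone A S' m.
Proof.
move=> SS' [w w0 ->]; exists (fun v => if v \in S then w v else 0) => [v _|].
  by case: ifP => // /w0.
rewrite [RHS]big_mkcond [LHS]big_mkcond; apply: eq_bigr => v _ /=.
case: ifP => vS; first by rewrite (fintype.subsetP SS' _ vS).
by rewrite scale0r if_same.
Qed.

Lemma tvec1 (R : realType) v : tvec 1%:M v = octvec R v.
Proof. by rewrite tvecE rho1. Qed.

(** * The solid octahedron as a unit ball of the l1 norm *)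

Definition axis_norm (R : realType) (m : 'rV[R]_4) : R := \sum_k `|axis k m|.

Lemma sum_axes (R : realType) (F : 'I_3 -> R) : \sum_k F k = F i30 + F i31 + F i32.
Proof.
rewrite !big_ord_recl big_ord0 addr0.
rewrite (_ : lift _ (lift _ _) = i32); last exact: val_inj.
rewrite (_ : lift _ _ = i31); last exact: val_inj.
by rewrite (_ : ord0 = i30) ?addrA //; exact: val_inj.
Qed.

Lemma ell_weights (R : realType) (w : octv -> R) :
  ell (\sum_v w v *: octvec R v) = \sum_v w v.
Proof. by rewrite ell_sum; apply: eq_bigr => v _; rewrite ell_octvec mulr1. Qed.

Lemma axis_weights (R : realType) (w : octv -> R) k :
  axis k (\sum_v w v *: octvec R v) = w (k, false) - w (k, true).
Proof.
rewrite axis_sum (bigD1 (k, false)) //= (bigD1 (k, true)) /=; last first.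
  by rewrite xpair_eqE andbF.
rewrite big1 ?addr0.
  by rewrite !axis_octvec !eqxx /= expr0 expr1 mulr1 mulrN1.
move=> [j b]; rewrite !xpair_eqE axis_octvec /=; case: eqP => _ /=; last by rewrite mulr0.
by case: b.
Qed.

(** The positive and negative parts of an axis coordinate go to the two ends of the axis, which uses
    the weight [axis_norm m]. The slack s is spread evenly over the six vertices, which changes no
    axis coordinate and makes all weights positive if s > 0. *)
Lemma weights_axes (R : realType) (m : 'rV[R]_4) (s : R) :
  s = ell m - axis_norm m ->
  m = \sum_(v : octv) (Num.max ((-1) ^+ v.2 * axis v.1 m) 0 + s / 6%:R) *: octvec R v.
Proof.
have mx (a : R) : Num.max a 0 - Num.max (- a) 0 = a /\
    Num.max a 0 + Num.max (- a) 0 = `|a|.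
  case: (ltrgt0P a) => [a0|a0|->].
  - by rewrite max_r ?oppr_le0 ?(ltW a0) //; split; lra.
  - by rewrite max_l ?oppr_ge0 ?(ltW a0) //; split; lra.
  - by rewrite oppr0 ?maxxx; split; lra.
move=> sE; apply: ell_axis_inj => [|k].
  rewrite ell_weights sum_octv /= !expr0 !expr1 !mul1r !mulN1r.
  have [_ h0] := mx (axis i30 m); have [_ h1] := mx (axis i31 m).
  have [_ h2] := mx (axis i32 m).
  have -> : ell m = s + axis_norm m by rewrite sE; ring.
  rewrite /axis_norm sum_axes -h0 -h1 -h2; by field.
rewrite axis_weights /= expr0 expr1 mul1r mulN1r.
by have [h _] := mx (axis k m); rewrite -[LHS]h; ring.
Qed.

Lemma cone_setT (R : realType) (m : 'rV[R]_4) :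
  axis_norm m <= ell m <-> cone 1%:M (finset.setTfor octv) m.
Proof.
split=> [le|[w w0]].
  exists (fun v : octv => Num.max ((-1) ^+ v.2 * axis v.1 m) 0 + (ell m - axis_norm m) / 6%:R).
    by move=> v _; rewrite addr_ge0 ?divr_ge0 ?subr_ge0 // le_max lexx orbT.
  rewrite [LHS](weights_axes (erefl _)); apply: eq_big => [v|v _]; first by rewrite inE.
  by rewrite tvec1.
have -> : \sum_(v in finset.setTfor octv) w v *: tvec 1%:M v = \sum_v w v *: octvec R v.
  by apply: eq_big => [v|v _]; rewrite ?inE ?tvec1.
move=> ->; rewrite ell_weights /axis_norm sum_axes !axis_weights sum_octv.
have h k : `|w (k, false) - w (k, true)| <= w (k, false) + w (k, true).
  by have := w0 (k, false); have := w0 (k, true); rewrite !inE ler_norml; lra.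
by rewrite !lerD ?h.
Qed.

Lemma ocone_setT (R : realType) (m : 'rV[R]_4) :
  axis_norm m < ell m <-> ocone 1%:M (finset.setTfor octv) m.
Proof.
split=> [le|[w w0]].
  exists (fun v : octv => Num.max ((-1) ^+ v.2 * axis v.1 m) 0 + (ell m - axis_norm m) / 6%:R).
    by move=> v _; rewrite ltr_wpDl ?divr_gt0 ?subr_gt0 // le_max lexx orbT.
  rewrite [LHS](weights_axes (erefl _)); apply: eq_big => [v|v _]; first by rewrite inE.
  by rewrite tvec1.
have -> : \sum_(v in finset.setTfor octv) w v *: tvec 1%:M v = \sum_v w v *: octvec R v.
  by apply: eq_big => [v|v _]; rewrite ?inE ?tvec1.
move=> ->; rewrite ell_weights /axis_norm sum_axes !axis_weights sum_octv.
have h k : `|w (k, false) - w (k, true)| < w (k, false) + w (k, true).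
  by have := w0 (k, false); have := w0 (k, true); rewrite !inE ltr_norml; lra.
by rewrite !ltrD ?h.
Qed.

(** The vertices of positive weight form a face if they contain no antipodal pair, and m != 0 makes
    it nonempty. For the solid tile, m is either interior or without slack, and then the weights of
    [weights_axes] charge at most one end of each axis. *)
Lemma cone_face (R : realType) (A : 'M[Zi R]_2) S m : SL2 A -> oct_face S ->
  cone A S m -> m != 0 ->
  exists S' : {set octv}, [/\ S' \subset S, oct_face S' & ocone A S' m].
Proof.
move=> sA fS cm m0.
have pos (w : octv -> R) : (forall v, v \in S -> 0 <= w v) ->
    m = \sum_(v in S) w v *: tvec A v ->
    (forall k, ~~ [&& (k, false) \in S, (k, true) \in S, 0 < w (k, false)
       & 0 < w (k, true)]) ->
    exists S' : {set octv}, [/\ S' \subset S, oct_face S' & ocone A S' m].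
  move=> w0 mE hk; pose S' := [set v in S | 0 < w v]%SET.
  have mE' : m = \sum_(v in S') w v *: tvec A v.
    rewrite mE (bigID (fun v => 0 < w v)) /= [X in _ + X]big1 ?addr0.
      by apply: eq_bigl => v; rewrite inE.
    move=> v /andP[vS]; rewrite -leNgt => wv.
    by rewrite (_ : w v = 0) ?scale0r //; apply/eqP; rewrite eq_le wv w0.
  exists S'; split; first by apply/fintype.subsetP => v; rewrite inE => /andP[].
    apply/orP; right; apply/andP; split.
      by apply: contraNneq m0 => S0; rewrite mE' S0 big_set0.
    apply/forallP => k; rewrite !inE; apply: contra (hk k).
    by case/andP=> /andP[-> ->] /andP[-> ->].
  by exists w => // v; rewrite inE => /andP[].
have [ST|ST] := eqVneq S (finset.setTfor octv); last first.
  have [w w0 mE] := cm; apply: (pos w w0 mE) => k.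
  apply/negP => /and4P[h1 h2 _ _].
  by have := oct_face_antip fS ST h1; rewrite h2.
have cm' : cone 1%:M S (rho (\adj A) m) by have := cone_rho (\adj A) cm; rewrite adjK.
rewrite ST in cm'; move/cone_setT: cm'; rewrite le_eqVlt => /orP[/eqP E|lt]; last first.
  exists S; split=> //; rewrite ST; have := ocone_rho A ((ocone_setT _).1 lt).
  by rewrite mulmx1 rho_adjKr.
pose n := rho (\adj A) m.
apply: (pos (fun v : octv => Num.max ((-1) ^+ v.2 * axis v.1 n) 0)) => [v _||k].
- by rewrite le_max lexx orbT.
- rewrite -[LHS](rho_adjKr m sA) -/n {1}(@weights_axes _ n 0); last by rewrite E subrr.
  rewrite rho_sum ST; apply: eq_big => [v|v _]; first by rewrite inE.
  by rewrite mul0r addr0 tvecE.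
- rewrite /= expr0 expr1 mul1r mulN1r !lt_max ltxx !orbF oppr_gt0.
  by apply/negP => /and4P[_ _]; lra.
Qed.

(** * Every point lies in a tile *)

Lemma bounded_gauss (R : realType) (N : R) : exists s : seq (Zi R),
  forall z : Zi R, `|zre z| <= N -> `|zim z| <= N -> z \in s.
Proof.
have [n Nn] : exists n : nat, N <= n%:R.
  exists (Num.bound `|N|); apply: le_trans (ler_norm _) _.
  by rewrite ltW // archi_boundP.
pose r := [seq (i%:Z - n%:Z) | i <- iota 0 (n + n).+1].
have mem_r (k : int) : `|k%:~R| <= (N : R) -> k \in r.
  move=> kN; have : `|k| <= n%:Z.
    by rewrite -(ler_int R) intr_norm (le_trans kN) // -pmulrn.
  move=> kn; apply/mapP; exists (absz (k + n%:Z)); last by rewrite gez0_abs; lia.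
  by rewrite mem_iota; lia.
exists [seq gauss_of R a b | a <- r, b <- r] => z zN zN'.
have [a aE] := intrP (zre_int z); have [b bE] := intrP (zim_int z).
apply/allpairsP; exists (a, b); split=> /=; first by apply: mem_r; rewrite -aE.
  by apply: mem_r; rewrite -bE.
by apply: zi_eqP.
Qed.

Definition mx22 (K : Type) (a b c d : K) : 'M[K]_2 :=
  \matrix_(i, j) if i == 0 then if j == 0 then a else b
                 else if j == 0 then c else d.

Lemma ord2P (P : 'I_2 -> Prop) : P 0 -> P 1 -> forall i, P i.
Proof.
move=> h0 h1 [[|[|//]] h].
- by rewrite (_ : Ordinal h = 0) //; apply: val_inj.
- by rewrite (_ : Ordinal h = 1) //; apply: val_inj.
Qed.

Lemma mx22E (K : Type) (A : 'M[K]_2) : A = mx22 (A 0 0) (A 0 1) (A 1 0) (A 1 1).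
Proof. by apply/matrixP; elim/ord2P; elim/ord2P; rewrite mxE. Qed.

(** The trace of A M A^* is the sum of |p z + r|^2 + |p|^2 t^2 over the rows (p, r) of A. As t > 0
    this bounds p, and then r. The same finiteness later gives the discreteness of the orbits. *)
Lemma bounded_SL2 (R : realType) (z : R[i]) (t K : R) : 0 < t ->
  exists s : seq 'M[Zi R]_2, forall A : 'M[Zi R]_2,
    rho A (mink (inl (z, t))) 0 x0 + rho A (mink (inl (z, t))) 0 x3 <= K -> A \in s.
Proof.
case: z => x y t0; pose L : R := `|K| / t ^+ 2 + 1.
pose N : R := L + (`|K| + 1) + L * (`|x| + `|y|).
(* A crude bound that avoids square roots, from (|a| - 1)^2 >= 0. *)
have le1 (a c : R) : a ^+ 2 <= c -> `|a| <= c + 1.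
  move=> ac; have h : 0 <= (`|a| - 1) ^+ 2 by rewrite sqr_ge0.
  have : `|a| ^+ 2 <= c by rewrite real_normK ?num_real.
  by have := normr_ge0 a; move: h; rewrite sqrrB1; lra.
have L0 : 0 <= L by rewrite addr_ge0 ?divr_ge0 ?sqr_ge0.
have Lxy : 0 <= L * (`|x| + `|y|) by rewrite mulr_ge0 // addr_ge0.
have LN : L <= N by have := normr_ge0 K; rewrite /N; lra.
have [sz hsz] := bounded_gauss N.
exists [seq mx22 q.1.1 q.1.2 q.2.1 q.2.2 | q <-
  [seq (a, b) | a <- [seq (a, b) | a <- sz, b <- sz],
                b <- [seq (a, b) | a <- sz, b <- sz]]] => A.
rewrite /rho mink_inl !mk4E => hK.
pose row (p r : Zi R) := (zre p * x - zim p * y + zre r) ^+ 2 +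
  (zre p * y + zim p * x + zim r) ^+ 2 + (zre p ^+ 2 + zim p ^+ 2) * t ^+ 2.
have row0 p r : 0 <= row p r.
  apply: addr_ge0; first exact: sumsq_ge0.
  by apply: mulr_ge0; [exact: sumsq_ge0|exact: sqr_ge0].
have rowK p r : row p r <= K -> p \in sz /\ r \in sz.
  rewrite /row => h; have h1 := sqr_ge0 (zre p * x - zim p * y + zre r).
  have h2 := sqr_ge0 (zre p * y + zim p * x + zim r).
  have tt : 0 < t ^+ 2 by rewrite exprn_gt0.
  have pK : (zre p ^+ 2 + zim p ^+ 2) * t ^+ 2 <= `|K|.
    by apply: le_trans (ler_norm K); lra.
  have p0 : 0 <= (zre p ^+ 2 + zim p ^+ 2) * t ^+ 2 by rewrite mulr_ge0 ?sumsq_ge0 ?ltW.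
  rewrite -ler_pdivlMr // in pK.
  have s1 := sqr_ge0 (zre p); have s2 := sqr_ge0 (zim p).
  have a1 : `|zre p| <= L by apply: le1; lra.
  have a2 : `|zim p| <= L by apply: le1; lra.
  have KK := ler_norm K.
  have b1 : `|zre p * x - zim p * y + zre r| <= `|K| + 1 by apply: le1; lra.
  have b2 : `|zre p * y + zim p * x + zim r| <= `|K| + 1 by apply: le1; lra.
  have m1 : `|zre p * x| <= L * `|x| by rewrite normrM ler_wpM2r.
  have m2 : `|zim p * x| <= L * `|x| by rewrite normrM ler_wpM2r.
  have m3 : `|zre p * y| <= L * `|y| by rewrite normrM ler_wpM2r.
  have m4 : `|zim p * y| <= L * `|y| by rewrite normrM ler_wpM2r.
  split; apply: hsz; [exact: le_trans a1 LN|exact: le_trans a2 LN| |].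
    move: b1 m1 m4 L0; rewrite /N !ler_norml; clear.
    by move=> /andP[? ?] /andP[? ?] /andP[? ?] ?; apply/andP; split; lra.
  move: b2 m2 m3 L0; rewrite /N !ler_norml; clear.
  by move=> /andP[? ?] /andP[? ?] /andP[? ?] ?; apply/andP; split; lra.
have hrow : row (A 0 0) (A 0 1) + row (A 1 0) (A 1 1) <= K.
  by apply: le_trans hK; rewrite le_eqVlt; apply/orP; left; apply/eqP; rewrite /row /zn; ring.
have [h00 h01] : A 0 0 \in sz /\ A 0 1 \in sz.
  by apply: rowK; have := row0 (A 1 0) (A 1 1); lra.
have [h10 h11] : A 1 0 \in sz /\ A 1 1 \in sz.
  by apply: rowK; have := row0 (A 0 0) (A 0 1); lra.
rewrite [A]mx22E; apply/mapP; exists ((A 0 0, A 0 1), (A 1 0, A 1 1)) => //.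
by apply/allpairsP; exists ((A 0 0, A 0 1), (A 1 0, A 1 1)); split=> //=;
  apply/allpairsP; [exists (A 0 0, A 0 1)|exists (A 1 0, A 1 1)].
Qed.

Lemma seq_argmin (T : eqType) (R : realType) (f : T -> R) (P : T -> Prop)
    (s : seq T) : (exists2 x, x \in s & P x) ->
  exists2 x, P x & forall y, y \in s -> P y -> f x <= f y.
Proof.
elim: s => [[x //]|a s IH] [x xs Px].
have [[x' xs' Px']|h] := pselect (exists2 x, x \in s & P x); last first.
  have xa : x = a.
    by move: xs; rewrite inE => /orP[/eqP //|xs]; exfalso; apply: h; exists x.
  exists a => [|y]; first by rewrite -xa.
  by rewrite inE => /orP[/eqP -> //|ys Py]; exfalso; apply: h; exists y.
have [b Pb bmin] := IH (ex_intro2 _ _ x' xs' Px').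
have [[Pa ab]|h] := pselect (P a /\ f a <= f b).
  exists a => // y; rewrite inE => /orP[/eqP -> //|ys Py].
  exact: le_trans ab (bmin _ ys Py).
exists b => // y; rewrite inE => /orP[/eqP -> Pa|]; last exact: bmin.
by rewrite leNgt; apply/negP => ba; apply: h; split=> //; apply: ltW.
Qed.

(** On the closed forward cone, (x + y)^2 <= 2(x^2 + y^2) <= 2ad <= (a + d)^2/2, and 3/4 is a
    rational bound above 1/sqrt 2. A bound on ell thus bounds the trace, so only finitely many group
    elements compete for the minimum. *)
Lemma ell_trace (R : realType) (m : 'rV[R]_4) : 0 <= qf m -> 0 <= m 0 x0 ->
  0 <= m 0 x3 -> m 0 x0 + m 0 x3 <= 4%:R * ell m.
Proof.
rewrite /qf /ell; move: (m 0 x0) (m 0 x1) (m 0 x2) (m 0 x3) => a x y d q a0 d0.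
have h : (x + y) ^+ 2 <= (3%:R / 4%:R * (a + d)) ^+ 2.
  have := sqr_ge0 (x - y); have := sqr_ge0 (a - d); have := sqr_ge0 (a + d).
  rewrite !expr2; nra.
have ad0 : 0 <= 3%:R / 4%:R * (a + d) by lra.
suff : x + y <= 3%:R / 4%:R * (a + d) by lra.
apply: le_trans (ler_norm _) _; rewrite -[leRHS]ger0_norm //.
by rewrite -ler_sqr ?nnegrE ?normr_ge0 // !real_normK ?num_real.
Qed.

Lemma mx22_00 (K : Type) (a b c d : K) : mx22 a b c d 0 0 = a.
Proof. by rewrite mxE. Qed.
Lemma mx22_01 (K : Type) (a b c d : K) : mx22 a b c d 0 1 = b.
Proof. by rewrite mxE. Qed.
Lemma mx22_10 (K : Type) (a b c d : K) : mx22 a b c d 1 0 = c.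
Proof. by rewrite mxE. Qed.
Lemma mx22_11 (K : Type) (a b c d : K) : mx22 a b c d 1 1 = d.
Proof. by rewrite mxE. Qed.
Definition mx22E' := (mx22_00, mx22_01, mx22_10, mx22_11).

Definition gmx (R : realType) (a a' b b' c c' d d' : int) : 'M[Zi R]_2 :=
  mx22 (gauss_of R a a') (gauss_of R b b') (gauss_of R c c') (gauss_of R d d').

(* If the center of T is, among its images, the closest one to the point then
   the point is in T: these are the centers of the 8 octahedra adjacent to T. *)
Lemma neighbours (R : realType) (n : 'rV[R]_4) :
  (forall g, SL2 g -> ell n <= ell (rho g n)) -> axis_norm n <= ell n.
Proof.
move=> h.
have key (a1 a2 b1 b2 c1 c2 d1 d2 : int) (r : R) :
    a1 * d1 - a2 * d2 - (b1 * c1 - b2 * c2) = 1 ->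
    a1 * d2 + a2 * d1 - (b1 * c2 + b2 * c1) = 0 ->
    ell (rho (gmx R a1 a2 b1 b2 c1 c2 d1 d2) n) = r -> ell n <= r.
  move=> e1 e2 <-; apply: h; apply/SL2E; rewrite !mx22E' !zre_gauss !zim_gauss -!intrM.
  by rewrite -!rmorphD -!rmorphB /= e1 e2.
have E (a1 a2 b1 b2 c1 c2 d1 d2 : int) :
    ell (rho (gmx R a1 a2 b1 b2 c1 c2 d1 d2) n) =
    (a1 ^+ 2 + a2 ^+ 2 + c1 ^+ 2 + c2 ^+ 2 - a1 * c1 - a2 * c2 - a2 * c1 + a1 * c2)%:~R
      * n 0 x0
    + (2 * (a1 * b1 + a2 * b2 + c1 * d1 + c2 * d2) - (a1 * d1 + a2 * d2) - (b1 * c1 + b2 * c2)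
       - (a2 * d1 - a1 * d2) - (b2 * c1 - b1 * c2))%:~R * n 0 x1
    + (- 2 * (a2 * b1 - a1 * b2 + c2 * d1 - c1 * d2) + (a2 * d1 - a1 * d2)
       - (b2 * c1 - b1 * c2) - (a1 * d1 + a2 * d2) + (b1 * c1 + b2 * c2))%:~R * n 0 x2
    + (b1 ^+ 2 + b2 ^+ 2 + d1 ^+ 2 + d2 ^+ 2 - b1 * d1 - b2 * d2 - b2 * d1 + b1 * d2)%:~R
      * n 0 x3.
  rewrite /ell /rho !mk4E !mx22E' /zn !zre_gauss !zim_gauss.
  by rewrite !(rmorphD, rmorphB, rmorphM, rmorphXn, rmorphN) /=; ring.
have h1 := key 1 0 0 1 0 0 1 0 _ erefl erefl (E _ _ _ _ _ _ _ _).
have h2 := key 1 0 1 0 0 0 1 0 _ erefl erefl (E _ _ _ _ _ _ _ _).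
have h3 := key 1 0 (-1) 0 0 0 1 0 _ erefl erefl (E _ _ _ _ _ _ _ _).
have h4 := key 1 0 0 (-1) 0 0 1 0 _ erefl erefl (E _ _ _ _ _ _ _ _).
have h5 := key 1 0 0 0 (-1) 0 1 0 _ erefl erefl (E _ _ _ _ _ _ _ _).
have h6 := key 1 0 0 0 0 1 1 0 _ erefl erefl (E _ _ _ _ _ _ _ _).
have h7 := key (-1) (-1) 0 1 0 (-1) (-1) 1 _ erefl erefl (E _ _ _ _ _ _ _ _).
have h8 := key (-1) 0 0 1 1 1 0 (-1) _ erefl erefl (E _ _ _ _ _ _ _ _).
move: h1 h2 h3 h4 h5 h6 h7 h8 {h key E}; rewrite /axis_norm sum_axes /axis /= /ell.
move: (n 0 x0) (n 0 x1) (n 0 x2) (n 0 x3) => a x y d h1 h2 h3 h4 h5 h6 h7 h8.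
(* These are the face planes of T: the four vertical ones over the sides of the unit square, and the
   four hemispheres with these sides as diameters. *)
have f1 : 0 <= y by move: h1; clear; lra.
have f2 : 0 <= x by move: h2; clear; lra.
have f3 : 0 <= d - x by move: h3; clear; lra.
have f4 : 0 <= d - y by move: h4; clear; lra.
have f5 : 0 <= a - x by move: h5; clear; lra.
have f6 : 0 <= a - y by move: h6; clear; lra.
have f7 : 0 <= a - 2 * x - y + d by move: h7; clear; lra.
have f8 : 0 <= a - x - 2 * y + d by move: h8; clear; lra.
move: f1 f2 f3 f4 f5 f6 f7 f8; clear.
move=> *; case: (ger0P (a - x - y)) => _; case: (ger0P (d - x - y)) => _;
  case: (ger0P (x - y)) => _; lra.
Qed.

Lemma tile_cover (R : realType) (z : R[i]) (t : R) : 0 < t ->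
  exists2 A, SL2 A & cone A (finset.setTfor octv) (mink (inl (z, t))).
Proof.
move=> t0; set m := mink _.
have pos A : 0 <= rho A m 0 x0 /\ 0 <= rho A m 0 x3.
  rewrite /m; case: (z) => x y; rewrite /rho mink_inl !mk4E /zn.
  pose row (p r : Zi R) := (zre p * x - zim p * y + zre r) ^+ 2 +
    (zre p * y + zim p * x + zim r) ^+ 2 + (zre p ^+ 2 + zim p ^+ 2) * t ^+ 2.
  have row0 p r : 0 <= row p r.
    apply: addr_ge0; first exact: sumsq_ge0.
    by apply: mulr_ge0; [exact: sumsq_ge0|exact: sqr_ge0].
  split; [have := row0 (A 0 0) (A 0 1)|have := row0 (A 1 0) (A 1 1)];
    by move=> /le_trans -> //; rewrite le_eqVlt; apply/orP; left; apply/eqP;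
    rewrite /row; ring.
have qm : 0 <= qf m by rewrite qf_mink_inl sqr_ge0.
have tr A : SL2 A -> rho A m 0 x0 + rho A m 0 x3 <= 4%:R * ell (rho A m).
  by move=> sA; have [] := pos A; apply: ell_trace; rewrite rho_qf.
have [s hs] := bounded_SL2 z (4%:R * ell m) t0.
have s1 : 1%:M \in s by apply: hs; rewrite -/m -[m in ell m]rho1 tr //; apply: SL2_1.
have [A sA Amin] := seq_argmin (fun A => ell (rho A m))
  (ex_intro2 _ (fun A => SL2 A) _ s1 (SL2_1 (Zi R))).
have Amin' B : SL2 B -> ell (rho A m) <= ell (rho B m).
  (* A matrix that does at least as well as the identity is in the finite list; any other is beaten
     by the identity, which is in the list. *)
  move=> sB; have [le|lt] := leP (ell (rho B m)) (ell m).
    by apply: Amin => //; apply: hs; rewrite -/m (le_trans (tr _ sB)) // ler_pM2l.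
  by apply: le_trans (ltW lt); rewrite -[m in leRHS]rho1; apply: Amin => //; apply: SL2_1.
exists (\adj A); first exact: adj_SL2.
have := cone_rho (\adj A) ((cone_setT (rho A m)).1 (neighbours _)).
rewrite mulmx1 rho_adjK //; apply=> g sg; rewrite rho_mul; apply: Amin'.
exact: mul_SL2.
Qed.

Lemma mink_neq0 (R : realType) (p : bpoint R) : mink p != 0.
Proof.
apply/eqP => /rowP h; move: (h x0) (h x3) => {h}; rewrite !mxE.
by case: p => [[[x y] t]|[[x y]|]] /= => h1 h2; lra.
Qed.

Lemma cusp_tvec (R : realType) (x : Hstar R) u : val x = inr u ->
  exists A v (c : R), [/\ SL2 A, 0 < c & mink (val x) = c *: tvec A v].
Proof.
move=> xu; have /asboolP := valP x; rewrite xu => -[A [v [sA ->]]].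
have [c c0 ->] := mink_moebius (octv_pos R v) sA.
exists A, v, (c * pos_scale R v); split=> //; first by rewrite mulr_gt0 ?pos_scale_gt0.
by rewrite mink_octv rhoZ tvecE scalerA.
Qed.

Lemma Hstar_cover (R : realType) (x : Hstar R) :
  exists A S, [/\ SL2 A, oct_face S & open_tile_face A S x].
Proof.
have [A sA cA] : exists2 A, SL2 A & cone A (finset.setTfor octv) (mink (val x)).
  have := Hstar_inside x; case xE : (val x) => [[z t]|u] /= h; first exact: tile_cover.
  have [A [v [c [sA c0 mE]]]] := cusp_tvec xE; exists A => //.
  rewrite -xE mE; apply: coneZ (ltW c0) _; apply: (@cone_sub _ _ [set v]%SET).
    by apply/fintype.subsetP => i; rewrite inE.
  by exists (fun=> 1) => //; rewrite big_set1 scale1r.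
have fT : oct_face (finset.setTfor octv) by rewrite /oct_face eqxx.
have [S [_ fS oS]] := cone_face sA fT cA (mink_neq0 _).
by exists A, S; split=> //; apply/open_tile_faceE.
Qed.

(** * Reduction modulo I of small Gaussian integers *)

Definition modI (R : realType) (I : prime_idealr (Zi R)) (x : Zi R) : {ideal_quot I} :=
  (\pi_({ideal_quot I}) x)%qT.

Lemma modID (R : realType) (I : prime_idealr (Zi R)) x y :
  modI I (x + y) = modI I x + modI I y.
Proof. by rewrite /modI rmorphD. Qed.
Lemma modIN (R : realType) (I : prime_idealr (Zi R)) x : modI I (- x) = - modI I x.
Proof. by rewrite /modI rmorphN. Qed.
Lemma modIM (R : realType) (I : prime_idealr (Zi R)) x y :
  modI I (x * y) = modI I x * modI I y.
Proof. by rewrite /modI rmorphM. Qed.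
Lemma modI1 (R : realType) (I : prime_idealr (Zi R)) : modI I 1 = 1.
Proof. by rewrite /modI rmorph1. Qed.
Lemma modI0 (R : realType) (I : prime_idealr (Zi R)) : modI I 0 = 0.
Proof. by rewrite /modI rmorph0. Qed.
Definition modIE := (modID, modIN, modIM, modI1, modI0).

Lemma modI_integral (R : realType) (I : prime_idealr (Zi R)) (x y : {ideal_quot I}) :
  x * y = 0 -> x = 0 \/ y = 0.
Proof. by move=> /Quotient.rquot_IdomainAxiom/orP[] /eqP; [left|right]. Qed.

Lemma modI_int (R : realType) (I : prime_idealr (Zi R)) (n : int) :
  modI I n%:~R = n%:~R.
Proof. by rewrite /modI rmorph_int. Qed.

Lemma zre_intr (R : realType) (n : int) : zre (n%:~R : Zi R) = n%:~R.
Proof.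
have hn (k : nat) : zre (k%:R : Zi R) = k%:R.
  by elim: k => [|k IH]; rewrite ?mulr0n ?zE // !mulrS zE IH zE.
by case: n => n; rewrite ?NegzE ?rmorphN /= ?zE -?pmulrn ?hn.
Qed.

Lemma zim_intr (R : realType) (n : int) : zim (n%:~R : Zi R) = 0.
Proof.
have hn (k : nat) : zim (k%:R : Zi R) = 0.
  by elim: k => [|k IH]; rewrite ?mulr0n ?zE // !mulrS zE IH zE addr0.
by case: n => n; rewrite ?NegzE ?rmorphN /= ?zE -?pmulrn ?hn ?oppr0.
Qed.

Lemma zi_decomp (R : realType) (z : Zi R) : exists a b : int,
  [/\ zre z = a%:~R, zim z = b%:~R & z = a%:~R + b%:~R * gauss_of R 0 1].
Proof.
have [a aE] := intrP (zre_int z); have [b bE] := intrP (zim_int z).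
exists a, b; split=> //; apply: zi_eqP; rewrite !zE ?zre_intr ?zim_intr zre_gauss zim_gauss.
  by rewrite aE; ring.
by rewrite bE; ring.
Qed.

(** The norm of x vanishes in the quotient; given the bounds, it is 0, 5 or a power of 2. Powers of
    2 are nonzero there. Norm 5 would make 5 vanish and i congruent to an integer, so that the
    quotient would have at most five elements. *)
Lemma modI_small (R : realType) (I : prime_idealr (Zi R)) (q : nat) :
  ([set: {ideal_quot I}] #= `I_q)%card -> 2%N \notin [pchar {ideal_quot I}] ->
  (5 < q)%N -> forall x : Zi R, `|zre x| <= 2 -> `|zim x| <= 2 -> modI I x = 0 -> x = 0.
Proof.
move=> cq c2 q5 x xr xi x0.
have two : (2%:R : {ideal_quot I}) != 0.
  by apply: contra c2 => h; rewrite inE /=.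
have [a [b [aE bE xE]]] := zi_decomp x.
set j := modI I (gauss_of R 0 1).
have jj : j * j = - 1.
  rewrite -modIM -modI1 -modIN; congr modI; apply: zi_eqP;
  by rewrite !zE !zre_gauss !zim_gauss; ring.
have xj : (a%:~R : {ideal_quot I}) + b%:~R * j = 0.
  by rewrite -x0 [in RHS]xE !modIE !modI_int.
have a2 : `|a| <= 2 by rewrite -(ler_int R) intr_norm -aE.
have b2 : `|b| <= 2 by rewrite -(ler_int R) intr_norm -bE.
have nj : (a * a + b * b)%:~R = 0 :> {ideal_quot I}.
  have -> : (a * a + b * b)%:~R = (a%:~R + b%:~R * j) * (a%:~R - b%:~R * j)
      + b%:~R * b%:~R * (1 + j * j) :> {ideal_quot I}.
    by rewrite rmorphD !rmorphM /=; ring.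
  by rewrite xj jj; ring.
have pow2 (k : nat) : (2 ^ k)%N%:R != 0 :> {ideal_quot I}.
  elim: k => [|k IH]; first exact: oner_neq0.
  apply/eqP; rewrite expnS natrM => /modI_integral[] /eqP; first by rewrite (negPf two).
  by rewrite (negPf IH).
have no5 (k : int) : j = k%:~R -> 5%:R = 0 :> {ideal_quot I} -> False.
  move=> jk f0; have surj (y : {ideal_quot I}) : exists2 n : nat, (n < 5)%N & y = n%:R.
    pose z := repr y; have [c [d [_ _ zE]]] := zi_decomp z.
    have yE : y = (c + d * k)%:~R.
      rewrite -[LHS]reprK -/(modI I (repr y)) -/z zE !modIE !modI_int -/j jk.
      by rewrite rmorphD rmorphM.
    exists (absz ((c + d * k) %% 5)%Z); first by lia.
    have e : (c + d * k) = ((c + d * k) %/ 5)%Z * 5 + (absz ((c + d * k) %% 5)%Z)%:Z by lia.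
    rewrite yE {1}e rmorphD rmorphM /= (_ : 5%:~R = 0) ?mulr0 ?add0r //.
  have : (`I_q #<= `I_5)%card.
    rewrite -(card_le_eql cq); apply: card_le_trans (card_image_le (fun n : nat => n%:R) `I_5).
    by apply: subset_card_le => y _; have [n n5 ->] := surj y; exists n.
  by rewrite card_le_II leqNgt q5.
have five (k : int) : k \in [:: -2; -1; 0; 1; 2] <-> `|k| <= 2.
  by rewrite !inE; split; lia.
have key : [\/ a = 0 /\ b = 0, exists k, a * a + b * b = (2 ^ k)%N,
    a * a + b * b = 5 /\ b * b = 1 | a * a + b * b = 5 /\ b * b = 4].
  move/five: a2; move/five: b2; rewrite !inE.
  by do 4?[case/orP]; move=> /eqP ->; do 4?[case/orP]; move=> /eqP ->;
    do [by constructor 1|by constructor 2; exists 0%N|by constructor 2; exists 1%N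
       |by constructor 2; exists 2%N|by constructor 2; exists 3%N|by constructor 3
       |by constructor 4].
have bj : (b * b)%:~R * j = - (a * b)%:~R :> {ideal_quot I}.
  have -> : (b * b)%:~R * j = b%:~R * (a%:~R + b%:~R * j) - (a * b)%:~R :> {ideal_quot I}.
    by rewrite !rmorphM /=; ring.
  by rewrite xj mulr0 sub0r.
case: key => [[a0 b0]|[k kE]|[n5 b1]|[n5 b4]].
- by apply: zi_eqP; rewrite ?aE ?bE ?a0 ?b0.
- by exfalso; have := pow2 k; rewrite pmulrn -kE nj eqxx.
- exfalso; apply: (no5 (- (a * b))); last by rewrite pmulrn -[RHS]nj n5.
  by rewrite rmorphN -bj b1 mul1r.
- have f0 : 5%:R = 0 :> {ideal_quot I} by rewrite pmulrn -[RHS]nj n5.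
  exfalso; apply: (no5 (a * b)) => //.
  (* As 5 = 0, the factor b^2 = 4 is -1, whence j = - b^2 j = ab. *)
  have -> : j = 5%:R * j - (b * b)%:~R * j by rewrite b4; ring.
  by rewrite f0 bj; ring.
Qed.

(** * Determinants of vertices, and vectors over the same vertex *)

Lemma polar_octvec (R : realType) (u v : octv) :
  polar (octvec R u) (octvec R v) =
  if u == v then 0 else if u.1 == v.1 then 2 else 1.
Proof.
by elim/octv_ind: u; elim/octv_ind: v; rewrite /polar !ovE !mk4E /=; ring.
Qed.

Lemma zn_det_vec (R : realType) (u v : octv) :
  zn (det2 (vec R u) (vec R v)) = if u == v then 0 else if u.1 == v.1 then 2 else 1.
Proof. by rewrite -polar_octvec octvec.unlock polar_lightvec. Qed.

Lemma det2_mul (R : realType) (A : 'M[Zi R]_2) (u v : 'cV[Zi R]_2) :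
  det2 (A *m u) (A *m v) = \det A * det2 u v.
Proof. by rewrite /det2 !colE det_mx22; ring. Qed.

Lemma det2_mulSL (R : realType) (A : 'M[Zi R]_2) (u v : 'cV[Zi R]_2) : SL2 A ->
  det2 (A *m u) (A *m v) = det2 u v.
Proof. by move=> sA; rewrite det2_mul sA mul1r. Qed.

Lemma det2Z (R : realType) (a b : Zi R) (u v : 'cV[Zi R]_2) :
  det2 (a *: u) (b *: v) = a * b * det2 u v.
Proof. by rewrite /det2 !mxE; ring. Qed.

(** The floors only convert integral real coordinates to [int]. *)
Definition zconj (R : realType) (z : Zi R) : Zi R :=
  let a := Num.floor (zre z) in let b := Num.floor (zim z) in gauss_of R a (- b).

Lemma zconjK (R : realType) (z : Zi R) : zre (zconj z * z) = zn z /\ zim (zconj z * z) = 0.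
Proof.
rewrite /zconj !zE zre_gauss zim_gauss rmorphN /= !floorK ?zre_int ?zim_int //.
by rewrite /zn; split; ring.
Qed.

Lemma unit_conj (R : realType) (z : Zi R) : zn z = 1 -> zconj z * z = 1.
Proof. by have [h1 h2] := zconjK z => z1; apply: zi_eqP; rewrite ?h1 ?h2 ?z1. Qed.

Lemma col2P (R : realType) (u v : 'cV[Zi R]_2) : u 0 0 = v 0 0 -> u 1 0 = v 1 0 -> u = v.
Proof. by move=> h0 h1; apply/colP; elim/ord2P. Qed.

Lemma lightvecZ (R : realType) (e : Zi R) (v : 'cV[Zi R]_2) :
  lightvec (e *: v) = zn e *: lightvec v.
Proof.
by apply: row4P; rewrite [RHS]mxE /lightvec !mk4E !mxE /zn !zE; ring.
Qed.

(** A vertex on another axis completes A k to a basis of Z[i]^2, their determinant being a unit.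
    Cramer's rule then expresses v, and its second coefficient is zero. *)
Lemma det2_colinear (R : realType) (A : 'M[Zi R]_2) (k : octv) (v : 'cV[Zi R]_2) :
  SL2 A -> det2 (A *m vec R k) v = 0 -> exists e, v = e *: (A *m vec R k).
Proof.
move=> sA; set u := A *m _ => uv.
have [k' kk'] : exists k' : octv, k'.1 != k.1.
  by elim/octv_ind: (k); [exists (i31, true)|exists (i31, true)|exists (i30, true)..].
pose u' := A *m vec R k'; pose d := det2 u u'.
have d1 : zn d = 1.
  rewrite /d det2_mulSL // zn_det_vec [k.1 == _]eq_sym (negPf kk').
  by case: eqP => // kE; rewrite kE eqxx in kk'.
exists (zconj d * det2 v u').
have h i : v i 0 * d = det2 v u' * u i 0.
  have -> : v i 0 * d = u i 0 * det2 v u' + u' i 0 * det2 u v.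
    by move: i; elim/ord2P; rewrite /d /det2; ring.
  by rewrite uv mulr0 addr0 mulrC.
by apply/colP => i; rewrite mxE -mulrA -h mulrCA unit_conj ?mulr1.
Qed.

(** A light vector pairs to zero with itself, so v and A k have zero determinant and are
    proportional; comparing levels gives the norm of the factor. *)
Lemma lightvec_unit (R : realType) (A : 'M[Zi R]_2) (k : octv) (v : 'cV[Zi R]_2) :
  SL2 A -> lightvec v = tvec A k ->
  exists2 e, zn e = 1 & v = e *: (A *m vec R k).
Proof.
move=> sA vE; have [|e eE] := @det2_colinear _ A k v sA.
  apply: zn_eq0; rewrite -polar_lightvec vE tvec_def polar_lightvec /det2.
  by rewrite /zn !zE; ring.
exists e => //; have := congr1 (@lightvec R) eE; rewrite lightvecZ vE -tvec_def.
move=> /(congr1 (fun m => ell (rho (\adj A) m))); rewrite rhoZ tvecE rho_adjK //.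
by rewrite ellZ ell_octvec mulr1.
Qed.

Lemma tvec_unit (R : realType) (A B : 'M[Zi R]_2) (u v : octv) :
  SL2 A -> tvec B v = tvec A u ->
  exists2 e, zn e = 1 & B *m vec R v = e *: (A *m vec R u).
Proof. by move=> sA; rewrite {1}tvec_def; exact: lightvec_unit. Qed.

Lemma zre_le (R : realType) (z : Zi R) : zn z <= 2 -> `|zre z| <= 1 /\ `|zim z| <= 1.
Proof.
have h (x : R) : x \is a Num.int -> x ^+ 2 <= 2 -> `|x| <= 1.
  move=> /intrP[n ->]; rewrite -intr_norm -rmorphXn /= -[2]/(2%:~R) -[1]/(1%:~R) !ler_int.
  by move=> n2; nia.
rewrite /zn => z2; have := sqr_ge0 (zre z); have := sqr_ge0 (zim z) => a b.
by split; apply: h; rewrite ?zre_int ?zim_int //; lra.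
Qed.

(* 1 + i is the prime over 2, and its residue field is F_2. *)
Definition ramified (R : realType) (z : Zi R) := exists c, z = gauss_of R 1 1 * c.

Lemma ramifiedD (R : realType) (z w : Zi R) : ramified z -> ramified w -> ramified (z + w).
Proof. by move=> [c ->] [d ->]; exists (c + d); rewrite mulrDr. Qed.

Lemma ramifiedM (R : realType) (z w : Zi R) : ramified z -> ramified (w * z).
Proof. by move=> [c ->]; exists (w * c); rewrite mulrCA. Qed.

Lemma ramified_unit (R : realType) (z : Zi R) : zn z = 1 -> ramified (z - 1).
Proof.
move=> z1; have [a [b [aE bE _]]] := zi_decomp z.
have : a * a + b * b = 1.
  apply/eqP; rewrite -(eqr_int R) rmorphD !rmorphM /= -aE -bE -z1 /zn; apply/eqP; ring.
move=> ab; have [k kE] : exists k : int, a + b - 1 = 2 * k.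
  by exists ((a + b - 1) %/ 2)%Z; nia.
(* The quotient of (a - 1) + bi by 1 + i is ((a + b - 1) + (b - a + 1) i)/2. *)
exists (gauss_of R k (b - k)).
apply: zi_eqP; rewrite !zE !zre_gauss !zim_gauss ?aE ?bE.
  by rewrite !mul1r -rmorphB -[1]/(1%:~R) -rmorphB /=; congr intmul; lia.
by rewrite !mul1r -rmorphD /= oppr0 addr0; congr intmul; lia.
Qed.

(** Modulo 1 + i the vertices reduce to the three points of the projective line over F_2, one for
    each axis. *)
Lemma ramified_vec (R : realType) (u v : octv) i : u.1 = v.1 ->
  ramified (vec R u i 0 - vec R v i 0).
Proof.
have z0 : ramified (0 : Zi R) by exists 0; rewrite mulr0.
have ex (a b k : int) : b - a = 2 * k -> ramified (gauss_of R a b).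
  move=> h; exists (gauss_of R (a + k) k).
  apply: zi_eqP; rewrite !zE !zre_gauss !zim_gauss !mul1r -?rmorphB -?rmorphD /=;
    congr intmul; lia.
have exB (k a b a' b' : int) : b - b' - (a - a') = 2 * k ->
    ramified (gauss_of R a b - gauss_of R a' b').
  have -> : gauss_of R a b - gauss_of R a' b' = gauss_of R (a - a') (b - b').
    by apply: zi_eqP; rewrite !zE ?(zre_gauss, zim_gauss) rmorphB.
  exact: ex.
by elim/octv_ind: u; elim/octv_ind: v => //= _; elim/ord2P: i; rewrite !mxE /=;
  do [exact: (@exB 0)|exact: (@exB 1)|exact: (@exB (-1))].
Qed.

Lemma polar_light_inside (R : realType) (v : 'cV[Zi R]_2) x y t :
  polar (lightvec v) (mink (inl (Complex x y, t))) =
  (zre (v 0 0) - (zre (v 1 0) * x - zim (v 1 0) * y)) ^+ 2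
  + (zim (v 0 0) - (zre (v 1 0) * y + zim (v 1 0) * x)) ^+ 2
  + zn (v 1 0) * t ^+ 2.
Proof. by rewrite mink_inl /polar /lightvec !mk4E /zn; ring. Qed.

Lemma scolE (R : realType) (e : Zi R) (v : 'cV[Zi R]_2) i :
  (e *: v) i 0 = e * v i 0.
Proof. by rewrite mxE. Qed.

(** * From congruences of vectors to a single element of the kernel *)

Definition cong_vec (R : realType) (I : prime_idealr (Zi R)) (u v : 'cV[Zi R]_2) :=
  forall i, modI I (u i 0) = modI I (v i 0).

Lemma cong_det2 (R : realType) (I : prime_idealr (Zi R)) (u v u' v' : 'cV[Zi R]_2) :
  cong_vec I u u' -> cong_vec I v v' -> modI I (det2 u v) = modI I (det2 u' v').
Proof. by move=> hu hv; rewrite /det2 !modIE !hu !hv. Qed.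

(** The sign allowed by PSL_2 is recorded as a unit s, to be merged with the units relating vectors
    over one vertex. *)
Lemma Gamma0_cong (R : realType) (I : prime_idealr (Zi R)) (g : 'M[Zi R]_2) :
  Gamma0 I g -> exists2 s : Zi R, zn s = 1 & forall u, cong_vec I (g *m u) (s *: u).
Proof.
have E (s : Zi R) : map_mx (modI I) g = (modI I s)%:M ->
    forall u, cong_vec I (g *m u) (s *: u).
  move=> h u; have gE i j : modI I (g i j) = (modI I s) *+ (i == j).
    by have := congr1 (fun m : 'M[_]_2 => m i j) h; rewrite !mxE.
  by elim/ord2P; rewrite colE !mxE !modIE !gE /=; ring.
case=> sg [h|h]; [exists 1|exists (-1)]; rewrite ?znN ?zn1 //; apply: E.
  by rewrite modI1.
by rewrite modIN modI1 h raddfN.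
Qed.

Lemma Gamma0_of_cong (R : realType) (I : prime_idealr (Zi R)) (g : 'M[Zi R]_2) :
  SL2 g -> (forall i j, modI I (g i j) = (i == j)%:R) -> Gamma0 I g.
Proof.
by move=> sg h; split=> //; left; apply/matrixP => i j; rewrite !mxE -h.
Qed.

(** Norm at most 2 means coordinates at most 1, so a difference falls within the bound 2 of
    [modI_small]. *)
Lemma small_eq (R : realType) (I : prime_idealr (Zi R)) (q : nat) :
  ([set: {ideal_quot I}] #= `I_q)%card -> 2%N \notin [pchar {ideal_quot I}] ->
  (5 < q)%N -> forall x y : Zi R, zn x <= 2 -> zn y <= 2 -> modI I x = modI I y -> x = y.
Proof.
move=> h1 h2 h3 x y xs ys xy; have [rx ix] := zre_le xs; have [ry iy] := zre_le ys.
apply/eqP; rewrite -subr_eq0; apply/eqP; apply: (modI_small h1 h2 h3).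
- by rewrite !zE; move: rx ry; rewrite !ler_norml; lra.
- by rewrite !zE; move: ix iy; rewrite !ler_norml; lra.
- by rewrite !modIE xy subrr.
Qed.

Lemma zn_det_vec_le (R : realType) (A : 'M[Zi R]_2) u v (e f : Zi R) : SL2 A ->
  zn e = 1 -> zn f = 1 -> zn (det2 (e *: (A *m vec R u)) (f *: (A *m vec R v))) <= 2.
Proof.
move=> sA e1 f1; rewrite det2Z det2_mulSL // !znM e1 f1 !mul1r zn_det_vec.
by case: eqP => _; [|case: eqP => _]; lra.
Qed.

(* The linear map sending a1 to b1 and a2 to b2. When a1 and a2 do not generate
   Z[i]^2 they come from antipodal vertices, and are congruent mod 1 + i. *)
Lemma basis_change (R : realType) (I : prime_idealr (Zi R)) (a1 a2 b1 b2 : 'cV[Zi R]_2) :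
  det2 a1 a2 = det2 b1 b2 -> modI I (det2 a1 a2) <> 0 ->
  cong_vec I a1 b1 -> cong_vec I a2 b2 ->
  zn (det2 a1 a2) = 1 \/ (zn (det2 a1 a2) = 2 /\
    forall i, ramified (a1 i 0 - a2 i 0) /\ ramified (b1 i 0 - b2 i 0)) ->
  exists2 g, Gamma0 I g & g *m a1 = b1 /\ g *m a2 = b2.
Proof.
set d := det2 a1 a2 => db d0 c1 c2 hd.
(* By Cramer's rule, N is d times the matrix (b1 b2)(a1 a2)^-1; it remains to divide it by d. *)
pose N i (j : 'I_2) := if j == 0 then a2 1 0 * b1 i 0 - a1 1 0 * b2 i 0
                       else a1 0 0 * b2 i 0 - a2 0 0 * b1 i 0.
have /boolp.choice[c cE] : forall p : 'I_2 * 'I_2, exists c, N p.1 p.2 = c * d.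
  move=> [i j] /=; case: hd => [d1|[d2 ram]].
    by exists (N i j * zconj d); rewrite -mulrA unit_conj // mulr1.
  have ramN : ramified (N i j).
    rewrite /N; case: ifP => _.
      have -> : a2 1 0 * b1 i 0 - a1 1 0 * b2 i 0 =
          (- b1 i 0) * (a1 1 0 - a2 1 0) + a1 1 0 * (b1 i 0 - b2 i 0) by ring.
      by apply: ramifiedD; apply: ramifiedM; [have [] := ram 1|have [] := ram i].
    have -> : a1 0 0 * b2 i 0 - a2 0 0 * b1 i 0 =
        b1 i 0 * (a1 0 0 - a2 0 0) + (- a1 0 0) * (b1 i 0 - b2 i 0) by ring.
    by apply: ramifiedD; apply: ramifiedM; [have [] := ram 0|have [] := ram i].
  have [e eE] : ramified d.
    have -> : d = a2 1 0 * (a1 0 0 - a2 0 0) + (- a2 0 0) * (a1 1 0 - a2 1 0).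
      by rewrite /d /det2; ring.
    by apply: ramifiedD; apply: ramifiedM; [have [] := ram 0|have [] := ram 1].
  (* Both d and 1 + i have norm 2, so the cofactor e is a unit, and divisibility by d amounts to
     divisibility by 1 + i. *)
  have e1 : zn e = 1.
    move: d2; rewrite eE znM {1}/zn zre_gauss zim_gauss.
    by rewrite rmorph1 expr1n; lra.
  have [f fE] := ramN; exists (f * zconj e).
  by rewrite fE eE -mulrA [zconj e * _]mulrCA unit_conj // mulr1 mulrC.
pose g : 'M[Zi R]_2 := \matrix_(i, j) c (i, j).
have dn : d <> 0 by move=> dz; apply: d0; rewrite dz modI0.
have can (x y : Zi R) : x * d = y * d -> x = y.
  move=> h; have : (x - y) * d = 0 by rewrite mulrBl h subrr.
  by case/zi_integral => // /eqP; rewrite subr_eq0 => /eqP.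
have gN i j : g i j * d = N i j by rewrite mxE -cE.
have g1 : g *m a1 = b1.
  apply/colP => i; apply: can; rewrite colE mulrDl mulrAC gN [_ * a1 1 0 * d]mulrAC gN.
  by rewrite /N /= /d /det2; ring.
have g2 : g *m a2 = b2.
  apply/colP => i; apply: can; rewrite colE mulrDl mulrAC gN [_ * a2 1 0 * d]mulrAC gN.
  by rewrite /N /= /d /det2; ring.
exists g; last by [].
apply: Gamma0_of_cong.
  by apply: can; rewrite -det2_mul g1 g2 mul1r db.
(* Modulo I, replacing the vectors b by the congruent vectors a turns N into d times the identity,
   and d is not zero there. *)
move=> i j; have /modI_integral[//|/eqP] :
    modI I d * (modI I (g i j) - (i == j)%:R) = 0; last by rewrite subr_eq0 => /eqP.
have -> : modI I d * (modI I (g i j) - (i == j)%:R) =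
    modI I (g i j * d) - modI I d * (i == j)%:R by rewrite modIM; ring.
rewrite gN /N /d /det2; move: i j; elim/ord2P; elim/ord2P => /=;
  rewrite !modIE -!c1 -!c2; ring.
Qed.

Lemma det2_inj (R : realType) (b1 b2 x y : 'cV[Zi R]_2) : det2 b1 b2 <> 0 ->
  det2 x b1 = det2 y b1 -> det2 x b2 = det2 y b2 -> x = y.
Proof.
move=> bn; rewrite /det2 => d1 d2.
have can (z w : Zi R) : z * det2 b1 b2 = w * det2 b1 b2 -> z = w.
  move=> h; have : (z - w) * det2 b1 b2 = 0 by rewrite mulrBl h subrr.
  by case/zi_integral => // /eqP; rewrite subr_eq0 => /eqP.
have exp (w : 'cV[Zi R]_2) i : w i 0 * det2 b1 b2 =
    (w 0 0 * b2 1 0 - w 1 0 * b2 0 0) * b1 i 0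
    - (w 0 0 * b1 1 0 - w 1 0 * b1 0 0) * b2 i 0.
  by move: i; elim/ord2P; rewrite /det2; ring.
by apply/colP => i; apply: can; rewrite !exp d1 d2.
Qed.

(** In the hypothesis g varies with v. Two vertices, with suitable unit multiples b1, b2 of their
    targets, fix one g. The determinants of a third vertex with these two are congruent, hence
    equal, to those of its target, so the same g carries it there. *)
Lemma common_element (R : realType) (I : prime_idealr (Zi R)) (q : nat)
    (A B : 'M[Zi R]_2) (S' W : {set octv}) :
  ([set: {ideal_quot I}] #= `I_q)%card -> 2%N \notin [pchar {ideal_quot I}] ->
  (5 < q)%N -> SL2 A -> SL2 B -> W != finset.set0 ->
  (forall v, v \in W -> exists g u, [/\ Gamma0 I g, u \in S' & tvec (g *m A) v = tvec B u]) ->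
  exists2 g, Gamma0 I g &
    forall v, v \in W -> exists2 u, u \in S' & tvec (g *m A) v = tvec B u.
Proof.
move=> h1 h2 h3 sA sB W0 hW; have small := small_eq h1 h2 h3.
have [v1 v1W] : exists v, v \in W by apply/finset.set0Pn.
have [[v2 v2W v21]|only] := pselect (exists2 v2, v2 \in W & v2 != v1); last first.
  have [g [u [gG uS E]]] := hW v1 v1W; exists g => // v vW.
  have -> : v = v1; last by exists u.
  by apply/eqP; apply/negP => /negP vv; apply: only; exists v.
have rel v : v \in W -> exists u e, [/\ u \in S', zn e = 1 &
    cong_vec I (A *m vec R v) (e *: (B *m vec R u))].
  move=> vW; have [g [u [gG uS E]]] := hW v vW.
  have [e e1 eE] := tvec_unit sB E; have [s s1 sE] := Gamma0_cong gG.
  (* As s (A v) is congruent to g A v = e (B u), the inverse [zconj s] of s moves all the units to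
     one side. *)
  have e1' : zn (zconj s * e) = 1.
    by rewrite znM e1 -s1 -znM (unit_conj s1) zn1.
  exists u, (zconj s * e); split; [exact: uS|exact: e1'|].
  move=> i; have := sE (A *m vec R v) i; rewrite mulmxA eE !scolE => h.
  by rewrite -mulrA modIM h -modIM mulrA unit_conj // mul1r.
have [u1 [e1 [u1S e1E r1]]] := rel v1 v1W.
have [u2 [e2 [u2S e2E r2]]] := rel v2 v2W.
pose a1 := A *m vec R v1; pose a2 := A *m vec R v2.
pose b1 := e1 *: (B *m vec R u1); pose b2 := e2 *: (B *m vec R u2).
have detle u v : zn (det2 (A *m vec R u) (A *m vec R v)) <= 2.
  by have := @zn_det_vec_le R A u v 1 1 sA (zn1 R) (zn1 R); rewrite !scale1r.
have d12 : det2 a1 a2 = det2 b1 b2 :=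
  small _ _ (detle v1 v2) (zn_det_vec_le u1 u2 sB e1E e2E) (cong_det2 r1 r2).
have znd : zn (det2 a1 a2) = if v1.1 == v2.1 then 2 else 1.
  by rewrite det2_mulSL // zn_det_vec eq_sym (negPf v21).
have znd' : zn (det2 b1 b2) = if u1 == u2 then 0 else if u1.1 == u2.1 then 2 else 1.
  by rewrite det2Z det2_mulSL // !znM e1E e2E !mul1r zn_det_vec.
have dn : modI I (det2 a1 a2) <> 0.
  rewrite -(modI0 I) => /small dz; have : det2 a1 a2 = 0.
    by apply: dz; [exact: detle|rewrite /zn !zE; lra].
  by move=> z; move: znd; rewrite z /zn !zE; case: ifP => _; lra.
have [g gG [ga1 ga2]] : exists2 g, Gamma0 I g & g *m a1 = b1 /\ g *m a2 = b2.
  apply: (basis_change d12 dn r1 r2).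
  have [v12|v12] := eqVneq v1.1 v2.1; last by left; rewrite znd (negPf v12).
  right; rewrite znd v12 eqxx; split=> // i.
  have u12 : u1.1 = u2.1.
    move: znd'; rewrite -d12 znd v12 eqxx; case: eqP => _; first by move=> ?; exfalso; lra.
    by case: eqP => // _ ?; exfalso; lra.
  have ram (C : 'M[Zi R]_2) u v : u.1 = v.1 ->
      ramified ((C *m vec R u) i 0 - (C *m vec R v) i 0).
    move=> uv; rewrite !colE.
    have -> : C i 0 * vec R u 0 0 + C i 1 * vec R u 1 0 -
      (C i 0 * vec R v 0 0 + C i 1 * vec R v 1 0) =
      C i 0 * (vec R u 0 0 - vec R v 0 0) + C i 1 * (vec R u 1 0 - vec R v 1 0) by ring.
    by apply: ramifiedD; apply/ramifiedM/ramified_vec.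
  split; first exact: ram.
  rewrite /b1 /b2 !scolE.
  set p := (B *m vec R u1) i 0; set p' := (B *m vec R u2) i 0.
  (* Units are congruent to 1 modulo 1 + i, so they do not affect the congruence of antipodal
     vertices. *)
  have -> : e1 * p - e2 * p' = (p - p') + (p * (e1 - 1) + (- p') * (e2 - 1)) by ring.
  apply: ramifiedD; first exact: ram.
  by apply: ramifiedD; apply/ramifiedM/ramified_unit.
exists g => // v vW; have [u3 [e3 [u3S e3E r3]]] := rel v vW.
exists u3; first exact: u3S.
pose a3 := A *m vec R v; pose b3 := e3 *: (B *m vec R u3).
have sg : SL2 g by case: gG.
have d31 : det2 a3 a1 = det2 b3 b1 :=
  small _ _ (detle v v1) (zn_det_vec_le u3 u1 sB e3E e1E) (cong_det2 r3 r1).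
have d32 : det2 a3 a2 = det2 b3 b2 :=
  small _ _ (detle v v2) (zn_det_vec_le u3 u2 sB e3E e2E) (cong_det2 r3 r2).
rewrite -(det2_mulSL _ _ sg) ga1 in d31; rewrite -(det2_mulSL _ _ sg) ga2 in d32.
have bn : det2 b1 b2 <> 0 by rewrite -d12 => z; apply: dn; rewrite z modI0.
have ga3 := det2_inj bn d31 d32.
by rewrite !tvec_def -mulmxA -/a3 ga3 lightvecZ e3E scale1r.
Qed.

(** * Faces in the quotient: embedding, intersections and disjointness *)

Lemma tvec_inj (R : realType) (A : 'M[Zi R]_2) u v : SL2 A ->
  tvec A u = tvec A v -> u = v.
Proof.
move=> sA /(congr1 (rho (\adj A))); rewrite !tvecE !rho_adjK // => uv.
have := polar_octvec R u v; rewrite uv polar_octvec eqxx => {uv}.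
by case: eqP => // _; case: eqP => _ ?; exfalso; lra.
Qed.

(** The chosen f is not known to be injective here, so the weights are added along its fibres. *)
Lemma cone_map (R : realType) (A B : 'M[Zi R]_2) (S S' : {set octv}) m :
  (forall v, v \in S -> exists2 u, u \in S' & tvec A v = tvec B u) ->
  cone A S m -> cone B S' m.
Proof.
move=> h [w w0 ->]; have /boolp.choice[f fE] : forall v : octv, exists u : octv,
    v \in S -> u \in S' /\ tvec A v = tvec B u.
  move=> v; have [vS|] := boolP (v \in S); last by exists v.
  by have [u uS E] := h v vS; exists u.
exists (fun u => \sum_(v in S | f v == u) w v) => [u _|].
  by apply: sumr_ge0 => v /andP[vS _]; apply: w0.
rewrite (partition_big f (fun u => u \in S')) /=; last by move=> v /fE[].
apply: eq_bigr => u _; rewrite scaler_suml; apply: eq_bigr => v /andP[vS /eqP <-].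
by have [_ ->] := fE v vS.
Qed.

Lemma ocone_map (R : realType) (A B : 'M[Zi R]_2) (S S' : {set octv}) m : SL2 B ->
  (forall v, v \in S -> exists2 u, u \in S' & tvec A v = tvec B u) ->
  (forall u, u \in S' -> exists2 v, v \in S & tvec B u = tvec A v) ->
  ocone A S m -> ocone B S' m.
Proof.
move=> sB h h' [w w0 ->]; have /boolp.choice[f fE] : forall v : octv, exists u : octv,
    v \in S -> u \in S' /\ tvec A v = tvec B u.
  move=> v; have [vS|] := boolP (v \in S); last by exists v.
  by have [u uS E] := h v vS; exists u.
exists (fun u => \sum_(v in S | f v == u) w v) => [u uS|].
  have [v vS E] := h' u uS; have [_ E'] := fE v vS.
  have fv : f v = u by apply: (tvec_inj sB); rewrite -E' -E.
  rewrite (bigD1 v) /=; last by rewrite vS fv eqxx.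
  rewrite ltr_wpDr ?w0 // sumr_ge0 // => i /andP[/andP[iS _] _].
  exact/ltW/w0.
rewrite (partition_big f (fun u => u \in S')) /=; last by move=> v /fE[].
apply: eq_bigr => u _; rewrite scaler_suml; apply: eq_bigr => v /andP[vS /eqP <-].
by have [_ ->] := fE v vS.
Qed.

Lemma tvec_map_card (R : realType) (A B : 'M[Zi R]_2) (S S' : {set octv}) :
  SL2 A -> (forall v, v \in S -> exists2 u, u \in S' & tvec A v = tvec B u) ->
  (#|S| <= #|S'|)%N.
Proof.
move=> sA h; have /boolp.choice[f fE] : forall v : octv, exists u : octv,
    v \in S -> u \in S' /\ tvec A v = tvec B u.
  move=> v; have [vS|] := boolP (v \in S); last by exists v.
  by have [u uS E] := h v vS; exists u.
have finj : {in S &, injective f}.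
  move=> u v uS vS fuv; have [_ Eu] := fE u uS; have [_ Ev] := fE v vS.
  by apply: (tvec_inj sA); rewrite Eu Ev fuv.
rewrite -(card_in_imset finj); apply: subset_leq_card; apply/fintype.subsetP => u.
by move=> /finset.imsetP[v vS ->]; have [] := fE v vS.
Qed.

Lemma Gamma0_mul (R : realType) (I : prime_idealr (Zi R)) (A B : 'M[Zi R]_2) :
  Gamma0 I A -> Gamma0 I B -> Gamma0 I (A *m B).
Proof.
move=> [sA eA] [sB eB]; split; first exact: mul_SL2.
rewrite /PSL2_eq map_mxM.
by case: eA eB => [->|->] [->|->]; rewrite ?mulNmx ?mulmxN ?mulmx1 ?opprK;
  [left|right|right|left].
Qed.

Lemma Gamma0_1 (R : realType) (I : prime_idealr (Zi R)) : Gamma0 I 1%:M.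
Proof.
apply: Gamma0_of_cong; first exact: SL2_1.
by move=> i j; rewrite mxE; case: eqP => _; rewrite ?modI1 ?modI0.
Qed.

Lemma Gamma0_adj (R : realType) (I : prime_idealr (Zi R)) (A : 'M[Zi R]_2) :
  Gamma0 I A -> Gamma0 I (\adj A).
Proof.
move=> [sA eA]; split; first exact: adj_SL2.
have := congr1 (map_mx \pi_({ideal_quot I})%qT) (adjK sA); rewrite map_mxM.
case: eA => ->; rewrite ?mulmxN mulmx1 map_scalar_mx rmorph1; first by left.
by move/eqP; rewrite eqr_oppLR => /eqP; right.
Qed.

Lemma proj_eq (R : realType) (I : prime_idealr (Zi R)) (x y : Hstar R) :
  proj_quotient I x = proj_quotient I y <-> exists2 g, Gamma0 I g & y = hact g x.
Proof.
have E : proj_quotient I x = proj_quotient I y <-> orbit0 I x = orbit0 I y.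
  split=> [/eqmodP/asboolP //|h]; exact/eqmodP/asboolP.
have orb (u v : Hstar R) : orbit0 I u v <-> exists2 g, Gamma0 I g & v = hact g u.
  split=> -[g gG vE]; exists g => //; have [sg _] := gG.
    by apply: val_inj; rewrite val_hact.
  by rewrite vE val_hact.
rewrite E; split=> [xy|[g gG ->]].
  by apply/orb; rewrite xy; apply/orb; exists 1%:M; [exact: Gamma0_1|rewrite hact1].
have [sg _] := gG; apply/seteqP; split=> z /orb[h hG ->]; apply/orb; have [sh _] := hG.
  exists (h *m \adj g); first exact/Gamma0_mul/Gamma0_adj.
  rewrite -hact_mul ?hact_adjK //; exact: adj_SL2.
by exists (h *m g); [exact: Gamma0_mul|rewrite hact_mul].
Qed.

(** Replacing S by the face whose interior contains x makes all the weights positive, as [cone_tvec]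
    demands. *)
Lemma tile_proj_common (R : realType) (I : prime_idealr (Zi R))
    (A B : 'M[Zi R]_2) (S S' : {set octv}) g (x : Hstar R) :
  SL2 A -> SL2 B -> oct_face S -> oct_face S' -> Gamma0 I g ->
  tile_face A S x -> tile_face B S' (hact g x) ->
  exists T : {set octv}, [/\ T \subset S, ocone A T (mink (val x)) &
    forall v, v \in T -> exists2 u, u \in S' & tvec (g *m A) v = tvec B u].
Proof.
move=> sA sB fS fS' [sg _] /(tile_faceE _ _ sA) cx /(tile_faceE _ _ sB) cy.
have [T [TS fT oT]] := cone_face sA fS cx (mink_neq0 _).
exists T; split=> //; have [c c0 yE] := mink_hact x sg.
apply: (cone_tvec (mul_SL2 sg sA) sB fS' (ocone_rho g oT)).
have : cone B S' (c^-1 *: (c *: rho g (mink (val x)))).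
  by rewrite -yE; apply: coneZ => //; rewrite invr_ge0 ltW.
by rewrite scalerA mulVf ?scale1r // gt_eqF.
Qed.

(** Let y = g x. The vertices of the open face of x go to vertices of the same tile. Since g v is
    congruent to a unit times v, the determinant of v and its target is congruent to 0, hence 0, so
    the target is v. Thus g fixes these vertices, and x. *)
Lemma tile_proj_inj (R : realType) (I : prime_idealr (Zi R)) (q : nat)
    (A : 'M[Zi R]_2) (S : {set octv}) (x y : Hstar R) :
  ([set: {ideal_quot I}] #= `I_q)%card -> 2%N \notin [pchar {ideal_quot I}] ->
  (5 < q)%N -> SL2 A -> oct_face S ->
  tile_face A S x -> tile_face A S y -> proj_quotient I x = proj_quotient I y -> x = y.
Proof.
move=> h1 h2 h3 sA fS tx ty /proj_eq[g gG yE]; subst y.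
have [T [TS oT hT]] := tile_proj_common sA sA fS fS gG tx ty.
have small := small_eq h1 h2 h3.
have [s s1 sE] := Gamma0_cong gG.
have fix_ v : v \in T -> tvec (g *m A) v = tvec A v.
  move=> vT; have [u uS E] := hT v vT; have [e e1 eE] := tvec_unit sA E.
  suff vu : v = u by rewrite E -vu.
  have := @small (det2 (s *: (A *m vec R v)) (e *: (A *m vec R u))) 0.
  move=> /(_ (zn_det_vec_le _ _ sA s1 e1)); rewrite {1}/zn !zE expr0n addr0.
  move=> /(_ (ler0n _ _)) D; have : modI I (det2 (s *: (A *m vec R v))
      (e *: (A *m vec R u))) = modI I 0.
    rewrite -eE -mulmxA.
    rewrite (@cong_det2 _ _ _ _ (s *: (A *m vec R v)) (s *: (A *m vec R v))) //.
    by congr modI; rewrite /det2; ring.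
  move=> /D /(congr1 (@zn R)).
  rewrite det2Z det2_mulSL // !znM s1 e1 !mul1r zn_det_vec {1}/zn !zE.
  by case: eqP => // _; case: eqP => _ ?; exfalso; lra.
have [sg _] := gG; have [c c0 mE] := mink_hact x sg.
apply/esym/(@Hstar_mink_inj _ _ _ c); rewrite mE; congr (_ *: _).
have [w _ ->] := oT; rewrite rho_sum; apply: eq_bigr => v vT.
by rewrite tvecM fix_.
Qed.

Lemma neq02 (R : realType) : 0 = 2 :> R -> False.
Proof. by move=> ?; lra. Qed.
Lemma neq12 (R : realType) : 1 = 2 :> R -> False.
Proof. by move=> ?; lra. Qed.

Lemma oct_face_sub (S W : {set octv}) : oct_face S -> S != finset.setTfor octv ->
  W \subset S -> W != finset.set0 -> oct_face W.
Proof.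
move=> fS ST WS W0; apply/orP; right; rewrite W0; apply/forallP => k.
apply/negP => /andP[h1 h2]; have := oct_face_antip fS ST (fintype.subsetP WS _ h1).
by rewrite (fintype.subsetP WS _ h2).
Qed.

Lemma polarD (R : realType) (a b m : 'rV[R]_4) : polar (a + b) m = polar a m + polar b m.
Proof. by rewrite /polar !mxE; ring. Qed.

Lemma ell_center (R : realType) k (m : 'rV[R]_4) :
  polar (octvec R (k, false) + octvec R (k, true)) m = 2 * ell m.
Proof.
rewrite polarD /polar /ell.
have [->|[->|->]] : k = i30 \/ k = i31 \/ k = i32.
  by case: k => [[|[|[|//]]] h]; [left|right; left|right; right]; apply: val_inj.
all: by rewrite !ovE !mk4E; ring.
Qed.

(* An element of PSL_2 which maps a pair of antipodal vertices of T to such a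
   pair fixes the center of T. *)
Lemma antipodal_rigid (R : realType) (A B : 'M[Zi R]_2) k u1 u2 : SL2 A -> SL2 B ->
  tvec A (k, false) = tvec B u1 -> tvec A (k, true) = tvec B u2 ->
  forall v, exists u, tvec A v = tvec B u.
Proof.
move=> sA sB E1 E2 v; have sB' := adj_SL2 sB.
have u12 : u2 = (u1.1, ~~ u1.2).
  have := rho_polar (octvec R (k, false)) (octvec R (k, true)) sA.
  rewrite -!tvecE E1 E2 !tvecE rho_polar // !polar_octvec /= eqxx xpair_eqE andbF.
  case: eqP => [_ /neq02 //|ne]; case: eqP => [|_ /neq12 //].
  case: u1 u2 ne {E1 E2} => [j b] [j' b'] /= ne jj _; rewrite -jj in ne *.
  by case: b b' ne => -[].
set C := \adj B *m A; have sC : SL2 C by exact: mul_SL2.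
have Ev w u : tvec A w = tvec B u -> rho C (octvec R w) = octvec R u.
  by move=> h; rewrite /C -rho_mul -tvecE h tvecE rho_adjK.
have oC : rho C (octvec R (k, false) + octvec R (k, true)) =
    octvec R (u1.1, false) + octvec R (u1.1, true).
  rewrite -[octvec R (k, false)]scale1r rho_lin scale1r (Ev _ _ E1) (Ev _ _ E2) u12.
  by case: (u1) => j [] /=; rewrite 1?addrC.
have : ell (rho C (octvec R v)) = 1.
  have := ell_center u1.1 (rho C (octvec R v)); rewrite -oC rho_polar // ell_center.
  by rewrite ell_octvec; lra.
rewrite -tvecE tvec_def => /ell_lightvec_eq1[u uE]; exists u.
rewrite [RHS]tvecE -uE -tvec_def tvecM /C mulmxA adjKr // mul1mx //.
Qed.

(** W consists of the vertices of S that some element of the kernel sends into S', and one element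
    serves for all. It could fail to be a face only for S = T with an antipodal pair in W; the
    translated tiles then coincide, S' contains an antipodal pair and so is T, and W is T as
    well. *)
Lemma proj_tile_inter (R : realType) (I : prime_idealr (Zi R)) (q : nat)
    (A B : 'M[Zi R]_2) (S S' : {set octv}) :
  ([set: {ideal_quot I}] #= `I_q)%card -> 2%N \notin [pchar {ideal_quot I}] ->
  (5 < q)%N -> SL2 A -> SL2 B -> oct_face S -> oct_face S' ->
  (proj_quotient I @` tile_face A S) `&` (proj_quotient I @` tile_face B S') = set0 \/
  exists2 W, oct_face W &
  (proj_quotient I @` tile_face A S) `&` (proj_quotient I @` tile_face B S') =
  proj_quotient I @` tile_face A W.
Proof.
move=> h1 h2 h3 sA sB fS fS'.
pose hit v := exists g u, [/\ Gamma0 I g, u \in S' & tvec (g *m A) v = tvec B u].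
pose W := [set v in S | `[< hit v >]]%SET.
have WS : W \subset S by apply/fintype.subsetP => v; rewrite inE => /andP[].
have hW v : v \in W -> hit v by rewrite inE => /andP[_ /asboolP].
have inW (x y : Hstar R) : tile_face A S x -> tile_face B S' y ->
    proj_quotient I x = proj_quotient I y ->
    exists2 T : {set octv}, T \subset W & ocone A T (mink (val x)).
  move=> tx ty /proj_eq[g gG yE]; rewrite yE in ty.
  have [T [TS oT hT]] := tile_proj_common sA sB fS fS' gG tx ty.
  exists T => //; apply/fintype.subsetP => v vT; rewrite inE (fintype.subsetP TS _ vT).
  by apply/asboolP; have [u uS E] := hT v vT; exists g, u.
have [W0|W0] := eqVneq W finset.set0.
  left; apply/seteqP; split=> // z [[x tx xz] [y ty yz]].
  have [|T TW [w _ E]] := inW x y tx ty; first by rewrite xz yz.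
  have := mink_neq0 (val x); rewrite E W0 in TW *.
  by move: TW; rewrite finset.subset0 => /eqP ->; rewrite big_set0 eqxx.
right; have [g gG gW] := common_element h1 h2 h3 sA sB W0 hW.
have [sg _] := gG; have sgA := mul_SL2 sg sA.
exists W.
  have [ST|ST] := eqVneq S (finset.setTfor octv); last exact: oct_face_sub WS W0.
  have [[k k1 k2]|noanti] := pselect (exists2 k, (k, false) \in W & (k, true) \in W).
    have [u1 u1S E1] := gW _ k1; have [u2 u2S E2] := gW _ k2.
    have rig := antipodal_rigid sgA sB E1 E2.
    have [ST'|ST'] := eqVneq S' (finset.setTfor octv).
      suff -> : W = finset.setTfor octv by rewrite /oct_face eqxx.
      apply/eqP; rewrite -finset.subTset; apply/fintype.subsetP => v _.
      rewrite inE ST inE; apply/asboolP; have [u E] := rig v.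
      by exists g, u; rewrite ST' inE.
    (* The images of antipodal vertices pair to 2 and so are antipodal, which a proper face S'
       excludes. *)
    exfalso; have := rho_polar (octvec R (k, false)) (octvec R (k, true)) sgA.
    rewrite -!tvecE E1 E2 !tvecE rho_polar // !polar_octvec /= eqxx xpair_eqE andbF.
    have au := oct_face_antip fS' ST' u1S.
    case: eqP => [_ /neq02 //|ne]; case: eqP => [|_ /neq12 //].
    move: au; case: u1 u2 u1S u2S ne {E1 E2} => [j b] [j' b'] /= u1S u2S ne /[swap] jj; rewrite -jj in ne u2S.
    suff -> : ~~ b = b' by rewrite u2S.
    by case: b b' ne {u1S u2S} => -[].
  apply/orP; right; rewrite W0; apply/forallP => k; apply/negP => /andP[k1 k2].
  by apply: noanti; exists k.
apply/seteqP; split=> z.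
  move=> [[x tx xz] [y ty yz]]; exists x => //.
  have [|T TW oT] := inW x y tx ty; first by rewrite xz yz.
  by apply/tile_faceE => //; apply: cone_sub TW _; apply: ocone_cone.
move=> [x /(tile_faceE _ _ sA) cx xz]; split.
  by exists x => //; apply/tile_faceE => //; apply: cone_sub WS _.
exists (hact g x); last by rewrite -xz; apply/esym/proj_eq; exists g.
apply/tile_faceE => //; have [c c0 ->] := mink_hact x sg; apply: coneZ; first exact: ltW.
by apply: cone_map gW _; apply: cone_rho.
Qed.

(** At a common point [cone_tvec] applies in both directions, so that g matches the vertices of S
    with those of S'. *)
Lemma proj_open_disjoint (R : realType) (I : prime_idealr (Zi R))
    (A B : 'M[Zi R]_2) (S S' : {set octv}) :
  SL2 A -> SL2 B -> oct_face S -> oct_face S' ->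
  (proj_quotient I @` open_tile_face A S) `&`
  (proj_quotient I @` open_tile_face B S') !=set0 ->
  #|S| = #|S'| /\
  proj_quotient I @` open_tile_face A S = proj_quotient I @` open_tile_face B S'.
Proof.
move=> sA sB fS fS' [_ [[x /(open_tile_faceE _ _ sA) ox <-] [y /(open_tile_faceE _ _ sB) oy]]].
move=> /esym/proj_eq[g gG yE]; rewrite yE in oy; have [sg _] := gG.
have [c c0 mE] := mink_hact x sg; have c1 : 0 < c^-1 by rewrite invr_gt0.
have cK : c^-1 *: (c *: rho g (mink (val x))) = rho g (mink (val x)).
  by rewrite scalerA mulVf ?scale1r // gt_eqF.
have oy' : ocone B S' (rho g (mink (val x))) by rewrite -cK -mE; apply: oconeZ.
have ogx := ocone_rho g ox; have sgA := mul_SL2 sg sA.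
have f1 := cone_tvec sgA sB fS' ogx (ocone_cone oy').
have f2 := cone_tvec sB sgA fS oy' (ocone_cone ogx).
split; first by apply/eqP; rewrite eqn_leq (tvec_map_card sgA f1) (tvec_map_card sB f2).
apply/seteqP; split=> _ [z /open_tile_faceE oz <-].
  exists (hact g z); last by apply/esym/proj_eq; exists g.
  apply/open_tile_faceE => //; have [d d0 ->] := mink_hact z sg; apply: oconeZ => //.
  by apply: ocone_map sB f1 f2 _; apply/ocone_rho/oz.
have sg' := adj_SL2 sg.
exists (hact (\adj g) z).
  apply/open_tile_faceE => //; have [d d0 ->] := mink_hact z sg'; apply: oconeZ => //.
  have := ocone_rho (\adj g) (ocone_map sgA f2 f1 (oz sB)).
  by rewrite mulmxA adjK // mul1mx.
by apply/proj_eq; exists g => //; rewrite hact_adjKr.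
Qed.

Lemma proj_open_mul (R : realType) (I : prime_idealr (Zi R)) (g A : 'M[Zi R]_2) S :
  Gamma0 I g -> SL2 A ->
  proj_quotient I @` open_tile_face (g *m A) S = proj_quotient I @` open_tile_face A S.
Proof.
move=> gG sA; have [sg _] := gG; have sgA := mul_SL2 sg sA; have sg' := adj_SL2 sg.
apply/seteqP; split=> _ [z /open_tile_faceE oz <-].
  exists (hact (\adj g) z).
    apply/open_tile_faceE => //; have [d d0 ->] := mink_hact z sg'; apply: oconeZ => //.
    by have := ocone_rho (\adj g) (oz sgA); rewrite mulmxA adjK // mul1mx.
  by apply/proj_eq; exists g => //; rewrite hact_adjKr.
exists (hact g z); last by apply/esym/proj_eq; exists g.
apply/open_tile_faceE => //; have [d d0 ->] := mink_hact z sg; apply: oconeZ => //.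
exact/ocone_rho/oz.
Qed.

(** * Continuity, compactness of disks and homeomorphisms onto images *)

Lemma forcD (R : realType) (T : topologicalType) (f g : T -> R) x :
  {for x, continuous f} -> {for x, continuous g} ->
  {for x, continuous (fun y => f y + g y)}.
Proof. by move=> cf cg; apply: (@continuousD R R^o T f g). Qed.

Lemma forcB (R : realType) (T : topologicalType) (f g : T -> R) x :
  {for x, continuous f} -> {for x, continuous g} ->
  {for x, continuous (fun y => f y - g y)}.
Proof. by move=> cf cg; apply: (@continuousB R R^o T f g). Qed.

Lemma forcM (R : realType) (T : topologicalType) (f g : T -> R) x :
  {for x, continuous f} -> {for x, continuous g} ->
  {for x, continuous (fun y => f y * g y)}.
Proof. by move=> cf cg; apply: (@continuousM R T f g). Qed.

Lemma forc_cst (R : realType) (T : topologicalType) (c : R) (x : T) :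
  {for x, continuous (fun=> c)}.
Proof. exact: cst_continuous. Qed.

Lemma continuous_sumR (R : realType) (T : topologicalType) (J : finType) (F : J -> T -> R) :
  (forall j, continuous (F j)) -> continuous (fun x => \sum_j F j x).
Proof.
move=> h; apply: continuous_big => //.
exact: add_continuous.
Qed.

Lemma coord_sqr_continuous (R : realType) n :
  continuous (fun x : 'rV[R]_n => \sum_i x 0 i ^+ 2).
Proof.
apply: continuous_sumR => i x; apply: (@continuousM _ _ (fun y : 'rV[R]_n => y 0 i) (fun y : 'rV[R]_n => y 0 i));
exact: coord_continuous.
Qed.

Lemma compact_disk (R : realType) n : compact (@disk R n).
Proof.
have cl : closed (@disk R n).
  have := @closed_comp _ _ _ _ (in1W (@coord_sqr_continuous R n)) (@closed_le R 1).
  exact.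
apply: (subclosed_compact cl (@rV_compact R n (fun=> `[-1, 1]%classic) _)).
  by move=> i; apply: segment_compact.
move=> x /= xd i; rewrite /= in_itv /= -ler_norml -(@expr_le1 _ 2) // real_normK ?num_real //.
by apply: le_trans xd; rewrite (bigD1 i) //= lerDl sumr_ge0 // => j _; apply: sqr_ge0.
Qed.

Lemma compact_homeo (T U : topologicalType) (t0 : T) (K : set T) (f : T -> U) :
  compact K -> hausdorff_space U -> {within K, continuous f} -> set_inj K f ->
  homeo_onto K (f @` K) f.
Proof.
move=> cK hU cf fi; split; last split=> //.
  by split=> // y; exact.
have [g gE] : exists g : U -> T, forall x, K x -> g (f x) = x.
  have /boolp.choice[g gE] : forall y, exists x, forall z, K z -> f z = y -> z = x.
    move=> y; have [[z Kz zy]|no] := pselect (exists2 z, K z & f z = y).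
      by exists z => z' Kz' z'y; apply: fi; rewrite ?inE // zy.
    (* Off the image of K the inverse takes the arbitrary value t0. *)
    by exists t0 => z Kz zy; exfalso; apply: no; exists z.
  by exists g => x Kx; rewrite -(gE _ x Kx erefl).
exists g; last by move=> x; rewrite inE; apply: gE.
apply/continuous_closedP => C cC; apply/closed_subspaceP.
exists (f @` (K `&` C)).
  apply: (compact_closed hU); apply: continuous_compact.
    by apply: continuous_subspaceW cf; apply: subIsetl.
  exact: compact_closedI.
apply/seteqP; split=> y /=.
  by move=> [[x [Kx Cx] <-] [x' Kx' xx']]; split; [rewrite /from_subspace gE|exists x].
by move=> [Cy [x Kx xy]]; split; [exists x => //; split=> //; rewrite -(gE x Kx) xy; exact: Cy|exists x].
Qed.

Lemma homeo_ontoW (T U : topologicalType) (A K : set T) (f : T -> U) :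
  A `<=` K -> homeo_onto K (f @` K) f -> homeo_onto A (f @` A) f.
Proof.
move=> AK [[_ fi _] [cf [g cg gK]]]; split; last split.
- split=> //.
  by move=> x y; rewrite !inE => Ax Ay; apply: fi; rewrite inE; apply: AK.
- exact: continuous_subspaceW cf.
- exists g; first by apply: continuous_subspaceW cg; apply: image_subset.
  by move=> x; rewrite inE => Ax; apply: gK; rewrite inE; apply: AK.
Qed.

Lemma open_disk_sub (R : realType) n : @open_disk R n `<=` @disk R n.
Proof. by move=> x; rewrite /open_disk /disk /= => /ltW. Qed.

(** * Radial maps, and parametrizations of faces by balls *)

Definition enorm (R : realType) n (x : 'rV[R]_n) : R := Num.sqrt (\sum_i x 0 i ^+ 2).

Lemma sumsqr_ge0 (R : realType) n (x : 'rV[R]_n) : 0 <= \sum_i x 0 i ^+ 2.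
Proof. by apply: sumr_ge0 => i _; apply: sqr_ge0. Qed.

Lemma enorm_ge0 (R : realType) n (x : 'rV[R]_n) : 0 <= enorm x.
Proof. exact: sqrtr_ge0. Qed.

Lemma enormZ (R : realType) n (c : R) (x : 'rV[R]_n) : 0 <= c ->
  enorm (c *: x) = c * enorm x.
Proof.
move=> c0; rewrite /enorm.
have -> : \sum_i (c *: x) 0 i ^+ 2 = c ^+ 2 * \sum_i x 0 i ^+ 2.
  by rewrite mulr_sumr; apply: eq_bigr => i _; rewrite mxE exprMn.
by rewrite sqrtrM ?sqr_ge0 // sqrtr_sqr ger0_norm.
Qed.

Lemma enorm_eq0 (R : realType) n (x : 'rV[R]_n) : enorm x = 0 -> x = 0.
Proof.
move=> /eqP; rewrite sqrtr_eq0 => h.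
have /psumr_eq0P z : \sum_i x 0 i ^+ 2 = 0 by apply/eqP; rewrite eq_le h sumsqr_ge0.
apply/rowP => i; rewrite mxE; have /eqP := z (fun i _ => sqr_ge0 _) i isT.
by rewrite sqrf_eq0 => /eqP.
Qed.

Lemma enorm0 (R : realType) n : enorm (0 : 'rV[R]_n) = 0.
Proof. by rewrite /enorm big1 ?sqrtr0 // => i _; rewrite mxE expr0n. Qed.

Lemma enorm_sqr (R : realType) n (x : 'rV[R]_n) : enorm x ^+ 2 = \sum_i x 0 i ^+ 2.
Proof. by rewrite sqr_sqrtr ?sumsqr_ge0. Qed.

Lemma disk_enorm (R : realType) n (x : 'rV[R]_n) : disk x <-> enorm x <= 1.
Proof. by rewrite /disk /= -enorm_sqr expr_le1 ?enorm_ge0. Qed.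

Lemma open_disk_enorm (R : realType) n (x : 'rV[R]_n) : open_disk x <-> enorm x < 1.
Proof. by rewrite /open_disk /= -enorm_sqr expr_lt1 ?enorm_ge0. Qed.

Lemma enorm_le_sum (R : realType) n (x : 'rV[R]_n) : enorm x <= \sum_i `|x 0 i|.
Proof.
have s0 : 0 <= \sum_i `|x 0 i| by apply: sumr_ge0 => i _; apply: normr_ge0.
rewrite -(@ler_pXn2r _ 2) ?nnegrE ?enorm_ge0 // enorm_sqr expr2 mulr_suml.
apply: ler_sum => i _; rewrite -real_normK ?num_real // expr2 ler_wpM2l //.
by rewrite (bigD1 i) //= lerDl sumr_ge0.
Qed.

(** Minkowski functionals of bounded bodies around the origin. Homogeneity is stated for c >= 0
    only, as a simplex is not symmetric. *)
Record gauge (R : realType) n (g : 'rV[R]_n -> R) : Prop := Gauge {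
  gauge_cont : continuous g;
  gauge_hom : forall c x, 0 <= c -> g (c *: x) = c * g x;
  gauge_bound : exists2 C : R, 0 < C & forall x, enorm x <= C * g x }.

(* Carries the unit ball onto the convex body [set x | g x <= 1]. *)
Definition radial (R : realType) n (g : 'rV[R]_n -> R) (x : 'rV[R]_n) : 'rV[R]_n :=
  (enorm x / g x) *: x.

Lemma gauge_gt0 (R : realType) n (g : 'rV[R]_n -> R) x : gauge g -> x != 0 -> 0 < g x.
Proof.
move=> [_ _ [C C0 h]] x0; have nx : 0 < enorm x.
  by rewrite lt_def enorm_ge0 andbT; apply: contraNneq x0 => /enorm_eq0 ->.
by rewrite -(pmulr_rgt0 _ C0) (lt_le_trans nx).
Qed.

Lemma gauge0 (R : realType) n (g : 'rV[R]_n -> R) : gauge g -> g 0 = 0.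
Proof. by move=> [_ h _]; have := h 0 0 (lexx 0); rewrite scale0r mul0r. Qed.

Lemma radial0 (R : realType) n (g : 'rV[R]_n -> R) : radial g 0 = 0.
Proof. by rewrite /radial scaler0. Qed.

Lemma gauge_radial (R : realType) n (g : 'rV[R]_n -> R) x : gauge g ->
  g (radial g x) = enorm x.
Proof.
move=> gg; have [->|x0] := eqVneq x 0; first by rewrite radial0 gauge0 // enorm0.
have gx := gauge_gt0 gg x0; rewrite /radial (gauge_hom gg) ?divr_ge0 ?enorm_ge0 ?(ltW gx) //.
by rewrite mulfVK // gt_eqF.
Qed.

Lemma radial_inj (R : realType) n (g : 'rV[R]_n -> R) : gauge g -> injective (radial g).
Proof.
move=> gg x y xy; have nxy : enorm x = enorm y by rewrite -!(gauge_radial _ gg) xy.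
have [x0|x0] := eqVneq x 0.
  by rewrite x0 enorm0 in nxy *; apply/esym/enorm_eq0; rewrite -nxy.
have nx : enorm x != 0 by apply: contraNneq x0 => /enorm_eq0 ->.
have y0 : y != 0 by apply: contraNneq nx => y0; rewrite nxy y0 enorm0.
have gx := gauge_gt0 gg x0; have gy := gauge_gt0 gg y0.
have xE : x = (g x / g y) *: y.
  have := congr1 (fun z => (g x / enorm x) *: z) xy; rewrite /radial !scalerA.
  rewrite mulrA mulfVK // mulfV ?gt_eqF // scale1r => h; rewrite [LHS]h; congr (_ *: _).
  by rewrite -nxy mulrA mulfVK //.
have gxy : g x / g y = 1.
  have : enorm x = (g x / g y) * enorm y by rewrite {1}xE enormZ ?divr_ge0 // ltW.
  by rewrite -nxy => /esym/eqP; rewrite -subr_eq0 -{2}[enorm x]mul1r -mulrBl mulf_eq0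
    (negPf nx) orbF subr_eq0 => /eqP.
by rewrite xE gxy scale1r.
Qed.

Lemma radial_surj (R : realType) n (g : 'rV[R]_n -> R) y : gauge g ->
  exists x, radial g x = y.
Proof.
move=> gg; have [->|y0] := eqVneq y 0; first by exists 0; rewrite radial0.
have gy := gauge_gt0 gg y0.
have ny : enorm y != 0 by apply: contraNneq y0 => /enorm_eq0 ->.
have ny0 : 0 < enorm y by rewrite lt_def ny enorm_ge0.
exists ((g y / enorm y) *: y); rewrite /radial enormZ ?divr_ge0 ?(ltW gy) ?(ltW ny0) //.
rewrite (gauge_hom gg) ?divr_ge0 ?(ltW gy) ?(ltW ny0) // scalerA.
rewrite -[RHS]scale1r; congr (_ *: _); field.
by rewrite ny gt_eqF.
Qed.

Lemma enorm_continuous (R : realType) n : continuous (@enorm R n).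
Proof.
move=> x; apply: continuous_comp; first exact: coord_sqr_continuous.
exact: sqrt_continuous.
Qed.

Lemma radial_continuous (R : realType) n (g : 'rV[R]_n -> R) i : gauge g ->
  continuous (fun x => radial g x 0 i).
Proof.
move=> gg x; rewrite (_ : (fun x => _) = (fun x => enorm x / g x * x 0 i)); last first.
  by apply/funext => y; rewrite mxE.
have [->|x0] := eqVneq x 0; last first.
  apply: (@continuousM _ _ (fun y => enorm y / g y) (fun y => y 0 i));
    last exact: coord_continuous.
  apply: (@continuousM _ _ (@enorm R n) (fun y => (g y)^-1)).
    exact: enorm_continuous.
  by apply: continuousV; [rewrite gt_eqF // gauge_gt0|exact: (gauge_cont gg)].
(* At the origin the denominator vanishes too, but the factor [enorm y / g y] stays below C. *)
rewrite /continuous_at mxE mulr0; have [C C0 hC] := gauge_bound gg.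
apply/(cvgr0Pnorm_lt (FF := nbhs_filter (0 : 'rV[R]_n))) => e e0; have eC : 0 < e / C by rewrite divr_gt0.
have hc : \forall y \near nbhs (0 : 'rV[R]_n), `|(y : 'rV[R]_n) 0 i| < e / C.
  have := @coord_continuous R 1 n 0 i (0 : 'rV[R]_n).
  by rewrite /continuous_at mxE => /(cvgr0Pnorm_lt (FF := nbhs_filter (0 : 'rV[R]_n))) /(_ _ eC).
near=> y; have hy : C * `|y 0 i| < e.
  by rewrite mulrC -ltr_pdivlMr //; near: y.
apply: le_lt_trans hy; rewrite normrM ler_wpM2r //.
have [->|y0] := eqVneq y 0; first by rewrite enorm0 mul0r normr0 ltW.
have gy := gauge_gt0 gg y0.
by rewrite ger0_norm ?divr_ge0 ?enorm_ge0 ?(ltW gy) // ler_pdivrMr.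
Unshelve. all: by end_near. Qed.

Lemma gauge_l1 (R : realType) n : gauge (fun x : 'rV[R]_n => \sum_i `|x 0 i|).
Proof.
split.
- apply: continuous_sumR => i x; apply: continuous_comp; first exact: coord_continuous.
  exact: norm_continuous.
- move=> c x c0; rewrite mulr_sumr; apply: eq_bigr => i _.
  by rewrite mxE normrM ger0_norm.
- by exists 1 => // x; rewrite mul1r enorm_le_sum.
Qed.

(** The simplex on which these n + 1 forms are at most 1 has its barycenter at the origin. Its
    barycentric coordinates are (1 - simplex_form y j)/(n + 1); they sum to 1 because the forms sum
    to 0. *)
Definition simplex_form (R : realType) n (y : 'rV[R]_n) (j : 'I_n.+1) : R :=
  if unlift ord_max j is Some i then - y 0 i else \sum_i y 0 i.

Definition simplex_gauge (R : realType) n (y : 'rV[R]_n) : R :=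
  \big[Num.max/0]_j simplex_form y j.

Lemma simplex_form_le (R : realType) n (y : 'rV[R]_n) j :
  simplex_form y j <= simplex_gauge y.
Proof. exact: le_bigmax. Qed.

Lemma simplex_formZ (R : realType) n c (y : 'rV[R]_n) j :
  simplex_form (c *: y) j = c * simplex_form y j.
Proof.
rewrite /simplex_form; case: unliftP => [i _|_]; first by rewrite mxE mulrN.
by rewrite mulr_sumr; apply: eq_bigr => i _; rewrite mxE.
Qed.

Lemma simplex_form_lift (R : realType) n (y : 'rV[R]_n) i :
  simplex_form y (lift ord_max i) = - y 0 i.
Proof. by rewrite /simplex_form liftK. Qed.

Lemma simplex_form_max (R : realType) n (y : 'rV[R]_n) :
  simplex_form y ord_max = \sum_i y 0 i.
Proof. by rewrite /simplex_form unlift_none. Qed.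

Lemma sum_simplex_form (R : realType) n (y : 'rV[R]_n) : \sum_j simplex_form y j = 0.
Proof.
rewrite big_ord_recr /= simplex_form_max.
rewrite (eq_bigr (fun i => - y 0 i)) ?sumrN ?addNr // => i _.
by rewrite -simplex_form_lift; congr simplex_form; apply: val_inj; rewrite /= /bump leqNgt ltn_ord.
Qed.

Lemma gauge_simplex (R : realType) n : gauge (@simplex_gauge R n).
Proof.
split.
- apply: (@continuous_big R^o 'I_n.+1 Num.max 0 xpredT) => [x|j _].
    by apply: continuous_max; [exact: cvg_fst|exact: cvg_snd].
  rewrite /simplex_form; case: unliftP => [i _|_].
    by move=> x; apply: continuousN; exact: coord_continuous.
  by apply: continuous_sumR => i; exact: coord_continuous.
- move=> c x c0; rewrite /simplex_gauge.
  rewrite (big_morph (fun a => c * a) (fun a b => maxr_pMr a b c0) (mulr0 c)).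
  by apply: eq_bigr => j _; rewrite simplex_formZ.
(* Each of the n coordinates is at most n + 1 times the gauge; the extra 1 keeps the constant
   positive for n = 0. *)
- exists (1 + n%:R * n.+1%:R) => [|x]; first by rewrite ltr_pwDl // mulr_ge0.
  have g0 : 0 <= simplex_gauge x by exact: bigmax_ge_id.
  apply: le_trans (enorm_le_sum x) _.
  have xi i : `|x 0 i| <= n.+1%:R * simplex_gauge x.
    rewrite ler_norml; have h k : - x 0 k <= simplex_gauge x.
      by rewrite -simplex_form_lift simplex_form_le.
    have hs : \sum_k x 0 k <= simplex_gauge x by rewrite -simplex_form_max simplex_form_le.
    apply/andP; split.
      by rewrite lerNl (le_trans (h i)) // ler_peMl // ler1n.
    (* The forms bound each coordinate from below only; an upper bound comes from the sum and the
       lower bounds on the other coordinates. *)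
    have -> : x 0 i = \sum_k x 0 k + \sum_(k | k != i) (- x 0 k).
      by rewrite sumrN (bigD1 i) //= addrK.
    rewrite -natr1 mulrDl mul1r addrC lerD //.
    apply: le_trans (ler_sum _ (fun k _ => h k)) _.
    rewrite sumr_const -[leLHS]mulr_natl ler_wpM2r // ler_nat -[leqRHS]card_ord.
    exact: max_card.
  apply: le_trans (ler_sum _ (fun k _ => xi k)) _.
  rewrite sumr_const card_ord -[leLHS]mulr_natl mulrDl mul1r mulrA.
  by rewrite lerDr.
Qed.

(** The cone of a face is cut by the hyperplane of level 1 seen from the center of its tile. This
    slice is a compact polytope with one point on each ray, and M is a map from the ball onto it. *)
Record face_param (R : realType) n (S : {set octv}) (A : 'M[Zi R]_2)
    (M : 'rV[R]_n -> 'rV[R]_4) : Prop := FaceParam {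
  param_cont : forall k, continuous (fun x => M x 0 k);
  param_cone : forall x, disk x -> cone A S (M x);
  param_ocone : forall x, open_disk x -> ocone A S (M x);
  param_surj : forall m, cone A S m -> ell (rho (\adj A) m) = 1 ->
    exists2 x, disk x & M x = m;
  param_osurj : forall m, ocone A S m -> ell (rho (\adj A) m) = 1 ->
    exists2 x, open_disk x & M x = m;
  param_inj : injective M;
  param_ell : forall x, ell (rho (\adj A) (M x)) = 1 }.

Lemma face_enum (S : {set octv}) n : #|S| = n.+1 -> exists s : 'I_n.+1 -> octv,
  [/\ injective s, forall j, s j \in S &
    forall (V : nmodType) (F : octv -> V), \sum_(v in S) F v = \sum_j F (s j)].
Proof.
move=> cS; have sz : size (enum S) == n.+1 by rewrite -cardE cS.
pose t := Tuple sz; exists (tnth t); split.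
- by apply/tuple_uniqP; rewrite /= enum_uniq.
- by move=> j; rewrite -mem_enum; apply: (mem_tnth j t).
- by move=> V F; rewrite -big_enum /= -[enum S]/(tval t) big_tuple.
Qed.

Lemma adj1 (K : comPzRingType) : \adj (1%:M : 'M[K]_2) = 1%:M.
Proof. by rewrite -[LHS]mulmx1 mul_adj_mx det1. Qed.

Lemma cone_tvec1 (R : realType) (S : {set octv}) (w : octv -> R) :
  \sum_(v in S) w v *: tvec 1%:M v = \sum_(v in S) w v *: octvec R v.
Proof. by apply: eq_bigr => v _; rewrite tvec1. Qed.

Lemma simplex_param (R : realType) n (S : {set octv}) : oct_face S ->
  S != finset.setTfor octv -> #|S| = n.+1 ->
  exists M : 'rV[R]_n -> 'rV[R]_4, face_param S 1%:M M.
Proof.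
move=> fS ST cS; have [s [s_inj sS sE]] := face_enum cS.
pose r := radial (@simplex_gauge R n); have gs := gauge_simplex R n.
pose w x j : R := (1 - simplex_form (r x) j) / n.+1%:R.
have n0 : (0 : R) < n.+1%:R by rewrite ltr0n.
pose M x := \sum_j w x j *: octvec R (s j); exists M.
have M_S x : M x = \sum_(v in S) (\sum_(j | s j == v) w x j) *: tvec 1%:M v.
  rewrite cone_tvec1 sE; apply: eq_bigr => j _; congr (_ *: _).
  by rewrite (big_pred1 j) // => i /=; apply/eqP/eqP => [/s_inj|->].
have Wj x j : \sum_(i | s i == s j) w x i = w x j.
  by rewrite (big_pred1 j) // => i /=; apply/eqP/eqP => [/s_inj|->].
have SP v : v \in S -> exists j, s j = v.
  move=> vS; have := sE nat (fun u => (u == v) : nat); rewrite (bigD1 v) //= eqxx.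
  move=> E; have [j /eqP sj|no] := pickP (fun j => s j == v); first by exists j.
  by exfalso; move: E; rewrite [RHS]big1 // => j _; rewrite no.
have gle x : disk x <-> forall j, simplex_form (r x) j <= 1.
  rewrite disk_enorm -(gauge_radial _ gs) -/r; split=> [h j|h].
    exact: le_trans (simplex_form_le _ _) h.
  by apply/bigmax_leP; split.
have glt x : open_disk x <-> forall j, simplex_form (r x) j < 1.
  rewrite open_disk_enorm -(gauge_radial _ gs) -/r; split=> [h j|h].
    exact: le_lt_trans (simplex_form_le _ _) h.
  by apply/bigmax_ltP; split.
have sur m (W : octv -> R) : m = \sum_(v in S) W v *: octvec R v -> ell m = 1 ->
    exists2 x, M x = m & forall j, simplex_form (r x) j = 1 - n.+1%:R * W (s j).
  move=> mE; rewrite mE ell_sum sE => W1; rewrite -mE.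
  have W1' : \sum_j W (s j) = 1.
    by rewrite -W1; apply: eq_bigr => j _; rewrite ell_octvec mulr1.
  (* Only the first n weights define y; the last form then has the right value because the weights
     sum to 1. *)
  pose y : 'rV[R]_n := \row_i (n.+1%:R * W (s (lift ord_max i)) - 1).
  have [x xy] := radial_surj y gs.
  have form j : simplex_form (r x) j = 1 - n.+1%:R * W (s j).
    rewrite /r xy; case: (unliftP ord_max j) => [i ->|->].
      by rewrite simplex_form_lift mxE opprB.
    have h := sum_simplex_form y; rewrite big_ord_recr /= in h.
    have -> : simplex_form y ord_max = - \sum_(i < n) simplex_form y (widen_ord (leqnSn n) i).
      by apply/eqP; rewrite -addr_eq0 addrC h.
    have e i : simplex_form y (widen_ord (leqnSn n) i) =
        1 - n.+1%:R * W (s (widen_ord (leqnSn n) i)).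
      have -> : widen_ord (leqnSn n) i = lift ord_max i.
        by apply: val_inj; rewrite /= /bump leqNgt ltn_ord.
      by rewrite simplex_form_lift mxE opprB.
    rewrite (eq_bigr _ (fun i _ => e i)) sumrB sumr_const card_ord -mulr_sumr.
    have -> : \sum_(i < n) W (s (widen_ord (leqnSn n) i)) = 1 - W (s ord_max).
      by rewrite -W1' big_ord_recr /= addrK.
    by rewrite -natr1; ring.
  exists x => //; rewrite mE sE; apply: eq_bigr => j _; congr (_ *: _).
  by rewrite /w form; field; rewrite addrC natr1 gt_eqF.
split.
- move=> k; rewrite (_ : (fun x => _) = fun x => \sum_j w x j * octvec R (s j) 0 k).
    apply: continuous_sumR => j x.
    apply: (@forcM R _ (w ^~ j) (fun=> octvec R (s j) 0 k)); last exact: forc_cst.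
    apply: (@forcM R _ (fun x => 1 - simplex_form (r x) j) (fun=> n.+1%:R^-1));
      last exact: forc_cst.
    apply: (@forcB R _ (fun=> 1) (fun x => simplex_form (r x) j)); first exact: forc_cst.
    rewrite /simplex_form; case: unliftP => [i _|_].
      by apply: continuousN; apply: radial_continuous.
    by apply: continuous_sumR => i; apply: radial_continuous.
  by apply/funext => x; rewrite /M summxE; apply: eq_bigr => j _; rewrite mxE.
- move=> x /gle h; exists (fun v => \sum_(j | s j == v) w x j) => // v _.
  by apply: sumr_ge0 => j _; rewrite divr_ge0 ?subr_ge0 ?h // ltW.
- move=> x /glt h; exists (fun v => \sum_(j | s j == v) w x j) => // v /SP[j <-].
  by rewrite Wj divr_gt0 ?subr_gt0 ?h.
- move=> m [W W0]; rewrite cone_tvec1 adj1 rho1 => mE m1.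
  have [x xm form] := sur m W mE m1; exists x => //; apply/gle => j.
  by rewrite form gerBl mulr_ge0 ?W0 // ltW.
- move=> m [W W0]; rewrite cone_tvec1 adj1 rho1 => mE m1.
  have [x xm form] := sur m W mE m1; exists x => //; apply/glt => j.
  by rewrite form gtrBl mulr_gt0 ?W0.
- move=> x x' xx'; apply: (radial_inj gs); apply/rowP => i; rewrite -/r.
  suff h j : simplex_form (r x) j = simplex_form (r x') j.
    by apply: oppr_inj; rewrite -!simplex_form_lift h.
  (* A proper face has at most one vertex on each axis, so the weight of s j is, up to sign, an axis
     coordinate of M. *)
  have ax z : axis (s j).1 (M z) = w z j * (-1) ^+ (s j).2.
    rewrite axis_sum (bigD1 j) //= axis_octvec eqxx big1 ?addr0 // => l ij.
    rewrite axis_octvec; case: eqP => [sij|_]; last by rewrite mulr0.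
    exfalso; have := oct_face_antip fS ST (sS j); rewrite -sij.
    suff <- : s l = ((s l).1, ~~ (s j).2) by rewrite sS.
    have : s l != s j by apply: contraNneq ij => /s_inj ->.
    case: (s l) (s j) sij => k b [k' b'] /= ->; rewrite xpair_eqE eqxx /=.
    by case: b b' => -[].
  have := ax x; rewrite xx' ax => /(congr1 (fun z => z * (-1) ^+ (s j).2)).
  rewrite -!mulrA -!expr2 sqrr_sign !mulr1 => /(mulIf (invr_neq0 (lt0r_neq0 n0))).
  by move=> /addrI/oppr_inj.
- move=> x; rewrite adj1 rho1 ell_sum.
  rewrite (eq_bigr (w x)) => [|j _]; last by rewrite ell_octvec mulr1.
  rewrite -mulr_suml sumrB sum_simplex_form subr0 sumr_const card_ord.
  by rewrite mulfV ?gt_eqF.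
Qed.

Lemma octahedron_param (R : realType) :
  exists M : 'rV[R]_3 -> 'rV[R]_4, face_param (finset.setTfor octv) 1%:M M.
Proof.
pose r := radial (fun x : 'rV[R]_3 => \sum_i `|x 0 i|); have gs := gauge_l1 R 3.
pose a k x := r x 0 k.
(* The solution of [ell m = 1] and [axis k m = a k x] for the coordinates of m. *)
pose M x := mk4 (1 - a i31 x) ((1 - a i30 x - a i31 x + a i32 x) / 2)
  ((1 - a i30 x - a i31 x - a i32 x) / 2) (1 - a i30 x).
have ac k : continuous (a k) by apply: radial_continuous.
have axM x k : axis k (M x) = a k x.
  have [->|[->|->]] : k = i30 \/ k = i31 \/ k = i32.
    by case: k => [[|[|[|//]]] h]; [left|right; left|right; right]; apply: val_inj.
  1-3: by rewrite /axis /M !mk4E /=; field.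
have ellM x : ell (M x) = 1 by rewrite /ell /M !mk4E; field.
have nM x : axis_norm (M x) = enorm x.
  by rewrite -(gauge_radial _ gs); apply: eq_bigr => k _; rewrite axM.
have sur m : ell m = 1 -> exists x, M x = m.
  move=> m1; have [x xm] := radial_surj (\row_k axis k m) gs.
  exists x; apply: ell_axis_inj => [|k]; first by rewrite ellM.
  by rewrite axM /a /r xm mxE.
exists M; split.
- move=> k; have [->|[->|[->|->]]] : k = x0 \/ k = x1 \/ k = x2 \/ k = x3.
    by case: k => [[|[|[|[|//]]]] h]; [left|right; left|right; right; left|
      right; right; right]; apply: val_inj.
  + rewrite (_ : (fun x => _) = fun x => 1 - a i31 x).
      by move=> x; apply: (@forcB R _ (fun=> 1) (a i31)); [exact: forc_cst|exact: ac].
    by apply/funext => x; rewrite /M mk4E.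
  + rewrite (_ : (fun x => _) = fun x => (1 - a i30 x - a i31 x + a i32 x) / 2).
      move=> x; apply: (@forcM R _ (fun x => 1 - a i30 x - a i31 x + a i32 x) (fun=> 2^-1));
        last exact: forc_cst.
      apply: (@forcD R _ (fun x => 1 - a i30 x - a i31 x) (a i32)); last exact: ac.
      apply: (@forcB R _ (fun x => 1 - a i30 x) (a i31)); last exact: ac.
      by apply: (@forcB R _ (fun=> 1) (a i30)); [exact: forc_cst|exact: ac].
    by apply/funext => x; rewrite /M mk4E.
  + rewrite (_ : (fun x => _) = fun x => (1 - a i30 x - a i31 x - a i32 x) / 2).
      move=> x; apply: (@forcM R _ (fun x => 1 - a i30 x - a i31 x - a i32 x) (fun=> 2^-1));
        last exact: forc_cst.
      apply: (@forcB R _ (fun x => 1 - a i30 x - a i31 x) (a i32)); last exact: ac.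
      apply: (@forcB R _ (fun x => 1 - a i30 x) (a i31)); last exact: ac.
      by apply: (@forcB R _ (fun=> 1) (a i30)); [exact: forc_cst|exact: ac].
    by apply/funext => x; rewrite /M mk4E.
  + rewrite (_ : (fun x => _) = fun x => 1 - a i30 x).
      by move=> x; apply: (@forcB R _ (fun=> 1) (a i30)); [exact: forc_cst|exact: ac].
    by apply/funext => x; rewrite /M mk4E.
- by move=> x /disk_enorm h; apply/cone_setT; rewrite nM ellM.
- by move=> x /open_disk_enorm h; apply/ocone_setT; rewrite nM ellM.
- move=> m /cone_setT h; rewrite adj1 rho1 => m1; have [x xm] := sur m m1.
  by exists x => //; apply/disk_enorm; rewrite -nM xm -m1.
- move=> m /ocone_setT h; rewrite adj1 rho1 => m1; have [x xm] := sur m m1.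
  by exists x => //; apply/open_disk_enorm; rewrite -nM xm -m1.
- move=> x y xy; apply: (radial_inj gs); apply/rowP => k; rewrite -/r.
  by have := axM x k; rewrite xy axM /a => ->.
- by move=> x; rewrite adj1 rho1 ellM.
Qed.

Lemma lin_continuous (R : realType) (T : topologicalType) (f : 'rV[R]_4 -> R)
    (M : T -> 'rV[R]_4) :
  (forall a u v, f (a *: u + v) = a * f u + f v) ->
  (forall k, continuous (fun x => M x 0 k)) -> continuous (fun x => f (M x)).
Proof.
move=> hf cM; have E m : f m = \sum_k m 0 k * f (delta_mx 0 k).
  by rewrite {1}[m]row_sum_delta; apply: (@lin_sum R _ (R^o)).
rewrite (_ : (fun x => _) = fun x => \sum_k M x 0 k * f (delta_mx 0 k)).
  apply: continuous_sumR => k x.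
  by apply: (@forcM R T (fun x => M x 0 k) (fun=> _)); [exact: cM|exact: forc_cst].
by apply/funext => x; rewrite E.
Qed.

Lemma polar_lin (R : realType) (n : 'rV[R]_4) (a : R) u v :
  polar n (a *: u + v) = a * polar n u + polar n v.
Proof. by rewrite /polar !mxE; ring. Qed.

Lemma qf_continuous (R : realType) (T : topologicalType) (M : T -> 'rV[R]_4) :
  (forall k, continuous (fun x => M x 0 k)) -> continuous (fun x => qf (M x)).
Proof.
move=> cM x; apply: (@forcB R T (fun x => M x 0 x0 * M x 0 x3 - M x 0 x1 ^+ 2)
  (fun x => M x 0 x2 ^+ 2)).
  apply: (@forcB R T (fun x => M x 0 x0 * M x 0 x3) (fun x => M x 0 x1 ^+ 2)).
    by apply: (@forcM R T (fun x => M x 0 x0) (fun x => M x 0 x3)); exact: cM.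
  by apply: (@forcM R T (fun x => M x 0 x1) (fun x => M x 0 x1)); exact: cM.
by apply: (@forcM R T (fun x => M x 0 x2) (fun x => M x 0 x2)); exact: cM.
Qed.

Lemma near_gt (R : realType) (T : topologicalType) (h : T -> R) (x : T) (a : R) :
  {for x, continuous h} -> a < h x -> nbhs x [set y | a < h y].
Proof. by move=> ch ahx; apply: (cvgr_gt (h x)). Qed.

Lemma near_lt (R : realType) (T : topologicalType) (h : T -> R) (x : T) (a : R) :
  {for x, continuous h} -> h x < a -> nbhs x [set y | h y < a].
Proof. by move=> ch ahx; apply: (cvgr_lt (h x)). Qed.

Lemma face_param_rho (R : realType) n S (A : 'M[Zi R]_2) (M : 'rV[R]_n -> 'rV[R]_4) :
  SL2 A -> face_param S 1%:M M -> face_param S A (fun x => rho A (M x)).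
Proof.
move=> sA [cM c1 c2 c3 c4 c5 c6]; have sA' := adj_SL2 sA.
have back1 m : rho (\adj 1%:M) m = m by rewrite adj1 rho1.
split.
- move=> k; apply: (lin_continuous (f := fun m => rho A m 0 k)) cM => a u v.
  by rewrite rho_lin [LHS]mxE [X in X + _]mxE.
- by move=> x /c1/(cone_rho A); rewrite mulmx1.
- by move=> x /c2/(ocone_rho A); rewrite mulmx1.
- move=> m /(cone_rho (\adj A)); rewrite adjK // => cm; rewrite -[X in ell X]back1 => m1.
  have [x dx E] := c3 _ cm m1.
  by exists x => //; rewrite E rho_adjKr.
- move=> m /(ocone_rho (\adj A)); rewrite adjK // => cm; rewrite -[X in ell X]back1 => m1.
  have [x dx E] := c4 _ cm m1.
  by exists x => //; rewrite E rho_adjKr.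
- by move=> x y /(congr1 (rho (\adj A))); rewrite !rho_adjK // => /c5.
- by move=> x; rewrite rho_adjK // -(c6 x) adj1 rho1.
Qed.

Lemma face_param_exists (R : realType) n (S : {set octv}) (A : 'M[Zi R]_2) :
  SL2 A -> oct_face S -> face_dim S = n ->
  exists M : 'rV[R]_n -> 'rV[R]_4, face_param S A M.
Proof.
move=> sA fS; rewrite /face_dim; have [->|ST] := eqVneq S (finset.setTfor octv) => <-.
  have [M hM] := octahedron_param R; exists (fun x => rho A (M x)).
  exact: face_param_rho.
have cS : #|S| = #|S|.-1.+1.
  rewrite prednK // card_gt0; case/orP: fS => [/eqP E|/andP[]//].
  by rewrite E eqxx in ST.
have [M hM] := simplex_param R fS ST cS; exists (fun x => rho A (M x)).
exact: face_param_rho.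
Qed.

(** * Pairings with vertices, and rays of cones as points of [Hstar] *)

Lemma polar_tvec (R : realType) (A : 'M[Zi R]_2) u v : SL2 A ->
  polar (tvec A u) (tvec A v) = if u == v then 0 else if u.1 == v.1 then 2 else 1.
Proof. by move=> sA; rewrite !tvecE rho_polar // polar_octvec. Qed.

Lemma polarC (R : realType) (m n : 'rV[R]_4) : polar m n = polar n m.
Proof. by rewrite /polar; ring. Qed.

Lemma polar_self (R : realType) (m : 'rV[R]_4) : polar m m = 2 * qf m.
Proof. by rewrite /polar /qf; ring. Qed.

Lemma weights_setT (R : realType) (A : 'M[Zi R]_2) S m : cone A S m ->
  exists2 w : octv -> R, (forall v, 0 <= w v) & m = \sum_v w v *: tvec A v.
Proof.
move=> /(cone_sub (finset.subsetT S))[w w0 ->]; exists w => [v|].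
  by apply: w0; rewrite inE.
by apply: eq_bigl => v; rewrite inE.
Qed.

(** A vertex pairs to 0 with itself and to 1 or 2 with the others, so the pairing with v dominates
    the total weight off v. The last bound keeps one term of 2 qf m = polar m m. *)
Lemma polar_weights (R : realType) (A : 'M[Zi R]_2) (w : octv -> R) v : SL2 A ->
  (forall v, 0 <= w v) -> let m := \sum_v w v *: tvec A v in
  [/\ \sum_(u | u != v) w u <= polar (tvec A v) m,
      forall u, u != v -> w u <= polar (tvec A v) m &
      w v * polar (tvec A v) m <= 2 * qf m].
Proof.
move=> sA w0 m.
have ge0 u : 0 <= polar (tvec A u) m.
  rewrite polar_sum sumr_ge0 // => i _; rewrite polar_tvec // mulr_ge0 //.
  by case: eqP => // _; case: eqP.
have ge1 u : \sum_(i | i != u) w i <= polar (tvec A u) m.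
  rewrite polar_sum [leRHS](bigD1 u) //= polar_tvec // eqxx mulr0 add0r.
  apply: ler_sum => i iu; rewrite polar_tvec // eq_sym (negPf iu) ler_peMr //.
  by case: eqP => _ //; rewrite ler1n.
split=> //.
  move=> u uv; apply: le_trans (ge1 v); rewrite (bigD1 u) //= lerDl.
  by rewrite sumr_ge0.
rewrite -polar_self {3}/m polar_sum (bigD1 v) //= [polar m (tvec A v)]polarC lerDl.
by rewrite sumr_ge0 // => i _; rewrite polarC mulr_ge0.
Qed.

Lemma cone_qf_ge0 (R : realType) (A : 'M[Zi R]_2) S m : SL2 A -> cone A S m ->
  0 <= qf m /\ 0 <= m 0 x3.
Proof.
move=> sA /weights_setT[w w0 mE]; split.
  have [h _ h'] := polar_weights (i30, false) sA w0; rewrite -mE in h h'.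
  rewrite -(@pmulr_rge0 _ 2) //; apply: le_trans h'; rewrite mulr_ge0 //.
  by apply: le_trans h; rewrite sumr_ge0.
rewrite mE summxE sumr_ge0 // => v _; rewrite mxE mulr_ge0 //.
by rewrite tvec_def; have [] := lightvec_ge0 (A *m vec R v).
Qed.

(** If v has positive weight and qf m = 0, the pairing of v with m is at most 0, and it dominates
    the weights of all the other vertices. *)
Lemma cone_lightlike (R : realType) (A : 'M[Zi R]_2) S m : SL2 A -> cone A S m ->
  qf m = 0 -> m != 0 -> exists v (c : R), 0 < c /\ m = c *: tvec A v.
Proof.
move=> sA /weights_setT[w w0 mE] q0 m0.
have [v wv] : exists v, 0 < w v.
  have [//|no] := pselect (exists v, 0 < w v); exfalso; move/eqP: m0; apply.
  rewrite mE big1 // => v _; suff -> : w v = 0 by rewrite scale0r.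
  by apply/eqP; rewrite eq_le w0 andbT leNgt; apply/negP => h; apply: no; exists v.
exists v, (w v); split=> //.
have [_ h h'] := polar_weights v sA w0; rewrite -mE q0 mulr0 in h h'.
have b0 : polar (tvec A v) m <= 0 by rewrite -(pmulr_rle0 _ wv).
rewrite {1}mE (bigD1 v) //= big1 ?addr0 // => u uv.
suff -> : w u = 0 by rewrite scale0r.
by apply/eqP; rewrite eq_le w0 andbT (le_trans (h u uv)).
Qed.

(* In T a point close to an ideal vertex is in a small horoball at this vertex. *)
Lemma cone_horoball (R : realType) (A : 'M[Zi R]_2) S m v : SL2 A -> cone A S m ->
  ell (rho (\adj A) m) = 1 -> polar (tvec A v) m <= 1 / 2 ->
  polar (tvec A v) m <= 4%:R * qf m.
Proof.
move=> sA /weights_setT[w w0 mE] m1 b2.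
have W1 : \sum_u w u = 1.
  rewrite -m1 mE rho_sum ell_sum; apply: eq_bigr => u _.
  by rewrite tvecE rho_adjK // ell_octvec mulr1.
have [h _ h'] := polar_weights v sA w0; rewrite -mE in h h'.
(* The other weights total at most 1/2, so v keeps at least 1/2. *)
rewrite (bigD1 v) //= in W1; have wv : 1 / 2 <= w v by lra.
have b0 : 0 <= polar (tvec A v) m by apply: le_trans h; rewrite sumr_ge0.
by have := ler_wpM2r b0 wv; lra.
Qed.

Definition to_Hstar (R : realType) (p : bpoint R) (h : in_Hstar p) : Hstar R :=
  exist (fun p => is_true `[< in_Hstar p >]) p (asboolT h).

Fact cusp_subproof (R : realType) (v : octv) : in_Hstar (inr (octv_pos R v) : bpoint R).
Proof. by exists 1%:M, v; split; [exact: SL2_1|rewrite act1]. Qed.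

Definition cusp (R : realType) (v : octv) : Hstar R := to_Hstar (cusp_subproof R v).

(** A lightlike vector is on the ray of a vertex of the tile. Otherwise its ray is that of the point
    at height sqrt (qf m)/d, because qf (mink (z, t)) = t^2. *)
Lemma cone_point (R : realType) (A : 'M[Zi R]_2) S m : SL2 A -> cone A S m ->
  m != 0 -> exists (x : Hstar R) (c : R), 0 < c /\ mink (val x) = c *: m.
Proof.
move=> sA cm m0; have [q0 d0] := cone_qf_ge0 sA cm.
have [qE|qn] := eqVneq (qf m) 0.
  have [v [c [c0 ->]]] := cone_lightlike sA cm qE m0.
  have [d dp E] := mink_hact (cusp R v) sA.
  exists (hact A (cusp R v)), (d * pos_scale R v / c).
  split; first by rewrite divr_gt0 ?mulr_gt0 ?pos_scale_gt0.
  rewrite E /= mink_octv rhoZ -tvecE !scalerA mulfVK ?gt_eqF //.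
have qp : 0 < qf m by rewrite lt_def qn.
have dp : 0 < m 0 x3.
  rewrite lt_def d0 andbT; apply/eqP => z; move: qp; rewrite /qf z mulr0.
  by have := sumsq_ge0 (m 0 x1) (m 0 x2); lra.
pose t := Num.sqrt (qf m) / m 0 x3.
have hx : in_Hstar (inl (Complex (m 0 x1 / m 0 x3) (m 0 x2 / m 0 x3), t) : bpoint R).
  by rewrite /= divr_gt0 ?sqrtr_gt0.
exists (to_Hstar hx), (m 0 x3)^-1; split; first by rewrite invr_gt0.
rewrite [LHS]mink_inl; apply: row4P; rewrite [RHS]mxE !mk4E.
- rewrite /t !expr_div_n sqr_sqrtr // -!mulrDl /qf.
  by field; rewrite gt_eqF.
- by rewrite mulrC.
- by rewrite mulrC.
- by rewrite mulVf // gt_eqF.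
Qed.

Lemma qf_mink_inside (R : realType) (z : R[i]) (t : R) : 0 < t ->
  Num.sqrt (qf (mink (inl (z, t) : bpoint R))) = t.
Proof. by move=> t0; rewrite qf_mink_inl sqrtr_sqr gtr0_norm. Qed.

Lemma horoballE (R : realType) (u : option R[i]) (r : R) (z : R[i]) (t : R) : 0 < t ->
  polar (mink (inr u)) (mink (inl (z, t))) < r * t -> horoball u r (z, t).
Proof.
move=> t0; case: z => x y; case: u => [[a b]|]; rewrite /horoball /sqnorm /=.
  rewrite mink_inr mink_inl /polar !mk4E => h; apply: le_lt_trans h.
  by rewrite le_eqVlt; apply/orP; left; apply/eqP; ring.
rewrite mink_oo mink_inl /polar !mk4E => h.
by rewrite -(ltr_pM2r t0) mulVf ?gt_eqF //; apply: le_lt_trans h; lra.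
Qed.

Lemma polarZ (R : realType) (a b : R) (m n : 'rV[R]_4) :
  polar (a *: m) (b *: n) = a * b * polar m n.
Proof. by rewrite /polar !mxE; ring. Qed.

Lemma qfZ (R : realType) (a : R) (m : 'rV[R]_4) : qf (a *: m) = a ^+ 2 * qf m.
Proof. by rewrite /qf !mxE; ring. Qed.

(** * Charts of closed faces, determined on the disk by their rays *)

Section Chart.
Context (R : realType) (n : nat) (S : {set octv}) (A : 'M[Zi R]_2)
  (M : 'rV[R]_n -> 'rV[R]_4) (sA : SL2 A) (hM : face_param S A M)
  (psi : 'rV[R]_n -> Hstar R)
  (psiE : forall x, disk x -> exists2 c : R, 0 < c & mink (val (psi x)) = c *: M x).

Lemma chart_continuous_inside (p0 : 'rV[R]_n) z t (U : set (Hstar R)) :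
  disk p0 -> val (psi p0) = inl (z, t) -> Hstar_open U -> U (psi p0) ->
  nbhs p0 [set x | disk x -> U (psi x)].
Proof.
move=> dp0 E oU Up0; have := oU _ Up0; rewrite E => -[e e0 hU].
have [c c0] := psiE dp0; rewrite E; case: z E hU => a b E hU; rewrite mink_inl => mE.
have t0 : 0 < t by have := Hstar_inside (psi p0); rewrite E.
pose d x := M x 0 x3; pose q x := qf (M x).
have mE0 := congr1 (fun m : 'rV[R]_4 => m 0 x0) mE; rewrite mk4E mxE in mE0.
have mE1 := congr1 (fun m : 'rV[R]_4 => m 0 x1) mE; rewrite mk4E mxE in mE1.
have mE2 := congr1 (fun m : 'rV[R]_4 => m 0 x2) mE; rewrite mk4E mxE in mE2.
have mE3 := congr1 (fun m : 'rV[R]_4 => m 0 x3) mE; rewrite mk4E mxE in mE3.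
have d0 : 0 < d p0 by rewrite -(pmulr_rgt0 _ c0) -mE3.
have cd : c = (d p0)^-1 by rewrite -[LHS]mulr1 -(mulfV (lt0r_neq0 d0)) mulrA -mE3 mul1r.
have q0 : q p0 = (t / c) ^+ 2.
  have : c ^+ 2 * q p0 = t ^+ 2.
    by rewrite -qfZ -mE /qf !mk4E; ring.
  by move=> h; rewrite exprMn -h exprVn mulrC mulKf // expf_neq0 // gt_eqF.
(* The squared Euclidean distance from psi p0 to the point on the ray of M x, as a continuous
   function of x. *)
pose G x := (M x 0 x1 / d x - a) ^+ 2 + (M x 0 x2 / d x - b) ^+ 2
            + (Num.sqrt (q x) / d x - t) ^+ 2.
have cq : continuous q by apply: qf_continuous; exact: (param_cont hM).
have cG : {for p0, continuous G}.
  have cV : {for p0, continuous (fun x => (d x)^-1)}.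
    by apply: (@continuousV R _ d); [rewrite gt_eqF|exact: (param_cont hM)].
  have sq (f : 'rV[R]_n -> R) : {for p0, continuous f} -> {for p0, continuous (fun x => f x ^+ 2)}.
    by move=> cf; apply: (@forcM R _ f f).
  apply: (@forcD R _ (fun x => (M x 0 x1 / d x - a) ^+ 2 + (M x 0 x2 / d x - b) ^+ 2)
    (fun x => (Num.sqrt (q x) / d x - t) ^+ 2)).
    apply: (@forcD R _ (fun x => (M x 0 x1 / d x - a) ^+ 2) (fun x => (M x 0 x2 / d x - b) ^+ 2)).
      apply: sq; apply: (@forcB R _ (fun x => M x 0 x1 / d x) (fun=> a)); last exact: forc_cst.
      by apply: (@forcM R _ (fun x => M x 0 x1) (fun x => (d x)^-1)); [exact: (param_cont hM)|].
    apply: sq; apply: (@forcB R _ (fun x => M x 0 x2 / d x) (fun=> b)); last exact: forc_cst.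
    by apply: (@forcM R _ (fun x => M x 0 x2) (fun x => (d x)^-1)); [exact: (param_cont hM)|].
  apply: sq; apply: (@forcB R _ (fun x => Num.sqrt (q x) / d x) (fun=> t)); last exact: forc_cst.
  apply: (@forcM R _ (fun x => Num.sqrt (q x)) (fun x => (d x)^-1)) => //.
  by apply: (@continuous_comp _ _ _ q); [exact: cq|exact: sqrt_continuous].
have G0 : G p0 = 0.
  rewrite /G q0 sqrtr_sqr gtr0_norm ?divr_gt0 // -cd mE1 mE2.
  by field; rewrite gt_eqF.
have nG : nbhs p0 [set x | G x < e ^+ 2].
  by apply: near_lt cG _; rewrite G0 exprn_gt0.
have nd : nbhs p0 [set x | 0 < d x] by apply: near_gt d0; apply: (param_cont hM).
have nq : nbhs p0 [set x | 0 < q x].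
  by apply: near_gt; [exact: cq|rewrite q0 exprn_gt0 ?divr_gt0].
near=> x => dx; have [c' c'0 mE'] := psiE dx.
have Gx : G x < e ^+ 2 by near: x.
have ddx : 0 < d x by near: x.
have qqx : 0 < q x by near: x.
have qpsi : 0 < qf (mink (val (psi x))) by rewrite mE' qfZ mulr_gt0 ?exprn_gt0.
have ins := Hstar_inside (psi x).
case px : (val (psi x)) => [[z' t']|u]; last by rewrite px qf_mink_inr ltxx in qpsi.
rewrite px /= in ins; apply: (hU _ z' t' px); apply: le_lt_trans Gx.
rewrite px in mE'; case: z' px mE' => a' b' px; rewrite mink_inl => mE'.
have E1 := congr1 (fun m : 'rV[R]_4 => m 0 x1) mE'; rewrite mk4E mxE in E1.
have E2 := congr1 (fun m : 'rV[R]_4 => m 0 x2) mE'; rewrite mk4E mxE in E2.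
have E3 := congr1 (fun m : 'rV[R]_4 => m 0 x3) mE'; rewrite mk4E mxE in E3.
have cd' : c' = (d x)^-1.
  by rewrite -[LHS]mulr1 -(mulfV (lt0r_neq0 ddx)) mulrA -E3 mul1r.
have q0' : q x = (t' / c') ^+ 2.
  have : c' ^+ 2 * q x = t' ^+ 2 by rewrite -qfZ -mE' /qf !mk4E; ring.
  by move=> h; rewrite exprMn -h exprVn mulrC mulKf // expf_neq0 // gt_eqF.
rewrite le_eqVlt; apply/orP; left; apply/eqP; rewrite /G /sqnorm /=.
rewrite q0' sqrtr_sqr gtr0_norm ?divr_gt0 // -cd' E1 E2.
by field; rewrite gt_eqF.
Unshelve. all: by end_near. Qed.

Lemma param_neq0 x : M x != 0.
Proof.
apply: contra_eq_neq (param_ell hM x) => ->.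
by rewrite -(scale0r 0) rhoZ ellZ mul0r eq_sym oner_eq0.
Qed.

Lemma param_lightlike x : disk x -> qf (M x) = 0 -> exists v, M x = tvec A v.
Proof.
move=> dx q0; have [v [c [c0 E]]] := cone_lightlike sA (param_cone hM dx) q0 (param_neq0 x).
exists v; have := param_ell hM x.
by rewrite E rhoZ ellZ tvecE rho_adjK // ell_octvec mulr1 => ->; rewrite scale1r -tvecE.
Qed.

(** With s^2 = qf (M x), the horoball condition reads c b < r s. In the tile near the cusp b <= 4
    s^2, hence c^2 b^2 <= 4 c^2 b s^2, which is below r^2 s^2 once b < r^2/(4 c^2). *)
Lemma chart_continuous_cusp (p0 : 'rV[R]_n) u (U : set (Hstar R)) :
  disk p0 -> val (psi p0) = inr u -> Hstar_open U -> U (psi p0) ->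
  nbhs p0 [set x | disk x -> U (psi x)].
Proof.
move=> dx0 E oU Ux0; have := oU _ Ux0; rewrite E => -[r r0 hU].
have [c c0] := psiE dx0; rewrite E => mE.
have q0 x c' u' : 0 < c' -> mink (inr u') = c' *: M x -> qf (M x) = 0.
  move=> c'0 /(congr1 (@qf R)); rewrite qf_mink_inr qfZ => /esym/eqP.
  by rewrite mulf_eq0 expf_eq0 /= (gt_eqF c'0) => /eqP.
have [v Mv] := param_lightlike dx0 (q0 _ _ _ c0 mE).
pose b x := polar (tvec A v) (M x).
have cb : continuous b by apply: lin_continuous (param_cont hM) => a x y; exact: polar_lin.
have b0 : b p0 = 0 by rewrite /b Mv polar_tvec // eqxx.
have nb1 : nbhs p0 [set x | b x < 1 / 2] by apply: near_lt; [exact: cb|rewrite b0; lra].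
have cc : 0 < 4%:R * c ^+ 2 by rewrite mulr_gt0 ?exprn_gt0.
have nb2 : nbhs p0 [set x | b x < r ^+ 2 / (4%:R * c ^+ 2)].
  by apply: near_lt; [exact: cb|rewrite b0 divr_gt0 ?exprn_gt0].
near=> x => dx; have [c' c'0 mE'] := psiE dx.
have b1 : b x < 1 / 2 by near: x.
have b2 : b x < r ^+ 2 / (4%:R * c ^+ 2) by near: x.
have ins := Hstar_inside (psi x).
case px : (val (psi x)) => [[z' t']|u']; last first.
  rewrite px in mE'; have [v' Mv'] := param_lightlike dx (q0 _ _ _ c'0 mE').
  suff -> : psi x = psi p0 by [].
  (* Another vertex would pair with v to at least 1, above the bound 1/2. *)
  have vv : v' = v.
    apply/esym/eqP; apply/negP => /negP vv; move: b1.
    by rewrite /b Mv' polar_tvec // (negPf vv); case: eqP => _; lra.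
  apply: (@Hstar_mink_inj _ _ _ (c' / c)).
  by rewrite px E mE' mE Mv Mv' vv scalerA mulfVK // gt_eqF.
rewrite px /= in ins mE'; apply: (hU _ _ px); apply: horoballE => //.
have qx : 0 < qf (M x).
  have : 0 < c' ^+ 2 * qf (M x) by rewrite -qfZ -mE' qf_mink_inl exprn_gt0.
  by rewrite pmulr_rgt0 // exprn_gt0.
pose s := Num.sqrt (qf (M x)).
have tE : t' = c' * s.
  rewrite -[LHS](qf_mink_inside z' ins) mE' qfZ sqrtrM ?sqr_ge0 //.
  by rewrite sqrtr_sqr gtr0_norm.
rewrite mE mE' polarZ Mv -/(b x) tE.
have -> : c * c' * b x = c' * (c * b x) by ring.
have -> : r * (c' * s) = c' * (r * s) by ring.
rewrite ltr_pM2l //; have s0 : 0 <= s by apply: sqrtr_ge0.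
have bx0 : 0 <= b x.
  have [w w0 wE] := weights_setT (param_cone hM dx).
  have [h _ _] := polar_weights v sA w0; rewrite /b wE; apply: le_trans h.
  by rewrite sumr_ge0.
have hor := cone_horoball sA (param_cone hM dx) (param_ell hM x) (ltW b1).
rewrite -(@ltr_pXn2r _ 2) // ?nnegrE ?mulr_ge0 ?(ltW r0) ?(ltW c0) // !exprMn sqr_sqrtr ?(ltW qx) //.
rewrite ltr_pdivlMr // in b2; apply: le_lt_trans (_ : 4%:R * c ^+ 2 * b x * qf (M x) < _).
  have -> : 4%:R * c ^+ 2 * b x * qf (M x) = c ^+ 2 * (b x * (4%:R * qf (M x))) by ring.
  by rewrite ler_wpM2l ?sqr_ge0 // expr2 ler_wpM2l.
by rewrite ltr_pM2r // mulrC.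
Unshelve. all: by end_near. Qed.

Lemma chart_continuous : {within @disk R n, continuous psi}.
Proof.
apply/subspace_continuousP => p0 dp0 U; rewrite nbhsE => -[V [oV Vp] VU].
suff h : nbhs p0 [set x | disk x -> V (psi x)].
  by apply: filterS h => x hx dx; apply: VU; apply: hx.
case E : (val (psi p0)) => [[z t]|u]; first exact: chart_continuous_inside E oV Vp.
exact: chart_continuous_cusp E oV Vp.
Qed.

Lemma mink_ell_scale (m : 'rV[R]_4) S' : cone A S' m -> m != 0 -> 0 < ell (rho (\adj A) m).
Proof.
move=> [w w0 mE] m0; rewrite mE rho_sum ell_sum.
have e v : w v * ell (rho (\adj A) (tvec A v)) = w v.
  by rewrite tvecE rho_adjK // ell_octvec mulr1.
rewrite (eq_bigr _ (fun v _ => e v)) lt_def sumr_ge0 // andbT.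
apply: contraNneq m0 => s0; rewrite mE big1 // => v vS.
by rewrite (psumr_eq0P w0 s0) // scale0r.
Qed.

(** Each ray of the cone meets the slice of level 1 exactly once, and a point of [Hstar] is
    determined by its ray. *)
Lemma chart_bij : set_bij (@disk R n) (tile_face A S) psi /\
  psi @` @open_disk R n = open_tile_face A S.
Proof.
have inj x y : disk x -> disk y -> psi x = psi y -> x = y.
  move=> dx dy xy; have [c c0 E] := psiE dx; have [d d0 E'] := psiE dy.
  apply: (param_inj hM); rewrite xy E' in E.
  have := congr1 (fun m => ell (rho (\adj A) m)) E.
  rewrite !rhoZ !ellZ !(param_ell hM) !mulr1 => dc; rewrite dc in E.
  by have := congr1 (fun m => c^-1 *: m) E; rewrite !scalerA mulVf ?gt_eqF // !scale1r.
have normal (x : Hstar R) S' : cone A S' (mink (val x)) ->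
    exists2 c : R, 0 < c & ell (rho (\adj A) (c *: mink (val x))) = 1.
  move=> /mink_ell_scale /(_ (mink_neq0 _)) l0.
  by exists (ell (rho (\adj A) (mink (val x))))^-1; rewrite ?invr_gt0 // rhoZ ellZ mulVf // gt_eqF.
have hit (x : Hstar R) c y : 0 < c -> disk y -> M y = c *: mink (val x) -> psi y = x.
  move=> c0 dy E; have [d d0 E'] := psiE dy; apply: (@Hstar_mink_inj _ _ _ (d * c)).
  by rewrite E' E scalerA.
split.
  split.
  - move=> x dx; apply/tile_faceE => //; have [c c0 ->] := psiE dx.
    by apply: coneZ; [exact: ltW|exact: (param_cone hM dx)].
  - by move=> x y; rewrite !inE; exact: inj.
  - move=> x /tile_faceE cx; have cx' := cx sA; have [c c0 c1] := normal x S cx'.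
    have [y dy E] := param_surj hM (coneZ (ltW c0) cx') c1.
    by exists y => //; apply: hit c0 dy E.
apply/seteqP; split=> [_ [x dx <-]|x /open_tile_faceE ox].
  apply/open_tile_faceE => //; have [c c0 ->] := psiE (open_disk_sub dx).
  by apply: oconeZ => //; exact: (param_ocone hM dx).
have ox' := ox sA; have [c c0 c1] := normal x S (ocone_cone ox').
have [y dy E] := param_osurj hM (oconeZ c0 ox') c1.
by exists y => //; apply: hit c0 (open_disk_sub dy) E.
Qed.
End Chart.

Lemma tile_chart (R : realType) n (S : {set octv}) (A : 'M[Zi R]_2) :
  SL2 A -> oct_face S -> face_dim S = n ->
  exists psi : 'rV[R]_n -> Hstar R, [/\ {within @disk R n, continuous psi},
    set_bij (@disk R n) (tile_face A S) psi &
    psi @` @open_disk R n = open_tile_face A S].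
Proof.
move=> sA fS dS; have [M hM] := face_param_exists sA fS dS.
have /boolp.choice[psi psiE] : forall x : 'rV[R]_n, exists y : Hstar R,
    disk x -> exists2 c : R, 0 < c & mink (val y) = c *: M x.
  (* Off the disk the value of psi is arbitrary. *)
  move=> x; have [dx|no] := pselect (disk x); last by exists (cusp R (i30, false)) => /no.
  have [y [c [c0 E]]] := cone_point sA (param_cone hM dx) (param_neq0 hM x).
  by exists y => _; exists c.
exists psi; have [b o] := chart_bij sA hM psiE; split=> //.
exact: (chart_continuous sA hM psiE).
Qed.

(** * Separation of orbits by balls and horoballs *)

(** A union of translates by the kernel. For k on a light ray they are horoballs with their center
    added; for k = mink p with p inside they are hyperbolic balls, as polar (mink p) (mink q) is 2 t
    t' cosh of the distance, where t and t' are the heights. *)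
Definition orbit_nbhd (R : realType) (I : prime_idealr (Zi R)) (k : 'rV[R]_4) (s : R) :
    set (Hstar R) :=
  [set y | exists2 g, Gamma0 I g & match val y with
    | inl q => polar (rho g k) (mink (val y)) < s * q.2
    | inr _ => exists2 c, 0 < c & mink (val y) = c *: rho g k
    end].

Lemma horoball_polar (R : realType) (u : option R[i]) (r : R) (z : R[i]) (t : R) : 0 < t ->
  horoball u r (z, t) -> polar (mink (inr u)) (mink (inl (z, t))) < r * t.
Proof.
move=> t0; case: z => x y; case: u => [[a b]|]; rewrite /horoball /sqnorm /=.
  rewrite mink_inr mink_inl /polar !mk4E => h; apply: le_lt_trans h.
  by rewrite le_eqVlt; apply/orP; left; apply/eqP; ring.
rewrite mink_oo mink_inl /polar !mk4E => h.
rewrite -(ltr_pM2r t0) mulVf ?gt_eqF // in h; apply: le_lt_trans h.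
by rewrite le_eqVlt; apply/orP; left; apply/eqP; ring.
Qed.

Lemma open_polar (R : realType) (k : 'rV[R]_4) (s : R) (z : R[i]) (t : R) :
  polar k (mink (inl (z, t))) < s * t -> exists2 e : R, 0 < e & forall z' t',
    sqnorm (z' - z) + (t' - t) ^+ 2 < e ^+ 2 ->
    polar k (mink (inl (z', t'))) < s * t'.
Proof.
case: z => a b h.
pose M (p : (R * R * R)%type) := mk4 (p.1.1 ^+ 2 + p.1.2 ^+ 2 + p.2 ^+ 2) p.1.1 p.1.2 1.
have c11 : continuous (fun p : (R * R * R)%type => p.1.1).
  by move=> p; apply: continuous_comp; exact: cvg_fst.
have c12 : continuous (fun p : (R * R * R)%type => p.1.2).
  by move=> p; apply: continuous_comp; [exact: cvg_fst|exact: cvg_snd].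
have c2 : continuous (fun p : (R * R * R)%type => p.2) by move=> p; exact: cvg_snd.
have sq (f : (R * R * R)%type -> R) : continuous f -> continuous (fun x => f x ^+ 2).
  by move=> cf p; apply: (@forcM R _ f f); exact: cf.
have cM j : continuous (fun p => M p 0 j).
  have [->|[->|[->|->]]] : j = x0 \/ j = x1 \/ j = x2 \/ j = x3.
    by case: j => [[|[|[|[|//]]]] hj]; [left|right; left|right; right; left|
      right; right; right]; apply: val_inj.
  - rewrite (_ : (fun p => _) = fun p : (R * R * R)%type => p.1.1 ^+ 2 + p.1.2 ^+ 2 + p.2 ^+ 2).
      move=> p; apply: (@forcD R _ (fun p : (R * R * R)%type => p.1.1 ^+ 2 + p.1.2 ^+ 2)
        (fun p => p.2 ^+ 2)); last exact: sq.
      by apply: (@forcD R _ (fun p : (R * R * R)%type => p.1.1 ^+ 2) (fun p => p.1.2 ^+ 2)); exact: sq.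
    by apply/funext => p; rewrite /M mk4E.
  - by rewrite (_ : (fun p => _) = fun p : (R * R * R)%type => p.1.1) //;
      apply/funext => p; rewrite /M mk4E.
  - by rewrite (_ : (fun p => _) = fun p : (R * R * R)%type => p.1.2) //;
      apply/funext => p; rewrite /M mk4E.
  - by rewrite (_ : (fun p => _) = fun p : (R * R * R)%type => 1); [move=> p; exact: forc_cst|];
      apply/funext => p; rewrite /M mk4E.
pose F p := s * p.2 - polar k (M p).
have cF : continuous F.
  move=> p; apply: (@forcB R _ (fun p => s * p.2) (fun p => polar k (M p))).
    by apply: (@forcM R _ (fun=> s) (fun p => p.2)); [exact: forc_cst|exact: c2].
  by apply: lin_continuous cM p => x y w; exact: polar_lin.
have : nbhs (a, b, t) [set p | 0 < F p].
  by apply: near_gt; [exact: cF|rewrite /F subr_gt0 /= /M /=; rewrite mink_inl in h].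
move=> /nbhs_ballP[e e0 he]; exists e => // -[a' b'] t'; rewrite /sqnorm /= => lt.
have small (x y : R) : (x - y) ^+ 2 < e ^+ 2 -> `|y - x| < e.
  move=> h'; rewrite -(@ltr_pXn2r _ 2) ?nnegrE ?(ltW e0) // real_normK ?num_real //.
  by move: h'; rewrite -sqrrN opprB.
have h1 := sqr_ge0 (a' - a); have h2 := sqr_ge0 (b' - b); have h3 := sqr_ge0 (t' - t).
have : 0 < F (a', b', t').
  by apply: he; split; [split|]; apply: small => /=; apply: le_lt_trans lt; lra.
by rewrite /F subr_gt0 mink_inl.
Qed.

Lemma orbit_nbhd_open (R : realType) (I : prime_idealr (Zi R)) k s : 0 < s ->
  Hstar_open (@orbit_nbhd R I k s).
Proof.
move=> s0 x [g gG]; have ins := Hstar_inside x.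
case E : (val x) ins => [[z t]|u] ins.
  move=> /open_polar[e e0 h]; exists e => // y z' t' yE lt; exists g => //.
  by rewrite yE; apply: h.
move=> [c c0 mE]; exists (c * s) => [|y [z t] yE]; first by rewrite mulr_gt0.
have t0 : 0 < t by have := Hstar_inside y; rewrite yE.
move=> /(horoball_polar t0); rewrite mE => h; exists g => //; rewrite yE /=.
rewrite -(ltr_pM2l c0) mulrA; apply: le_lt_trans h.
by rewrite -{2}[mink (inl _)]scale1r polarZ mulr1.
Qed.

(** On normalised vectors qf is the squared height, and [rho] preserves qf, so the scale of the ray
    is also the factor on the height. *)
Lemma hact_height (R : realType) (A : 'M[Zi R]_2) (x : Hstar R) z t : SL2 A ->
  val x = inl (z, t) -> exists z' (c : R), [/\ 0 < c, val (hact A x) = inl (z', c * t) &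
    mink (val (hact A x)) = c *: rho A (mink (val x))].
Proof.
move=> sA E; have [c c0 mE] := mink_hact x sA.
have t0 : 0 < t by have := Hstar_inside x; rewrite E.
have q : qf (mink (val (hact A x))) = (c * t) ^+ 2.
  by rewrite mE qfZ rho_qf // E qf_mink_inl exprMn.
have ins := Hstar_inside (hact A x).
case E' : (val (hact A x)) q ins => [[z' t']|u] q /= ins; last first.
  move: q; rewrite qf_mink_inr => /esym/eqP.
  by rewrite expf_eq0 /= mulf_eq0 !gt_eqF.
have t'E : t' = c * t.
  rewrite -[LHS](qf_mink_inside z' ins) q sqrtr_sqr gtr0_norm //; exact: mulr_gt0.
by exists z', c; rewrite -t'E -E' mE.
Qed.

Lemma orbit_nbhd_hact (R : realType) (I : prime_idealr (Zi R)) k s h (y : Hstar R) :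
  Gamma0 I h -> orbit_nbhd I k s y -> orbit_nbhd I k s (hact h y).
Proof.
move=> hG [g gG H]; have [sh _] := hG; exists (h *m g); first exact: Gamma0_mul.
move: H; case E : (val y) => [[z t]|u].
  have [z' [c [c0 -> ->]]] := hact_height sh E; rewrite -rho_mul E /= => lt.
  by rewrite -[rho h (rho g k)]scale1r polarZ mul1r rho_polar // mulrCA ltr_pM2l.
move=> [c c0 mE]; have [d d0 mE'] := mink_hact y sh.
have : qf (mink (val (hact h y))) = 0 by rewrite mE' qfZ rho_qf // E qf_mink_inr mulr0.
have ins := Hstar_inside (hact h y).
case E' : (val (hact h y)) ins => [[z t]|u'] /= ins.
  by rewrite qf_mink_inl => /eqP; rewrite expf_eq0 /= gt_eqF.
move=> _; exists (d * c); first exact: mulr_gt0.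
by rewrite -E' mE' E mE rhoZ scalerA rho_mul.
Qed.

Lemma orbit_nbhd_cusp (R : realType) (I : prime_idealr (Zi R)) s (x n : Hstar R) u :
  orbit_nbhd I (mink (val x)) s n -> val n = inr u -> proj_quotient I n = proj_quotient I x.
Proof.
move=> [g gG + E]; rewrite E -E => -[c c0 mE]; have [sg _] := gG.
have [d d0 mE'] := mink_hact x sg; apply/esym/proj_eq; exists g => //.
by apply: (@Hstar_mink_inj _ _ _ (c / d)); rewrite mE mE' scalerA mulfVK // gt_eqF.
Qed.

Lemma orbit_nbhd_self (R : realType) (I : prime_idealr (Zi R)) s (x : Hstar R) :
  (forall z t, val x = inl (z, t) -> 2 * t < s) -> orbit_nbhd I (mink (val x)) s x.
Proof.
move=> h; exists 1%:M; first exact: Gamma0_1.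
rewrite rho1; case E : (val x) => [[z t]|u]; last by exists 1; rewrite ?scale1r.
have t0 : 0 < t by have := Hstar_inside x; rewrite E.
by rewrite polar_self qf_mink_inl expr2 mulrA ltr_pM2r // (h z).
Qed.

(* Up to the group, a common point of two neighborhoods can be taken near the
   center of the second one. *)
Lemma orbit_nbhd_meet (R : realType) (I : prime_idealr (Zi R)) s1 s2 (x y n : Hstar R) :
  proj_quotient I x <> proj_quotient I y ->
  orbit_nbhd I (mink (val x)) s1 n -> orbit_nbhd I (mink (val y)) s2 n ->
  exists g z t, [/\ Gamma0 I g, 0 < t,
    polar (rho g (mink (val x))) (mink (inl (z, t))) < s1 * t &
    polar (mink (val y)) (mink (inl (z, t))) < s2 * t].
Proof.
move=> xy nx ny; case E : (val n) => [[z t]|u]; last first.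
  by exfalso; apply: xy; rewrite -(orbit_nbhd_cusp nx E) (orbit_nbhd_cusp ny E).
have t0 : 0 < t by have := Hstar_inside n; rewrite E.
move: nx ny => [g gG + [h hG]]; rewrite E /= => lx ly.
have [sg _] := gG; have [sh _] := hG; have sh' := adj_SL2 sh.
have [z' [c [c0 E' mE]]] := hact_height sh' E; rewrite E' E in mE.
have hK m : polar (rho (\adj h) m) (mink (inl (z', c * t))) = c * polar m (mink (inl (z, t))).
  by rewrite mE -{1}[rho (\adj h) m]scale1r polarZ mul1r rho_polar.
exists (\adj h *m g), z', (c * t); split.
- exact/Gamma0_mul/gG/Gamma0_adj.
- exact: mulr_gt0.
- by rewrite -rho_mul hK mulrCA ltr_pM2l.
- by rewrite -[mink (val y)](rho_adjK _ sh) hK mulrCA ltr_pM2l.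
Qed.

Lemma proj_same_ray (R : realType) (I : prime_idealr (Zi R)) g (x y : Hstar R) (c : R) :
  Gamma0 I g -> rho g (mink (val x)) = c *: mink (val y) ->
  proj_quotient I x = proj_quotient I y.
Proof.
move=> gG E; have [sg _] := gG; have [d d0 mE] := mink_hact x sg.
apply/proj_eq; exists g => //; apply/esym/(@Hstar_mink_inj _ _ _ (d * c)).
by rewrite mE E scalerA.
Qed.

(* Lagrange's identity: the difference is the square of the norm of a Hermitian
   product. *)
Lemma polar_light_mul (R : realType) (v w : 'cV[Zi R]_2) z t :
  zn (det2 v w) * t ^+ 2 <=
  polar (lightvec v) (mink (inl (z, t))) * polar (lightvec w) (mink (inl (z, t))).
Proof.
case: z => x y; rewrite !polar_light_inside /det2 -subr_ge0.
set P := zre (v 0 0) - _; set P' := zim (v 0 0) - _.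
set Q := zre (w 0 0) - _; set Q' := zim (w 0 0) - _.
pose U := P * Q + P' * Q' + (zre (v 1 0) * zre (w 1 0) + zim (v 1 0) * zim (w 1 0)) * t ^+ 2.
pose V := P * Q' - P' * Q + (zre (v 1 0) * zim (w 1 0) - zim (v 1 0) * zre (w 1 0)) * t ^+ 2.
apply: le_trans (sumsq_ge0 U V) _; rewrite le_eqVlt; apply/orP; left; apply/eqP.
by rewrite /U /V /P /P' /Q /Q' /zn !zE; ring.
Qed.

Lemma polar_light_ge0 (R : realType) (v : 'cV[Zi R]_2) z t :
  0 <= polar (lightvec v) (mink (inl (z, t))).
Proof.
case: z => x y; rewrite polar_light_inside; apply: addr_ge0; first exact: sumsq_ge0.
by apply: mulr_ge0; [exact: zn_ge0|exact: sqr_ge0].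
Qed.

Definition separated (R : realType) (I : prime_idealr (Zi R)) (x y : Hstar R) :=
  exists s1 s2 : R, [/\ 0 < s1, 0 < s2,
    orbit_nbhd I (mink (val x)) s1 x, orbit_nbhd I (mink (val y)) s2 y &
    forall n, orbit_nbhd I (mink (val x)) s1 n -> orbit_nbhd I (mink (val y)) s2 n -> False].

(** The sizes c and d are those for which the horoball of a primitive vector v is polar (lightvec v)
    p < t, with t the height of p. If two such horoballs meet, [polar_light_mul] gives a determinant
    of norm below 1, hence 0, and the cusps agree. *)
Lemma separated_cusps (R : realType) (I : prime_idealr (Zi R)) (x y : Hstar R) u v :
  proj_quotient I x <> proj_quotient I y -> val x = inr u -> val y = inr v ->
  separated I x y.
Proof.
move=> xy xu yv; have [A [k [c [sA c0 mx]]]] := cusp_tvec xu.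
have [B [l [d [sB d0 my]]]] := cusp_tvec yv.
exists c, d; split=> //; try by apply: orbit_nbhd_self => z t; rewrite ?xu ?yv.
move=> n nx ny; have [g [z [t [gG t0]]]] := orbit_nbhd_meet xy nx ny.
rewrite mx my rhoZ tvecM => lx ly; have [sg _] := gG.
have scal (a : R) m N : polar (a *: m) N = a * polar m N.
  by rewrite -{1}[N]scale1r polarZ mulr1.
rewrite !scal !ltr_pM2l // !tvec_def in lx ly.
have z1 : zn (det2 (g *m A *m vec R k) (B *m vec R l)) < 1.
  have tt : 0 < t ^+ 2 by rewrite exprn_gt0.
  rewrite -(ltr_pM2r tt) mul1r; apply: le_lt_trans (polar_light_mul _ _ z t) _.
  by rewrite expr2 ltr_pM // polar_light_ge0.
have dz : det2 (g *m A *m vec R k) (B *m vec R l) = 0.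
  by apply/eqP; apply/negP => /negP /zn_ge1; rewrite leNgt z1.
have [e eE] := det2_colinear (mul_SL2 sg sA) dz.
apply: xy; apply/esym; apply: (@proj_same_ray _ _ (\adj g) _ _ (d * zn e / c)).
  exact: Gamma0_adj.
rewrite mx my rhoZ tvec_def eE lightvecZ rhoZ !scalerA -tvec_def -tvecM rho_adjK //.
by rewrite mulfVK // gt_eqF.
Qed.

Lemma inside_ball (R : realType) (z w : R[i]) (t s e : R) : 
  polar (mink (inl (z, t))) (mink (inl (w, s))) < (2 + e) * t * s ->
  sqnorm (z - w) + (t - s) ^+ 2 < e * t * s.
Proof.
case: z w => [a b] [c d]; rewrite !mink_inl /polar !mk4E /sqnorm /= => h.
rewrite -subr_gt0; rewrite -subr_gt0 in h; apply: lt_le_trans h _.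
by rewrite le_eqVlt; apply/orP; left; apply/eqP; ring.
Qed.

(** From (t - s)^2 < ts the ratio of the heights is below (3 + sqrt 5)/2, rounded up to 3. *)
Lemma ball_height (R : realType) (q t s : R) : 0 <= q -> 0 < t -> 0 < s ->
  q + (t - s) ^+ 2 < t * s -> s < 3%:R * t /\ t < 3%:R * s.
Proof.
move=> q0 t0 s0 h; split; rewrite ltNge; apply/negP => le; move: h; apply/negP; rewrite -leNgt.
  have := mulr_ge0 (ltW s0) (_ : 0 <= s - 3%:R * t); rewrite subr_ge0 => /(_ le).
  by have := mulr_gt0 t0 t0; rewrite !expr2; nra.
have := mulr_ge0 (ltW t0) (_ : 0 <= t - 3%:R * s); rewrite subr_ge0 => /(_ le).
by have := mulr_gt0 s0 s0; rewrite !expr2; nra.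
Qed.

(* lra fails on hypotheses which are equations between vectors or points. *)
Ltac geo_lra := repeat match goal with
  | H : mink _ = _ |- _ => clear H
  | H : rho _ _ = _ |- _ => clear H
  | H : _ = inl _ |- _ => clear H
  | H : _ = inr _ |- _ => clear H
  | H : _ <> _ |- _ => clear H
  end; lra.

Lemma separated_cusp_inside (R : realType) (I : prime_idealr (Zi R)) (x y : Hstar R) u z1 t1 :
  proj_quotient I x <> proj_quotient I y -> val x = inr u -> val y = inl (z1, t1) ->
  separated I x y.
Proof.
move=> xy xu yE; have [A [k [c [sA c0 mx]]]] := cusp_tvec xu.
have t10 : 0 < t1 by have := Hstar_inside y; rewrite yE.
(* The ball at y keeps heights between t1/3 and 3 t1. In the horoball, 1 < r t would hold if its
   center is infinity, and t < r otherwise; the two bounds on r exclude these. *)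
pose r := Num.min (t1 / 3%:R) (3%:R * t1)^-1.
have r0 : 0 < r by rewrite lt_min divr_gt0 // invr_gt0 mulr_gt0.
exists (c * r), (3%:R * t1); split; try exact: mulr_gt0.
- by apply: orbit_nbhd_self => z t; rewrite xu.
- by apply: orbit_nbhd_self => z t; rewrite yE => -[_ <-]; rewrite ltr_pM2r // ltr_nat.
move=> n nx ny; have [g [[a b] [t [gG t0]]]] := orbit_nbhd_meet xy nx ny.
have [sg _] := gG; rewrite mx yE rhoZ tvecM => lx ly.
rewrite -{1}[mink _]scale1r polarZ mulr1 -mulrA ltr_pM2l // tvec_def polar_light_inside in lx.
have [lt1 lt2] : t < 3%:R * t1 /\ t1 < 3%:R * t.
  apply: (@ball_height _ (sqnorm (z1 - Complex a b))) => //; first exact: sumsq_ge0.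
  rewrite -[t1 * t]mul1r mulrA; apply: inside_ball.
  by rewrite (_ : 2 + 1 = 3%:R) //; ring.
have r1 : r <= t1 / 3%:R by rewrite ge_min lexx.
have r2 : r <= (3%:R * t1)^-1 by rewrite ge_min lexx orbT.
set v := g *m A *m vec R k in lx.
set P := _ - _ in lx; set P' := zim _ - _ in lx.
have [v10|v10] := eqVneq (v 1 0) 0.
  have v00 : v 0 0 != 0.
    apply/eqP => v00; have := mulvec_neq0 k (mul_SL2 sg sA); rewrite -/v => /eqP; apply.
    by apply: col2P; rewrite ?v00 ?v10 mxE.
  have : zn (v 0 0) < r * t.
    apply: le_lt_trans lx; rewrite /P /P' v10 /zn !zE le_eqVlt.
    by apply/orP; left; apply/eqP; ring.
  have : r * t < 1.
    apply: le_lt_trans (_ : (3%:R * t1)^-1 * t < 1); first by rewrite ler_pM2r.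
    by rewrite mulrC ltr_pdivrMr ?mulr_gt0 // mul1r.
  by have := zn_ge1 v00; geo_lra.
have : zn (v 1 0) * t ^+ 2 < r * t.
  by apply: le_lt_trans lx; rewrite lerDr sumsq_ge0.
have : t ^+ 2 <= zn (v 1 0) * t ^+ 2 by rewrite ler_peMl ?sqr_ge0 // zn_ge1.
move=> h1 h2; have := le_lt_trans h1 h2; rewrite expr2 ltr_pM2r // => h3.
by geo_lra.
Qed.

Lemma common_radius (T : eqType) (R : realType) (s : seq T) (P : T -> R -> Prop) :
  (forall x e e', P x e -> 0 < e' -> e' <= e -> P x e') ->
  (forall x, x \in s -> exists2 e, 0 < e & P x e) ->
  exists2 e, 0 < e & e <= 1 /\ forall x, x \in s -> P x e.
Proof.
move=> mono; elim: s => [_|a s IH h]; first by exists 1.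
have [e e0 [e1 he]] : exists2 e, 0 < e & e <= 1 /\ forall x, x \in s -> P x e.
  by apply: IH => x xs; apply: h; rewrite inE xs orbT.
have [f f0 hf] := h a (mem_head _ _); have m0 : 0 < Num.min e f by rewrite lt_min e0.
exists (Num.min e f) => //; split; first by rewrite ge_min e1.
move=> x; rewrite inE => /orP[/eqP ->|xs].
  by apply: mono hf m0 _; rewrite ge_min lexx orbT.
by apply: mono (he x xs) m0 _; rewrite ge_min lexx.
Qed.

Lemma sqnorm_tri (R : realType) (z w y : R[i]) :
  sqnorm (z - y) <= 2 * (sqnorm (z - w) + sqnorm (w - y)).
Proof.
case: z w y => [a b] [c d] [e f]; rewrite /sqnorm /=.
by have := sqr_ge0 (a - c - (c - e)); have := sqr_ge0 (b - d - (d - f)); nra.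
Qed.

(** For e <= 1 only finitely many g can make the ball at g x meet the ball at y. Each of these g x
    differs from y, so a small enough e works for all of them. *)
Lemma separated_inside (R : realType) (I : prime_idealr (Zi R)) (x y : Hstar R) z0 t0 z1 t1 :
  proj_quotient I x <> proj_quotient I y -> val x = inl (z0, t0) -> val y = inl (z1, t1) ->
  separated I x y.
Proof.
move=> xy xE yE.
have t00 : 0 < t0 by have := Hstar_inside x; rewrite xE.
have t10 : 0 < t1 by have := Hstar_inside y; rewrite yE.
(* A bound for the trace of rho g (mink x), with g x = (z', t'): the scale t0/t' is at most 9 t0/t1,
   while |z'|^2 <= 2|z1|^2 + 120 t1^2 and t'^2 <= 81 t1^2, for which 300 t1^2 is ample. *)
pose K := t0 * 9%:R / t1 * (2 * sqnorm (z1 - 0) + 300%:R * t1 ^+ 2 + 1).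
have [s hs] := bounded_SL2 z0 K t00.
pose bad (e : R) (g : 'M[Zi R]_2) z t := [/\ Gamma0 I g, 0 < t,
    polar (rho g (mink (val x))) (mink (inl (z, t))) < (2 + e) * t0 * t &
    polar (mink (val y)) (mink (inl (z, t))) < (2 + e) * t1 * t].
have badE e g z t : bad e g z t -> e <= 1 -> exists z' t',
    [/\ val (hact g x) = inl (z', t'), 0 < t',
        mink (inl (z', t')) = (t' / t0) *: rho g (mink (val x)) /\
        t < 3%:R * t1 /\ t' < 3%:R * t, t1 < 3%:R * t /\ t < 3%:R * t' &
        sqnorm (z' - z) + (t' - t) ^+ 2 < e * t' * t /\
        sqnorm (z1 - z) + (t1 - t) ^+ 2 < e * t1 * t].
  move=> [gG tp lx ly] e1; have [sg _] := gG.
  have [z' [c [c0 gE mE]]] := hact_height sg xE; exists z', (c * t0).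
  have ct0 : 0 < c * t0 by exact: mulr_gt0.
  have b1 : sqnorm (z' - z) + (c * t0 - t) ^+ 2 < e * (c * t0) * t.
    apply: inside_ball; rewrite -gE mE -[mink (inl (z, t))]scale1r polarZ mulr1.
    have -> : (2 + e) * (c * t0) * t = c * ((2 + e) * t0 * t) by ring.
    by rewrite ltr_pM2l.
  have b2 : sqnorm (z1 - z) + (t1 - t) ^+ 2 < e * t1 * t.
    by apply: inside_ball; rewrite -yE.
  have [h1 h2] : t < 3%:R * (c * t0) /\ c * t0 < 3%:R * t.
    apply: (@ball_height _ (sqnorm (z' - z))) => //; first exact: sumsq_ge0.
    apply: lt_le_trans b1 _; rewrite -mulrA ler_piMl // mulr_ge0 // ltW //.
  have [h3 h4] : t < 3%:R * t1 /\ t1 < 3%:R * t.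
    apply: (@ball_height _ (sqnorm (z1 - z))) => //; first exact: sumsq_ge0.
    apply: lt_le_trans b2 _; rewrite -mulrA ler_piMl // mulr_ge0 // ltW //.
  by split=> //; split=> //; rewrite -gE mE mulfK // gt_eqF.
have fin e g z t : bad e g z t -> e <= 1 -> g \in s.
  move=> hb e1; have [z' [t' [gE t'0 [mE [a1 a2]] [a3 a4] [b1 b2]]]] := badE _ _ _ _ hb e1.
  have e1' (a b : R) : 0 < a -> 0 < b -> e * a * b <= a * b.
    by move=> ap bp; rewrite -mulrA ler_piMl // mulr_ge0 // ltW.
  have [_ tp _ _] := hb.
  apply: hs; rewrite -xE; have gm : rho g (mink (val x)) = (t0 / t') *: mink (inl (z', t')).
    rewrite mE scalerA -{1}[rho g _]scale1r; congr (_ *: _).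
    by field; rewrite !gt_eqF.
  have trE : mink (inl (z', t')) 0 x0 + mink (inl (z', t')) 0 x3 =
      sqnorm (z' - 0) + t' ^+ 2 + 1.
    case: (z') => a b; rewrite mink_inl !mk4E /sqnorm /=; ring.
  have scE (c : R) (m : 'rV[R]_4) j : (c *: m) 0 j = c * m 0 j by rewrite mxE.
  rewrite gm !scE -mulrDr trE /K.
  have k1 : t0 / t' <= t0 * 9%:R / t1.
    rewrite ler_pdivrMr // mulrAC ler_pdivlMr // -mulrA ler_pM2l //; geo_lra.
  have tt : t' <= 9%:R * t1 by geo_lra.
  have tt2 : t' ^+ 2 <= 81%:R * t1 ^+ 2.
    have := ler_pM (ltW t'0) (ltW t'0) tt tt; rewrite -!expr2 => /le_trans -> //.
    by rewrite exprMn -natrX.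
  have b1' : sqnorm (z' - z) <= 27%:R * t1 ^+ 2.
    have := sqr_ge0 (t' - t); have := e1' _ _ t'0 tp.
    by have := ler_pM (ltW t'0) (ltW tp) tt (ltW a1); rewrite expr2; geo_lra.
  have b2' : sqnorm (z - z1) <= 3%:R * t1 ^+ 2.
    have -> : sqnorm (z - z1) = sqnorm (z1 - z).
      by case: (z) (z1) => [a b] [c d]; rewrite /sqnorm /=; ring.
    have := sqr_ge0 (t1 - t); have := e1' _ _ t10 tp.
    by have := ler_pM (ltW t10) (ltW tp) (lexx t1) (ltW a1); rewrite expr2; geo_lra.
  have n1 := sqnorm_tri z' z1 0; have n2 := sqnorm_tri z' z z1.
  apply: ler_pM => //; first by rewrite divr_ge0 // ltW.
    by rewrite !addr_ge0 ?sqr_ge0 //; exact: sumsq_ge0.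
  by have := sqr_ge0 t1; geo_lra.
have [e e0 [e1 he]] : exists2 e, 0 < e & e <= 1 /\
    forall g, g \in s -> forall z t, ~ bad e g z t.
  apply: common_radius => [g e e' P e'0 ee' z t [gG tp lx ly]|g _].
    apply: (P z t); split=> //.
      by apply: lt_le_trans lx _; rewrite -!mulrA ler_pM2r ?mulr_gt0 // lerD2l.
    by apply: lt_le_trans ly _; rewrite -!mulrA ler_pM2r ?mulr_gt0 // lerD2l.
  case gE : (val (hact g x)) => [[z' t']|u]; last first.
    exists 1 => // z t hb; have [z'' [t'' [gE' _ _ _ _]]] := badE _ _ _ _ hb (lexx 1).
    by rewrite gE in gE'.
  have [gG|nG] := pselect (Gamma0 I g); last by exists 1 => // z t [].
  pose D := sqnorm (z' - z1) + (t' - t1) ^+ 2.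
  have D0 : 0 < D.
    have Dge : 0 <= D by apply: addr_ge0; [exact: sumsq_ge0|exact: sqr_ge0].
    rewrite lt_def Dge andbT /D.
    apply/negP; rewrite paddr_eq0 ?sqr_ge0 //; last exact: sumsq_ge0.
    case/andP=> /eqP h1; rewrite sqrf_eq0 subr_eq0 => /eqP h2; apply: xy.
    apply/proj_eq; exists g => //; apply: val_inj; rewrite gE yE h2; congr (inl (_, _)).
    move: h1; case: (z') (z1) => [a b] [c d]; rewrite /sqnorm /= => /eqP.
    by rewrite sumsq_eq0 !subr_eq0 => /andP[/eqP -> /eqP ->].
  have c0 : 0 < 60%:R * t1 ^+ 2 by rewrite mulr_gt0 // exprn_gt0.
  (* A common point would give D < 2e (t' t + t1 t) <= 60 e t1^2, using t' <= 9 t1 and t < 3 t1. *)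
  exists (Num.min 1 (D / (60%:R * t1 ^+ 2))); first by rewrite lt_min ltr01 divr_gt0.
  set e := Num.min _ _; have e1 : e <= 1 by rewrite ge_min lexx.
  have eD : e * (60%:R * t1 ^+ 2) <= D by rewrite -ler_pdivlMr // ge_min lexx orbT.
  have e0 : 0 < e by rewrite lt_min ltr01 divr_gt0.
  move=> z t hb; have [z'' [t'' [gE' t''0 [_ [a1 a2]] [a3 a4] [b1 b2]]]] := badE _ _ _ _ hb e1.
  rewrite gE in gE'; case: gE' => zE tE; rewrite -zE -tE in t''0 a2 a4 b1.
  have [_ tp _ _] := hb.
  have tt : t' <= 9%:R * t1 by geo_lra.
  have m1 := ler_pM (ltW t''0) (ltW tp) tt (ltW a1).
  have m2 := ler_pM (ltW t10) (ltW tp) (lexx t1) (ltW a1).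
  have m3 : e * (t' * t + t1 * t) <= e * (30%:R * t1 ^+ 2).
    by rewrite ler_pM2l // expr2; geo_lra.
  have n1 := sqnorm_tri z' z z1.
  have n2 : (t' - t1) ^+ 2 <= 2 * ((t' - t) ^+ 2 + (t1 - t) ^+ 2).
    by have := sqr_ge0 (t' - t + (t1 - t)); rewrite !expr2; geo_lra.
  have n3 : sqnorm (z - z1) = sqnorm (z1 - z).
    by case: (z) (z1) => [a b] [c d]; rewrite /sqnorm /=; ring.
  by rewrite /D in eD; geo_lra.
exists ((2 + e) * t0), ((2 + e) * t1).
have e2 : 2 < 2 + e by geo_lra.
split.
- by rewrite mulr_gt0 // addr_gt0.
- by rewrite mulr_gt0 // addr_gt0.
- by apply: orbit_nbhd_self => z t; rewrite xE => -[_ <-]; rewrite ltr_pM2r.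
- by apply: orbit_nbhd_self => z t; rewrite yE => -[_ <-]; rewrite ltr_pM2r.
- move=> n nx ny; have [g [z [t [gG tp lx ly]]]] := orbit_nbhd_meet xy nx ny.
  have hb : bad e g z t by split.
  exact: he (fin _ _ _ _ hb e1) z t hb.
Qed.

Lemma separated_sym (R : realType) (I : prime_idealr (Zi R)) (x y : Hstar R) :
  separated I x y -> separated I y x.
Proof.
by move=> [s1 [s2 [h1 h2 h3 h4 h5]]]; exists s2, s1; split=> // n ny nx; apply: (h5 n).
Qed.

Lemma separated_neq (R : realType) (I : prime_idealr (Zi R)) (x y : Hstar R) :
  proj_quotient I x <> proj_quotient I y -> separated I x y.
Proof.
move=> xy; case xE : (val x) => [[z0 t0]|u]; case yE : (val y) => [[z1 t1]|v].
- exact: separated_inside xy xE yE.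
- by apply/separated_sym/separated_cusp_inside; [exact/nesym|exact: yE|exact: xE].
- exact: separated_cusp_inside xy xE yE.
- exact: separated_cusps xy xE yE.
Qed.

Lemma orbit_nbhd_repr (R : realType) (I : prime_idealr (Zi R)) k s (x : Hstar R) :
  orbit_nbhd I k s (repr (proj_quotient I x)) <-> orbit_nbhd I k s x.
Proof.
have /proj_eq[g gG E] : proj_quotient I x = proj_quotient I (repr (proj_quotient I x)).
  by rewrite /proj_quotient reprK.
split=> h; last by rewrite E; apply: orbit_nbhd_hact.
have [sg _] := gG; have := orbit_nbhd_hact (Gamma0_adj gG) h.
by rewrite E hact_adjK.
Qed.

Lemma hausdorff_cusped_quotient (R : realType) (I : prime_idealr (Zi R)) :
  hausdorff_space (cusped_quotient I).
Proof.
rewrite open_hausdorff => X Y XY.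
have [xX yY] : proj_quotient I (repr X) = X /\ proj_quotient I (repr Y) = Y.
  by rewrite /proj_quotient !reprK.
have [|s1 [s2 [s10 s20 nx ny dis]]] := @separated_neq R I (repr X) (repr Y).
  by rewrite xX yY; apply/eqP.
pose W k s : set (cusped_quotient I) := [set Z | orbit_nbhd I k s (repr Z)].
have oW k s : 0 < s -> open (W k s).
  (* By saturation, the preimage of W under the projection is the orbit neighborhood itself. *)
  move=> s0; suff -> : open (W k s) = Hstar_open (orbit_nbhd I k s) by apply: orbit_nbhd_open.
  congr Hstar_open; apply/seteqP; split=> x /=; by move/orbit_nbhd_repr.
exists (W (mink (val (repr X))) s1, W (mink (val (repr Y))) s2).
  by rewrite !inE.
split; [exact: oW|exact: oW|].
by apply/eqP/seteqP; split=> // Z [] /= h1 h2; apply: dis h1 h2.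
Qed.

(** The inverse of the composite, applied after p, is a continuous inverse of psi. Homeomorphisms
    onto faces in [Hstar] are thus obtained from those in the Hausdorff quotient. *)
Lemma homeo_onto_comp (T U V : topologicalType) (K : set T) (psi : T -> U) (p : U -> V)
    (B : set U) :
  continuous p -> {within K, continuous psi} -> set_bij K B psi ->
  homeo_onto K ((p \o psi) @` K) (p \o psi) -> homeo_onto K B psi.
Proof.
move=> cp cpsi bij [_ [_ [g cg gK]]]; split=> //; split=> //.
have [psiB psi_inj psi_surj] := bij.
exists (g \o p); last by move=> x xK; apply: (gK x xK).
apply/continuous_closedP => C cC; apply/closed_subspaceP.
have /closed_subspaceP[D cD DE] := (continuous_closedP _).1 cg C cC.
exists (p @^-1` D); first exact: ((continuous_closedP p).1 cp).
apply/seteqP; split=> y [h By]; split=> //; have [x Kx xy] := psi_surj y By.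
  have : (D `&` (p \o psi) @` K) (p y) by split=> //; exists x => //; rewrite /= xy.
  by rewrite DE => -[].
have : (from_subspace [set (p \o psi) x | x in K] g @^-1` C `&` (p \o psi) @` K) (p y).
  by split=> //; exists x => //; rewrite /= xy.
by rewrite -DE => -[].
Qed.

(** * The cells of the quotient and their incidences *)

Lemma proj_continuous (R : realType) (I : prime_idealr (Zi R)) :
  continuous (proj_quotient I).
Proof. exact: pi_continuous. Qed.

Lemma chart_images (R : realType) (I : prime_idealr (Zi R)) n (A : 'M[Zi R]_2) S
    (psi : 'rV[R]_n -> Hstar R) :
  set_bij (@disk R n) (tile_face A S) psi ->
  psi @` @open_disk R n = open_tile_face A S ->
  (proj_quotient I \o psi) @` @disk R n = proj_quotient I @` tile_face A S /\
  (proj_quotient I \o psi) @` @open_disk R n = proj_quotient I @` open_tile_face A S.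
Proof.
move=> [pf _ ps] po; split; last by rewrite -po image_comp.
rewrite -image_comp; congr (_ @` _); apply/seteqP; split.
  by move=> _ [x dx <-]; apply: pf.
by move=> y /ps.
Qed.

Lemma card_face_le3 (S : {set octv}) : oct_face S -> S != finset.setTfor octv ->
  (#|S| <= 3)%N.
Proof.
move=> fS ST; have inj : {in S &, injective (fun v : octv => v.1)}.
  move=> u v uS vS uv; have := oct_face_antip fS ST uS.
  case: u v uS vS uv => [k b] [k' b'] /= uS vS kk; rewrite -kk in vS *.
  by case: b b' uS vS => -[] // _ ->.
by rewrite -(card_in_imset inj) -[leqRHS](card_ord 3) max_card.
Qed.

Lemma face_dim_lt (S S' : {set octv}) : oct_face S -> oct_face S' ->
  S' \subset S -> S' != S -> (face_dim S' < face_dim S)%N.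
Proof.
move=> fS fS' S'S ne; have lt : (#|S'| < #|S|)%N.
  by rewrite ltn_neqAle subset_leq_card // andbT; apply: contra ne => /eqP h;
    rewrite eqEcard S'S h leqnn.
have S'T : S' != finset.setTfor octv.
  apply: contraNneq ne => E; rewrite E finset.eqEsubset finset.subsetT andbT.
  by rewrite -E.
rewrite /face_dim (negPf S'T).
have [_|ST] := eqVneq S (finset.setTfor octv).
  by have := card_face_le3 fS' S'T; case: #|S'|.
have : (0 < #|S'|)%N by case/orP: fS' => [fT|/andP[s0 _]]; [rewrite fT in S'T|rewrite card_gt0].
by case: #|S'| #|S| lt => [//|a] [].
Qed.

Lemma face_dim_card (S S' : {set octv}) : #|S| = #|S'| -> face_dim S = face_dim S'.
Proof.
move=> cS; have h (T T' : {set octv}) : #|T| = #|T'| -> T = finset.setTfor octv ->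
    T' = finset.setTfor octv.
  by move=> cT E; apply/eqP; rewrite eqEcard finset.subsetT -E cT leqnn.
rewrite /face_dim cS; case: eqP => [/(h _ _ cS) ->|ST]; first by rewrite eqxx.
by case: eqP => // /(h _ _ (esym cS)).
Qed.

Section Cells.
Context (R : realType) (I : prime_idealr (Zi R)) (q : nat)
  (card_quot : ([set: {ideal_quot I}] #= `I_q)%card)
  (char_quot : 2%N \notin [pchar {ideal_quot I}]) (q_gt5 : (5 < q)%N).

Lemma chart_homeo n (A : 'M[Zi R]_2) S (psi : 'rV[R]_n -> Hstar R) :
  SL2 A -> oct_face S -> {within @disk R n, continuous psi} ->
  set_bij (@disk R n) (tile_face A S) psi ->
  homeo_onto (@disk R n) ((proj_quotient I \o psi) @` @disk R n) (proj_quotient I \o psi).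
Proof.
move=> sA fS cpsi [pf pinj _].
apply: (@compact_homeo _ _ (0 : 'rV[R]_n) (@disk R n) (proj_quotient I \o psi)
  (@compact_disk R n) (@hausdorff_cusped_quotient R I)).
  move=> x; apply: (@continuous_comp _ _ _ (psi : subspace (@disk R n) -> Hstar R)).
    exact: cpsi.
  exact: proj_continuous.
move=> x y; rewrite !inE => dx dy; move/(tile_proj_inj card_quot char_quot q_gt5 sA fS).
by move=> /(_ (pf x dx) (pf y dy)); apply: pinj; rewrite inE.
Qed.

Lemma cell_exists (A : 'M[Zi R]_2) S : SL2 A -> oct_face S ->
  exists2 f, @tiling_cells R I (face_dim S) f &
    f @` @disk R (face_dim S) = proj_quotient I @` tile_face A S /\
    f @` @open_disk R (face_dim S) = proj_quotient I @` open_tile_face A S.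
Proof.
move=> sA fS; have [psi [cpsi bpsi opsi]] := tile_chart sA fS (erefl (face_dim S)).
exists (proj_quotient I \o psi); last exact: chart_images.
exists A, S, psi; split=> //.
apply: (homeo_onto_comp (@proj_continuous R I) cpsi bpsi).
exact: chart_homeo cpsi bpsi.
Qed.

Lemma cellP n (f : 'rV[R]_n -> cusped_quotient I) : tiling_cells f ->
  exists A S, [/\ SL2 A, oct_face S /\ face_dim S = n,
    f @` @disk R n = proj_quotient I @` tile_face A S,
    f @` @open_disk R n = proj_quotient I @` open_tile_face A S &
    homeo_onto (@disk R n) (f @` @disk R n) f].
Proof.
move=> [A [S [psi [sA [fS dS] [bpsi [cpsi _]] opsi ->]]]]; exists A, S.
have [i1 i2] := chart_images I bpsi opsi; split=> //.
exact: chart_homeo sA fS cpsi bpsi.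
Qed.

Lemma finite_matrices : finite_set [set: 'M[{ideal_quot I}]_2].
Proof.
have fQ : finite_set [set: {ideal_quot I}] by exists q.
have -> : [set: 'M[{ideal_quot I}]_2] =
    (fun p => mx22 p.1.1 p.1.2 p.2.1 p.2.2) @`
    (([set: {ideal_quot I}] `*` [set: {ideal_quot I}]) `*`
     ([set: {ideal_quot I}] `*` [set: {ideal_quot I}])).
  apply/seteqP; split=> // B _.
  by exists ((B 0 0, B 0 1), (B 1 0, B 1 1)) => //=; rewrite -mx22E.
by apply: finite_image; do 2?[apply: finite_setX].
Qed.

(** If A and B agree modulo I, then A B^-1 is in the kernel. Open cells are therefore indexed by
    matrices over the finite quotient and sets of vertices. *)
Lemma open_cell_mod (A B : 'M[Zi R]_2) S : SL2 A -> SL2 B ->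
  map_mx \pi_({ideal_quot I})%qT A = map_mx \pi_({ideal_quot I})%qT B ->
  proj_quotient I @` open_tile_face A S = proj_quotient I @` open_tile_face B S.
Proof.
move=> sA sB AB; have sB' := adj_SL2 sB.
have gG : Gamma0 I (A *m \adj B).
  split; first exact: mul_SL2.
  by left; rewrite map_mxM AB -map_mxM adjKr // map_scalar_mx rmorph1.
by rewrite -(proj_open_mul S gG sB) -mulmxA adjK // mulmx1.
Qed.

Lemma finite_cells : finite_set [set c : nat * set (cusped_quotient I) |
  exists2 f, @tiling_cells R I c.1 f & c.2 = f @` @open_disk R c.1].
Proof.
have /boolp.choice[rep repE] : forall B : 'M[{ideal_quot I}]_2, exists A : 'M[Zi R]_2,
    (exists2 A', SL2 A' & map_mx \pi_({ideal_quot I})%qT A' = B) ->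
    SL2 A /\ map_mx \pi_({ideal_quot I})%qT A = B.
  move=> B; have [[A sA AB]|no] := pselect (exists2 A', SL2 A' &
      map_mx \pi_({ideal_quot I})%qT A' = B); first by exists A.
  by exists 0 => /no.
pose h (p : 'M[{ideal_quot I}]_2 * {set octv}) :=
  (face_dim p.2, proj_quotient I @` open_tile_face (rep p.1) p.2).
apply: (sub_finite_set (B := h @` ([set: 'M[{ideal_quot I}]_2] `*` [set: {set octv}]))).
  move=> [n c] /= [f /cellP[A [S [sA [fS dS] _ oE _]]] ->].
  exists (map_mx \pi_({ideal_quot I})%qT A, S) => //.
  have [sA' AE] := repE _ (ex_intro2 _ _ A sA erefl).
  by rewrite /h /= dS oE (open_cell_mod S sA' sA AE).
apply: finite_image; apply: finite_setX; first exact: finite_matrices.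
exact: finite_finset.
Qed.

Lemma tiling_finite_CW : finite_CW (@tiling_cells R I).
Proof.
split.
- exact: hausdorff_cusped_quotient.
- exact: finite_cells.
- move=> X; have [A [S [sA fS oX]]] := Hstar_cover (repr X).
  have [f fP [_ fo]] := cell_exists sA fS; exists (face_dim S), f => //.
  by rewrite fo; exists (repr X) => //; rewrite /proj_quotient reprK.
- move=> n m f g /cellP[A [S [sA [fS dS] _ fo _]]] /cellP[B [S' [sB [fS' dS'] _ go _]]].
  rewrite fo go => /(proj_open_disjoint sA sB fS fS')[cS ->]; split=> //.
  by rewrite -dS -dS' (face_dim_card cS).
- by move=> n f /cellP[A [S [_ _ _ _ [_ [cf _]]]]].
- move=> n f /cellP[A [S [_ _ _ _ hf]]].
  exact: homeo_ontoW (@open_disk_sub R n) hf.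
- move=> n f [A [S [psi [sA [fS dS] [[pf pinj _] _] opsi ->]]]] x [dx nox].
  have cx := (tile_faceE S (psi x) sA).1 (pf x dx).
  have [S1 [S1S fS1 oS1]] := cone_face sA fS cx (mink_neq0 _).
  (* If psi x were interior to the face S itself, injectivity of psi would put x in the open
     disk. *)
  have S1n : S1 != S.
    apply/eqP => E; apply: nox; rewrite E in oS1.
    have : open_tile_face A S (psi x) by apply/open_tile_faceE.
    rewrite -opsi => -[y oy yx]; suff <- : y = x by [].
    by apply: pinj; rewrite ?inE //; apply: open_disk_sub.
  have [g gP [_ go]] := cell_exists sA fS1; exists (face_dim S1).
  split; first by rewrite -dS; apply: face_dim_lt.
  by exists g => //; rewrite go; exists (psi x) => //; apply/open_tile_faceE.
Qed.

Lemma tiling_strongly_regular : strongly_regular_cellulation (@tiling_cells R I).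
Proof.
split; first by split; [exact: tiling_finite_CW|move=> n f /cellP[A [S []]]].
move=> n m f g /cellP[A [S [sA [fS dS] fd _ _]]] /cellP[B [S' [sB [fS' dS'] gd _ _]]].
rewrite fd gd.
have [E|[W fW E]] := proj_tile_inter card_quot char_quot q_gt5 sA sB fS fS'; first by left.
right; have [h hP [hd _]] := cell_exists sA fW; exists (face_dim W), h => //.
by rewrite E hd.
Qed.
End Cells.

Theorem theorem2p2 (R : realType) (I : prime_idealr (Zi R)) (q : nat)
    (card_quot : ([set: {ideal_quot I}] #= `I_q)%card)
    (char_quot : 2%N \notin [pchar {ideal_quot I}])
    (q_gt5 : (5 < q)%N) :
  strongly_regular_cellulation (@tiling_cells R I).
Proof. exact: (tiling_strongly_regular card_quot char_quot q_gt5). Qed.
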